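(* The utility value of lifetime labor $$\mathcal P(y)=\sup_{\tau\in\mathcal S}\mathbb E\left[\int_0^\tau e^{-\rho t}\big(\tilde u_B(\mathcal Y_t^y)-\tilde u_A(\mathcal Y_t^y)+\mathcal Y_t^y\epsilon\big)dt\right],\qquad y>0,$$ is given by $$\mathcal P(y)=\begin{cases}Dy^{n_2}+\Xi_h(y), & y\ge z_R,\\ 0, & 0<y\le z_R,\end{cases}$$ where $z_R\in(0,\bar z)$ is the unique solution of the equation $$\int_{z_R}^\infty\nu^{-n_1-1}h(\nu)\,d\nu=0$$ and $$D=-\frac{2}{\theta^2(n_1-n_2)}\int_0^{z_R}\nu^{-n_2-1}h(\nu)\,d\nu.$$ Moreover, the optimal stopping time is $\tau_R(y)=\inf\{t\ge0:\ \mathcal Y_t^y\le z_R\}$, that is, $$\mathcal P(y)=\mathbb E\left[\int_0^{\tau_R(y)}e^{-\rho t}\big(\tilde u_B(\mathcal Y_t^y)-\tilde u_A(\mathcal Y_t^y)+\mathcal Y_t^y\epsilon\big)dt\right].$$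
   Context: Constants: $r>0$, $\rho>0$, $\mu>0$, $\sigma>0$, $\epsilon>0$, with $\mu\ne r$; $\theta=\frac{\mu-r}{\sigma}$. $B$ is a standard Brownian motion, $\mathcal F$ its augmented filtration, $\xi_t=e^{-rt-\frac12\theta^2t-\theta B_t}$, and $\mathcal Y^y_t=ye^{\rho t}\xi_t$ for $y>0$. $\mathcal S$ is the set of all $\mathcal F$-stopping times with values in $[0,\infty]$. $n_1>0$ and $n_2<0$ are the roots of $\frac{\theta^2}{2}n^2+(\rho-r-\frac{\theta^2}{2})n-\rho=0$. Class $\Sigma$: let $\mathcal D=[0,\infty)$ or $(0,\infty)$. $\Sigma$ is the set of functions $u:\mathcal D\to\mathbb R$ such that (i) $u$ is strictly increasing, strictly concave, continuously differentiable, with $\lim_{c\to\infty}u'(c)=0$; $I_u:(0,u'(0))\to(0,\infty)$ denotes the inverse of $u'$ (where $u'(0)=\lim_{c\downarrow0}u'(c)\in(0,\infty]$), extended by $I_u(y)=0$ for $y\ge u'(0)$; (ii) $\int_0^y\eta^{-n_2}I_u(\eta)\,d\eta<\infty$ for every $y>0$. By convention $u(0)=\lim_{c\downarrow0}u(c)$. The conjugate of $u$ is $\tilde u(y)=\sup_{c\ge0}(u(c)-yc)=u(I_u(y))-yI_u(y)$, $y>0$. Standing assumptions: $u_B,u_A\in\Sigma$ and $u_B(I_{u_B}(y))<u_A(I_{u_A}(y))$ for all $y>0$; and $\lim_{y\to0+}\Psi(y)<0$, where $\Psi(y)=\frac1y(\tilde u_B(y)-\tilde u_A(y))+\epsilon$.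 Under these assumptions $\Psi$ is strictly increasing with $\lim_{y\to\infty}\Psi(y)=\epsilon$, and $\bar z>0$ denotes its unique zero. $h(y)=y\Psi(y)=\tilde u_B(y)-\tilde u_A(y)+\epsilon y$. For a function $f$ on $(0,\infty)$ for which the integrals converge, $$\Xi_f(y)=\frac{2}{\theta^2(n_1-n_2)}\left[y^{n_2}\int_0^y\nu^{-n_2-1}f(\nu)\,d\nu+y^{n_1}\int_y^\infty\nu^{-n_1-1}f(\nu)\,d\nu\right].$$ *)

(* Defs.v *)
From HB Require Import structures.
From mathcomp Require Import all_boot all_order all_algebra.
From mathcomp Require Import all_classical all_reals all_analysis.

Set Implicit Arguments.
Unset Strict Implicit.
Unset Printing Implicit Defensive.

Import Order.TTheory GRing.Theory Num.Theory.
Import numFieldNormedType.Exports.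

Local Open Scope classical_set_scope.
Local Open Scope ring_scope.

Section utility.
Context {R : realType}.
Implicit Types (u : R -> R) (c y : R).

(* A utility function is a total function on [R]; only its values on its domain
   [D], which is [0, +oo[ or ]0, +oo[, are meaningful. *)

(* u'(0) = lim_(c -> 0+) u'(c), possibly +oo *)
Definition marginal0 u : \bar R := lim ((derive1 u c)%:E @[c --> 0^'+]).

(* The inverse of u' : ]0, +oo[ -> ]0, u'(0)[, extended by 0 on [u'(0), +oo[. *)
Definition inverse_marginal u y : R :=
  if (0 < y) && (y%:E < marginal0 u)%E
  then xget 0 [set c | 0 < c /\ derive1 u c = y] else 0.

(* u(c) for c >= 0, with u(0) = lim_(c -> 0+) u(c), possibly -oo (only when
   u'(0) = +oo). *)
Definition utility_value u c : \bar R :=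
  if 0 < c then (u c)%:E else lim ((u x)%:E @[x --> 0^'+]).

(* The supremum is taken in [\bar R] because u(0) may be -oo; for u in the class
   below and y > 0 it is finite. *)
Definition conjugate u y : R :=
  fine (ereal_sup [set (utility_value u c - (y * c)%:E)%E | c in `[0, +oo[]).

Definition strictly_concave_on (D : set R) u : Prop :=
  forall a b t, D a -> D b -> a != b -> 0 < t < 1 ->
    t * u a + (1 - t) * u b < u (t * a + (1 - t) * b).

(* When 0 belongs to D, u is only required to be continuous there, so that
   u'(0) = +oo remains possible. *)
Record utility_class (n2 : R) (D : set R) u : Prop := UtilityClass {
  utility_domain : D = [set` `[0, +oo[] \/ D = [set` `]0, +oo[] ;
  utility_incr : forall a b, D a -> D b -> a < b -> u a < u b ;
  utility_concave : strictly_concave_on D u ;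
  utility_continuous : {within D, continuous u} ;
  utility_derivable : forall c, 0 < c -> derivable u c 1 ;
  utility_C1 : forall c, 0 < c -> {for c, continuous (derive1 u)} ;
  utility_marginal_pinfty : derive1 u c @[c --> +oo] --> (0 : R) ;
  utility_integral : forall y, 0 < y ->
    (\int[lebesgue_measure]_(eta in `]0%R, y[)
       (eta `^ (- n2) * inverse_marginal u eta)%:E < +oo)%E }.

End utility.

Section brownian.
Context {R : realType} {d : measure_display} {Omega : measurableType d}.
Variables (P : probability Omega R) (B : R -> Omega -> R).

(* Processes are indexed by [R]; only the times t >= 0 are meaningful. *)

Definition natural_filtration (t : R) : set (set Omega) :=
  <<s [set A | exists (s : R) (C : set R),
         [/\ 0 <= s <= t, measurable C & A = B s @^-1` C]] >>.

(* The augmentation is by the null sets of the ambient sigma-algebra; when P is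
   complete these are all the P-negligible sets. *)
Definition augmented_filtration (t : R) : set (set Omega) :=
  <<s natural_filtration t `|` [set N | measurable N /\ P N = 0%E] >>.

Definition increment (s t : R) (w : Omega) : R := B t w - B s w.

Record standard_brownian_motion : Prop := StandardBrownianMotion {
  brownian_measurable : forall t : R, 0 <= t -> measurable_fun setT (B t) ;
  brownian0 : {ae P, forall w, B 0 w = 0} ;
  brownian_continuous :
    forall w, {within `[0, +oo[, continuous (fun t => B t w)} ;
  brownian_independent : forall (s t : R) (A : set Omega) (C : set R),
    0 <= s < t -> natural_filtration s A -> measurable C ->
    P (A `&` increment s t @^-1` C) = (P A * P (increment s t @^-1` C))%E ;
  brownian_normal : forall (s t : R) (C : set R), 0 <= s < t -> measurable C ->
    P (increment s t @^-1` C) = normal_prob 0 (Num.sqrt (t - s)) C }.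

Definition stopping_time (tau : Omega -> \bar R) : Prop :=
  (forall w, 0 <= tau w)%E /\
  forall t : R, 0 <= t -> augmented_filtration t [set w | (tau w <= t%:E)%E].

Variables (r rho theta : R).

Definition state_price (t : R) (w : Omega) : R :=
  expR (- r * t - theta ^+ 2 / 2 * t - theta * B t w).

Definition dual_process (y t : R) (w : Omega) : R :=
  y * expR (rho * t) * state_price t w.

(* E[ \int_0^tau e^(- rho t) f(Y_t^y) dt ] *)
Definition stopped_value (f : R -> R) (y : R) (tau : Omega -> \bar R) : \bar R :=
  (\int[P]_w \int[lebesgue_measure]_(t in [set t | (0 <= t)%R /\ t%:E <= tau w])
     (expR (- rho * t) * f (dual_process y t w))%:E)%E.

Definition optimal_value (f : R -> R) (y : R) : \bar R :=
  ereal_sup [set stopped_value f y tau | tau in stopping_time].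

Definition hitting_time (z y : R) (w : Omega) : \bar R :=
  ereal_inf [set t%:E | t in [set t | 0 <= t /\ dual_process y t w <= z]].

End brownian.

Section retirement.
Context {R : realType}.
Implicit Types (uB uA f : R -> R) (eps y z : R).

Definition Psi uB uA eps y : R := (conjugate uB y - conjugate uA y) / y + eps.

Definition labor_flow uB uA eps y : R :=
  conjugate uB y - conjugate uA y + y * eps.

Variables (theta n1 n2 : R).

Definition lower_integral f y : R :=
  \int[lebesgue_measure]_(nu in `]0, y[) (nu `^ (- n2 - 1) * f nu).

Definition upper_integral f y : R :=
  \int[lebesgue_measure]_(nu in `]y, +oo[) (nu `^ (- n1 - 1) * f nu).

(* [Rintegral] returns a default value on a divergent integral; this states that
   the integrals defining Xi_f converge. *)
Definition Xi_converges f : Prop := forall y, 0 < y ->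
  lebesgue_measure.-integrable `]0, y[
    (fun nu : R => (nu `^ (- n2 - 1) * f nu)%:E) /\
  lebesgue_measure.-integrable `]y, +oo[
    (fun nu : R => (nu `^ (- n1 - 1) * f nu)%:E).

Definition Xi f y : R :=
  2 / (theta ^+ 2 * (n1 - n2)) *
  (y `^ n2 * lower_integral f y + y `^ n1 * upper_integral f y).

Definition homogeneous_coef f z : R :=
  - (2 / (theta ^+ 2 * (n1 - n2))) * lower_integral f z.

End retirement.

(* Main.v *)
(* Let h be the running reward and h_+ its restriction to [zR, +oo[.  The value
   function is v = Xi_(h_+): on ]0, zR] it vanishes by the choice of zR, and on
   [zR, +oo[ it is D y^n2 + Xi_h(y).  No Ito calculus is needed: Xi_f(y) is the
   expected total discounted reward of f along the dual process started at y,
   because ln Y is a drifted Brownian motion whose resolvent kernel is explicit.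
   By the Markov property, the reward collected after a stopping time tau equals
   E[e^(-rho tau) Xi_f(Y_tau)] for tau on a grid, and grids approximate any tau
   from above.  Since h <= h_+ on ]0, +oo[ and v >= 0, stopping at tau never
   earns more than v(y).  For the hitting time of zR the reward of h_+ collected
   afterwards is E[e^(-rho tau) v(min(y, zR))] = 0, and h = h_+ before it.

   The sign condition v >= 0 and the uniqueness of zR come from h changing sign
   exactly once, at zbar: Psi is increasing, as its derivative at y is
   (u_A(I_A(y)) - u_B(I_B(y))) / y^2. *)

From HB Require Import structures.
Require Import Defs.
From mathcomp Require Import all_boot all_order all_algebra.
From mathcomp Require Import all_classical all_reals all_analysis.
From mathcomp Require Import measurable_realfun ring lra.

Set Implicit Arguments.
Unset Strict Implicit.
Unset Printing Implicit Defensive.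

Import Order.TTheory GRing.Theory Num.Theory.
Import numFieldNormedType.Exports.

Local Open Scope classical_set_scope.
Local Open Scope ring_scope.

(** * Changes of variables *)

(** The restart formula is needed only at deterministic times: when a stopping time is rounded up to
    a grid, the event that it is rounded to [k / n.+1] is known at that time, so independence of
    increments suffices and the strong Markov property is not invoked. Two obstacles shape the
    proof. Independence is assumed for the natural filtration, whereas stopping times refer to the
    augmented one, so events are first corrected by null sets. And [Xi] need not be bounded, so the
    limit at the hitting time is taken for rewards cut off to [[z, m]], and [m] is sent to infinity
    afterwards. Rewards are integrals over regions of the product [P \x mu], before or after the
    stopping time; absolute convergence there comes from the restart formula itself, applied at time
    0 to the positive and negative parts. The kernel behind [Xi] is obtained by integrating the
    Gaussian transition density over time, with an explicit antiderivative made of two normal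
    distribution functions; completing the square in the exponent produces the roots n1 and n2. *)

Definition image_measure d1 d2 (T1 : measurableType d1) (T2 : measurableType d2)
    (R : realType) (m : {measure set T1 -> \bar R}) (f : T1 -> T2)
    (mf : measurable_fun setT f) : {measure set T2 -> \bar R} :=
  measure_function_pushforward__canonical__measure_function_Measure m mf.

Lemma ge0_integral_image d1 d2 (T1 : measurableType d1) (T2 : measurableType d2)
    (R : realType) (m : {measure set T1 -> \bar R}) (f : T1 -> T2)
    (mf : measurable_fun setT f) (g : T2 -> \bar R) :
  measurable_fun setT g -> (forall y, 0 <= g y)%E ->
  (\int[image_measure m mf]_y g y = \int[m]_x g (f x))%E.
Proof. by move=> mg g0; rewrite ge0_integral_pushforward. Qed.

Section density.
Local Open Scope ereal_scope.
Context d (T : measurableType d) (R : realType).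
Variables (m1 m2 : {measure set T -> \bar R}) (p : T -> R).
Hypotheses (mp : measurable_fun setT p) (p0 : forall x, (0 <= p x)%R).
Hypothesis m2E : forall E, measurable E -> m2 E = \int[m1]_(x in E) (p x)%:E.
Import HBNNSimple.

(** By monotone convergence both sides are limits along the simple functions approximating [f]; by
    additivity and homogeneity only indicators remain, and for these the claim is [m2E]. *)
Lemma ge0_integral_density (f : T -> \bar R) :
  measurable_fun setT f -> (forall x, 0 <= f x) ->
  \int[m2]_x f x = \int[m1]_x (f x * (p x)%:E).
Proof.
move=> mf f0; pose h := nnsfun_approx measurableT mf.
have cvgh x : (h n x)%:E @[n --> \oo] --> f x.
  exact: (cvg_nnsfun_approx measurableT mf).
have ndh x : {homo (fun n => (h n x)%:E) : a b / (a <= b)%N >-> a <= b}.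
  by move=> a b ab; rewrite lee_fin; exact/lefP/nd_nnsfun_approx.
have mep : measurable_fun setT (fun x => (p x)%:E) by exact/measurable_EFinP.
have -> : \int[m2]_x f x = limn (fun n => \int[m2]_x (h n x)%:E).
  under eq_integral => x _ do rewrite -(cvg_lim _ (cvgh x))//.
  apply: monotone_convergence => //.
  - by move=> n; exact/measurable_EFinP/measurable_funP.
  - by move=> n x _; rewrite lee_fin.
have -> : \int[m1]_x (f x * (p x)%:E) =
          limn (fun n => \int[m1]_x ((h n x)%:E * (p x)%:E)).
  under eq_integral => x _.
    rewrite -(cvg_lim _ (cvgeZr (y := (p x)%:E) _ (cvgh x)))//.
    over.
  apply: monotone_convergence => //.
  - move=> n; apply: emeasurable_funM => //.
    exact/measurable_EFinP/measurable_funP.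
  - by move=> n x _; rewrite mule_ge0// lee_fin.
  - by move=> x _ a b ab; rewrite lee_wpmul2r ?lee_fin// -lee_fin; exact: ndh.
congr (limn _); apply/funext => n.
transitivity (\int[m2]_x
   (\sum_(y \in range (h n)) (y * \1_(h n @^-1` [set y]) x)%:E)).
  by apply: eq_integral => t _; rewrite /= fimfunE -fsumEFin.
have indich r : measurable_fun setT (fun x => (r * \1_(h n @^-1` [set r]) x)%:E).
  by apply: (measurable_comp measurableT) => //; exact: measurable_funM.
rewrite ge0_integral_fsum//; last by move=> m y _; exact: nnfun_muleindic_ge0.
transitivity (\int[m1]_x (\sum_(y \in range (h n))
    (y * \1_(h n @^-1` [set y]) x)%:E * (p x)%:E)); last first.
  apply: eq_integral => x _.
  rewrite -ge0_mule_fsuml => [|y]; last exact: nnfun_muleindic_ge0.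
  by rewrite fsumEFin // -(fimfunE _ x).
rewrite ge0_integral_fsum//; last 2 first.
  - by move=> y; apply: emeasurable_funM.
  - by move=> m y _; rewrite mule_ge0 ?lee_fin// -lee_fin nnfun_muleindic_ge0.
apply: eq_fsbigr => r rhn.
have r0 : (0 <= r)%R by move: rhn; rewrite inE => -[t _ <-].
have mr : measurable (h n @^-1` [set r]) by exact: measurable_sfunP.
under eq_integral do rewrite EFinM.
rewrite ge0_integralZl_EFin//; last exact/measurable_EFinP.
under [RHS]eq_integral do rewrite EFinM -muleA.
rewrite ge0_integralZl_EFin//; last 2 first.
  - by move=> x _; rewrite mule_ge0 ?lee_fin.
  - by apply: emeasurable_funM => //; exact/measurable_EFinP.
rewrite integral_indic// setIT m2E//; congr (_ * _).
rewrite integral_mkcond; apply: eq_integral => x _.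
by rewrite muleC patchE indicE; case: ifPn => _; rewrite ?mule1 ?mule0.
Qed.

End density.

Section density_measure.
Local Open Scope ereal_scope.
Context d (T : measurableType d) (R : realType).
Variables (m : {measure set T -> \bar R}) (p : T -> R).
Hypotheses (mp : measurable_fun setT p) (p0 : forall x, (0 <= p x)%R).

(** The proofs of measurability and nonnegativity are arguments so that the measure structure
    declared below can be inferred from the term. *)
Definition density_measure of measurable_fun setT p & (forall x, (0 <= p x)%R) :=
  fun E : set T => \int[m]_(x in E) (p x)%:E.

Local Notation mu := (density_measure mp p0).

Let mu0 : mu set0 = 0. Proof. exact: integral_set0. Qed.

Let mu_ge0 E : 0 <= mu E.
Proof. by apply: integral_ge0 => x _; rewrite lee_fin. Qed.

Let mu_sigma_additive : semi_sigma_additive mu.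
Proof.
move=> /= F mF tF mUF.
rewrite /density_measure ge0_integral_bigcup//=; last 2 first.
- by apply/measurable_funTS/measurable_EFinP.
- by move=> x _; rewrite lee_fin.
apply: is_cvg_ereal_nneg_natsum_cond => n _ _.
by apply: integral_ge0 => x _; rewrite lee_fin.
Qed.

HB.instance Definition _ := isMeasure.Build _ _ _ mu mu0 mu_ge0 mu_sigma_additive.

End density_measure.

Lemma ge0_integral_mrestr d (T : measurableType d) (R : realType)
    (m : {measure set T -> \bar R}) (D : set T) (mD : measurable D)
    (f : T -> \bar R) : measurable_fun setT f -> (forall x, 0 <= f x)%E ->
  (\int[mrestr m mD]_x f x = \int[m]_(x in D) f x)%E.
Proof.
move=> mf f0; rewrite (ge0_integral_density (m1 := m) (p := \1_D))//.
- rewrite [RHS]integral_mkcond; apply: eq_integral => x _.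
  by rewrite patchE indicE; case: ifPn => _; rewrite ?mule1 ?mule0.
- by move=> E mE; rewrite integral_indic// setIC.
Qed.

Section change_of_variables.
Local Open Scope ereal_scope.
Context {R : realType}.
Notation mu := (@lebesgue_measure R).

(** The image of Lebesgue measure under [z |-> a + b * z], scaled by [|b|], gives every interval
    []x, y]] its length, hence is Lebesgue measure. For [b < 0] the preimage of []x, y]] is closed
    on the left and open on the right, which has the same length. *)
Lemma ge0_integral_affine (f : R -> \bar R) (a b : R) : (b != 0)%R ->
  measurable_fun setT f -> (forall x, 0 <= f x) ->
  \int[mu]_x f x = `|b|%:E * \int[mu]_z f (a + b * z)%R.
Proof.
move=> b0 mf f0.
have nb0 : (0 <= `|b|)%R by [].
have mphi : measurable_fun setT
    ((fun z => a + b * z)%R : measurableTypeR R -> measurableTypeR R).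
  by apply: measurable_funD => //; exact: measurable_funM.
pose m := mscale (NngNum nb0) (image_measure mu mphi).
have mE A : measurable A -> mu A = m A.
  apply: lebesgue_measure_unique => _ [[x y]] _ <-.
  change (mu `]x, y] = `|b|%:E * mu ((fun z => a + b * z)%R @^-1` `]x, y])).
  have [b_gt0|] := ltP 0%R b; last first.
    rewrite le_eqVlt (negbTE b0)/= => b_lt0.
    rewrite [X in _ * mu X](_ : _ = [set` `[((y - a) / b)%R, ((x - a) / b)%R[]);
      last first.
      apply/seteqP; split => z /=; rewrite !in_itv/=.
        by rewrite ler_ndivrMr// ltr_ndivlMr//; lra.
      by rewrite ler_ndivrMr// ltr_ndivlMr//; lra.
    rewrite !lebesgue_measure_itv/= !lte_fin ltr_nM2r ?invr_lt0// ltrD2r.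
    case: ifPn => xy; last by rewrite mule0.
    rewrite ltr0_norm// -!EFinB -EFinM; congr EFin; by field.
  rewrite [X in _ * mu X](_ : _ = [set` `]((x - a) / b)%R, ((y - a) / b)%R]]);
    last first.
    apply/seteqP; split => z /=; rewrite !in_itv/=.
      by rewrite ltr_pdivrMr// ler_pdivlMr//; lra.
    by rewrite ltr_pdivrMr// ler_pdivlMr//; lra.
  rewrite !lebesgue_measure_itv/= !lte_fin ltr_pM2r ?invr_gt0// ltrD2r.
  case: ifPn => xy; last by rewrite mule0.
  rewrite gtr0_norm// -!EFinB -EFinM; congr EFin; by field.
transitivity (\int[m]_x f x).
  by apply: eq_measure_integral => //= A mA _; exact: mE.
rewrite /m ge0_integral_mscale//=; congr (_ * _).
exact: ge0_integral_image.
Qed.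

(** The image under [ln] of Lebesgue measure on []0, +oo[] has density [expR]: on []x, y]] this is
    the fundamental theorem of calculus, and the intervals []-n, n]] provide the finite cover needed
    for uniqueness of measures. *)
Lemma ge0_integral_expR (f : R -> \bar R) :
  measurable_fun setT f -> (forall x, 0 <= f x) ->
  \int[mu]_(x in `]0%R, +oo[) f x = \int[mu]_u (f (expR u) * (expR u)%:E).
Proof.
move=> mf f0.
have mln : measurable_fun setT (@ln R : measurableTypeR R -> measurableTypeR R).
  exact: measurable_ln.
have mexp : measurable_fun setT (@expR R) by exact: measurable_expR.
have exp0 x : (0 <= expR x :> R)%R by exact: expR_ge0.
have mpos : measurable (`]0%R, +oo[%classic : set R) by [].
pose m2 := image_measure (mrestr mu mpos) mln.
have ocE (x y : R) : m2 `]x, y]%classic = density_measure mu mexp exp0 `]x, y]%classic.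
  change (mu (@ln R @^-1` `]x, y] `&` `]0%R, +oo[) =
    density_measure mu mexp exp0 `]x, y]).
  have -> : (@ln R) @^-1` `]x, y] `&` `]0%R, +oo[ =
      [set` `](expR x), (expR y)]].
    apply/seteqP; split => z /=; rewrite !in_itv/= ?andbT.
      move=> [/andP[xz zy] z0].
      by rewrite -[z]lnK ?posrE// ltr_expR ler_expR xz.
    move=> /andP[xz zy]; have z0 : (0 < z)%R by rewrite (lt_trans _ xz)// expR_gt0.
    by rewrite -ler_expR -ltr_expR lnK ?posrE// xz zy.
  rewrite lebesgue_measure_itv/= lte_fin ltr_expR /density_measure.
  case: ltP => xy; last by rewrite set_itv_ge -?leNgt ?bnd_simp// integral_set0.
  rewrite integral_itv_obnd_cbnd; last exact/measurable_EFinP/measurable_funTS.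
  rewrite (continuous_FTC2 (F := expR) xy) //.
  - by apply: continuous_subspaceT => ?; exact: continuous_expR.
  - split; first by move=> ? _; exact: derivable_expR.
    + by apply: cvg_at_right_filter; exact: continuous_expR.
    + by apply: cvg_at_left_filter; exact: continuous_expR.
  - by move=> z _; rewrite derive1E; exact: derive_val.
transitivity (\int[m2]_x (f (expR x))).
  rewrite /m2 ge0_integral_image//=; last by apply: measurableT_comp.
  rewrite ge0_integral_mrestr//; last first.
    by apply: measurableT_comp => //; apply: measurableT_comp.
  apply: eq_integral => x; rewrite inE/= in_itv/= andbT => x0.
  by rewrite lnK.
rewrite (@ge0_integral_density _ _ _ mu m2 expR)//; last by apply: measurableT_comp.
move=> E mE.
have -> : \int[mu]_(x in E) (expR x)%:E = density_measure mu mexp exp0 E by [].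
apply: (@measure_unique _ R (measurableTypeR R) (@ocitv R) (fun n => `](- n%:R)%R, n%:R]%classic)) => //.
- exact: ocitvI.
- by move=> n; exact: is_ocitv.
- apply/seteqP; split => // x _; exists (Num.truncn `|x|).+1 => //=.
  have := truncnS_gt `|x|; rewrite ltr_norml in_itv/= => /andP[-> /ltW->].
  by [].
- by move=> _ [[a b] _ <-]; exact: ocE.
- move=> k.
  change (mu (@ln R @^-1` `](- k%:R)%R, k%:R] `&` `]0%R, +oo[) < +oo).
  apply: (@le_lt_trans _ _ (mu `](0:R)%R, (expR k%:R)])).
    apply: le_measure; rewrite ?inE//.
      by apply: measurableI => //; rewrite -[X in measurable X]setTI; exact: (mln measurableT).
    move=> z /=; rewrite !in_itv/= andbT => -[/andP[_ zk] z0].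
    by rewrite z0/= -[z]lnK ?posrE// ler_expR.
  by rewrite lebesgue_measure_itv/=; case: ifP => _; rewrite ?ltry// ltry.
Qed.

End change_of_variables.

(** * Laplace transform of the Gaussian kernel in time *)

Section normal_cdf.
Context {R : realType}.

Definition normal_cdf (x : R) : R :=
  \int[lebesgue_measure]_(u in `]-oo, x]) normal_pdf 0 1 u.

Lemma normal_cdfE (x : R) :
  (normal_cdf x)%:E = normal_prob 0 1 `]-oo, x]%classic.
Proof.
rewrite /normal_cdf /Rintegral fineK// /normal_prob.
apply: integrable_fin_num => //.
by apply: (integrableS measurableT) => //; exact: integrable_normal_pdf.
Qed.

Lemma is_derive_normal_cdf (x : R) : is_derive x 1 normal_cdf (normal_pdf 0 1 x).
Proof.
have cn : continuous (@normal_pdf R 0 1) by exact: continuous_normal_pdf.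
have xx1 : x < x + 1 by rewrite ltrDl.
have [] := @continuous_FTC1 R (normal_pdf 0 1) -oo%O x (x + 1) xx1.
- by apply: (integrableS measurableT) => //; exact: integrable_normal_pdf.
- by rewrite ltNyr.
- exact: cn.
by move=> d1; rewrite derive1E => d2; apply: DeriveDef.
Qed.

(** The identity, seen as a random variable under [normal_prob 0 1], has [normal_cdf] as its
    distribution function; this gives access to the general limits of distribution functions at both
    infinities. *)
Let idTR : measurableTypeR R -> R := idfun.

#[local] HB.instance Definition _ :=
  @isMeasurableFun.Build _ _ _ _ idTR (@measurable_id _ _ setT).

Lemma normal_cdf_pinfty : normal_cdf x @[x --> +oo] --> (1 : R).
Proof.
have := @cvg_cdfy1 _ _ _ (normal_prob (0 : R) 1) idTR.
move=> /fine_cvg; apply: cvg_trans.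
apply: near_eq_cvg; apply: nearW => x /=.
by rewrite -[LHS]/(fine (normal_cdf x)%:E) normal_cdfE.
Qed.

Lemma normal_cdf_ninfty : normal_cdf x @[x --> -oo] --> (0 : R).
Proof.
have := @cvg_cdfNy0 _ _ _ (normal_prob (0 : R) 1) idTR.
move=> /fine_cvg; apply: cvg_trans.
apply: near_eq_cvg; apply: nearW => x /=.
by rewrite -[LHS]/(fine (normal_cdf x)%:E) normal_cdfE.
Qed.

End normal_cdf.

Section gauss_inverse_time.
Context {R : realType}.
Notation mu := (@lebesgue_measure R).
Variables (m a : R).
Hypotheses (m0 : 0 < m) (a0 : 0 < a).

(** An antiderivative for the Gaussian kernel in the variable [s], the square root of rescaled time.
    Both products, of [exp(-am)] with the normal density at [m s - a/s] and of [exp(am)] with that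
    at [m s + a/s], equal the same Gaussian expression in [(m s)^2 + (a/s)^2]; the inner derivatives
    [m + a/s^2] and [m - a/s^2] therefore add up to [2 m]. *)
Let H (s : R) := expR (- (a * m)) * normal_cdf (m * s - a / s)
               + expR (a * m) * normal_cdf (m * s + a / s).

Let is_derive_H (s : R) : 0 < s ->
  is_derive s 1 H
   (2 * m * normal_peak 1 * expR (- ((m * s) ^+ 2 + (a / s) ^+ 2) / 2)).
Proof.
move=> s0; have sn0 : s != 0 by rewrite gt_eqF.
have dV : is_derive s 1 (fun s : R => s^-1) (- s ^- 2).
  apply: is_derive_eq; first by apply: is_deriveV.
  by rewrite /GRing.scale/= mulr1.
have d1 : is_derive s 1 (fun s => m * s - a / s) (m + a / s ^+ 2).
  apply: is_derive_eq; rewrite /GRing.scale/=; ring.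
have d2 : is_derive s 1 (fun s => m * s + a / s) (m - a / s ^+ 2).
  apply: is_derive_eq; rewrite /GRing.scale/=; ring.
have d3 := @is_derive1_comp _ _ _ _ _ _ (is_derive_normal_cdf _) d1.
have d4 := @is_derive1_comp _ _ _ _ _ _ (is_derive_normal_cdf _) d2.
apply: is_derive_eq.
rewrite /GRing.scale/= !normal_pdfE ?oner_neq0// /normal_fun.
have e1 : expR (- (a * m)) * expR (- (m * s - a / s - 0) ^+ 2 / (1 ^+ 2 *+ 2))
    = expR (- ((m * s) ^+ 2 + (a / s) ^+ 2) / 2).
  by rewrite -expRD; congr expR; field.
have e2 : expR (a * m) * expR (- (m * s + a / s - 0) ^+ 2 / (1 ^+ 2 *+ 2))
    = expR (- ((m * s) ^+ 2 + (a / s) ^+ 2) / 2).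
  by rewrite -expRD; congr expR; field.
rewrite !mulrA [X in X * (m + _)]mulrAC e1 [X in X * (m - _)]mulrAC e2.
by field.
Qed.

Let H_pinfty : H s @[s --> +oo] --> expR (- (a * m)) + expR (a * m).
Proof.
have c1 : (fun s => m * s - a / s) s @[s --> +oo] --> +oo.
  apply/cvgryPge => A; near=> s.
  have s1 : 1 <= s by near: s; apply: nbhs_pinfty_ge; rewrite num_real.
  have sA : (A + a) / m <= s by near: s; apply: nbhs_pinfty_ge; rewrite num_real.
  rewrite ler_pdivrMr// in sA.
  have : a / s <= a by rewrite ler_pdivrMr ?(lt_le_trans ltr01)// ler_peMr// ltW.
  lra.
have c2 : (fun s => m * s + a / s) s @[s --> +oo] --> +oo.
  apply/cvgryPge => A; near=> s.
  have s1 : 0 <= s by near: s; apply: nbhs_pinfty_ge; rewrite num_real.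
  have sA : A / m <= s by near: s; apply: nbhs_pinfty_ge; rewrite num_real.
  rewrite ler_pdivrMr// in sA.
  have : 0 <= a / s by rewrite divr_ge0// ltW.
  lra.
rewrite -[X in _ --> X + _]mulr1 -[X in _ --> _ + X]mulr1.
apply: cvgD; apply: cvgMr.
  exact: (cvg_comp _ _ c1 normal_cdf_pinfty).
exact: (cvg_comp _ _ c2 normal_cdf_pinfty).
Unshelve. all: by end_near. Qed.

Let H_0 : H s @[s --> 0^'+] --> expR (a * m).
Proof.
have c1 : (fun s => m * s - a / s) s @[s --> 0^'+] --> -oo.
  apply/cvgrNyPle => A.
  have mA : 0 < m + `|A| by rewrite ltr_wpDr.
  near=> s.
  have s0 : 0 < s by near: s; apply: nbhs_right_gt.
  have s1 : s <= 1 by near: s; apply: nbhs_right_le.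
  have sA : s <= a / (m + `|A|).
    by near: s; apply: nbhs_right_le; rewrite divr_gt0.
  rewrite ler_pdivlMr// in sA.
  have : m + `|A| <= a / s by rewrite ler_pdivlMr// mulrC.
  have : m * s <= m by rewrite ler_piMr// ltW.
  have := ler_norm (- A); rewrite normrN; lra.
have c2 : (fun s => m * s + a / s) s @[s --> 0^'+] --> +oo.
  apply/cvgryPge => A.
  have mA : 0 < m + `|A| by rewrite ltr_wpDr.
  near=> s.
  have s0 : 0 < s by near: s; apply: nbhs_right_gt.
  have sA : s <= a / (m + `|A|).
    by near: s; apply: nbhs_right_le; rewrite divr_gt0.
  rewrite ler_pdivlMr// in sA.
  have : m + `|A| <= a / s by rewrite ler_pdivlMr// mulrC.
  have : 0 <= m * s by rewrite mulr_ge0 ?ltW.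
  have := ler_norm A; move: m0; lra.
rewrite -[X in _ --> X]add0r -[X in _ --> X + _](mulr0 (expR (- (a * m)))).
rewrite -[X in _ --> _ + X]mulr1.
apply: cvgD; apply: cvgMr.
  exact: (cvg_comp _ _ c1 normal_cdf_ninfty).
exact: (cvg_comp _ _ c2 normal_cdf_pinfty).
Unshelve. all: by end_near. Qed.

Variable alpha : R.
Hypothesis alpha0 : 0 < alpha.

Let f t := expR (- (alpha * m ^+ 2 * t) / 2
      - a ^+ 2 / (2 * alpha * t)) / Num.sqrt (2 * pi * alpha * t).

Let F t := H (Num.sqrt (alpha * t)).

Let is_derive_F (t : R) : 0 < t -> is_derive t 1 F (alpha * m * f t).
Proof.
move=> t0.
have at0 : 0 < alpha * t by rewrite mulr_gt0.
have s0 : 0 < Num.sqrt (alpha * t) by rewrite sqrtr_gt0.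
have d1 : is_derive t 1 (fun t : R => Num.sqrt (alpha * t))
    (alpha / (2 * Num.sqrt (alpha * t))).
  have d0 : is_derive t 1 (fun t : R => alpha * t) alpha.
    by apply: is_derive_eq; rewrite /GRing.scale/= mulr1.
  have := @is_derive1_comp R Num.sqrt (fun t : R => alpha * t) t _ _
    (is_derive1_sqrt at0) d0.
  by move=> dd; apply: (is_derive_eq dd); rewrite mulrC.
have := @is_derive1_comp R H (fun t : R => Num.sqrt (alpha * t)) t _ _
  (is_derive_H s0) d1.
move=> dd; apply: (is_derive_eq dd).
rewrite /f /normal_peak expr1n mul1r.
have ap : 0 <= pi *+ 2 :> R by rewrite mulrn_wge0// pi_ge0.
have -> : 2 * pi * alpha * t = (pi *+ 2) * (alpha * t) :> R by ring.
rewrite (sqrtrM (alpha * t) ap).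
have -> : (m * Num.sqrt (alpha * t)) ^+ 2 = m ^+ 2 * (alpha * t).
  by rewrite exprMn sqr_sqrtr// ltW.
have -> : (a / Num.sqrt (alpha * t)) ^+ 2 = a ^+ 2 / (alpha * t).
  by rewrite expr_div_n sqr_sqrtr// ltW.
have -> : - (m ^+ 2 * (alpha * t) + a ^+ 2 / (alpha * t)) / 2 =
  - (alpha * m ^+ 2 * t) / 2 - a ^+ 2 / (2 * alpha * t).
  by field; rewrite !gt_eqF.
have p0 : Num.sqrt (pi *+ 2) != 0 :> R.
  by rewrite gt_eqF// sqrtr_gt0 mulrn_wgt0// pi_gt0.
by field; rewrite p0 gt_eqF.
Qed.

Let continuous_f (x : R) : 0 < x -> {for x, continuous f}.
Proof.
move=> x0.
have xn0 : x != 0 by rewrite gt_eqF.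
have an0 : alpha != 0 by rewrite gt_eqF.
apply: cvgM.
  apply: (cvg_comp _ expR); last exact: continuous_expR.
  apply: cvgB.
    apply: cvgM; last exact: cvg_cst.
    by apply: cvgN; apply: cvgM; [exact: cvg_cst|exact: cvg_id].
  apply: cvgM; first exact: cvg_cst.
  apply: cvgV; first by rewrite !mulf_neq0.
  by apply: cvgM; [exact: cvg_cst|exact: cvg_id].
apply: cvgV.
  by rewrite gt_eqF// sqrtr_gt0 !mulr_gt0// pi_gt0.
apply: (cvg_comp _ Num.sqrt); last exact: sqrt_continuous.
by apply: cvgM; [exact: cvg_cst|exact: cvg_id].
Qed.

Let integral_f_from (d : R) : 0 < d ->
  (\int[mu]_(t in `[d, +oo[) (alpha * m * f t)%:E
   = (expR (- (a * m)) + expR (a * m))%:E - (F d)%:E)%E.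
Proof.
move=> d0.
have cF x : d <= x -> {for x, continuous F}.
  move=> dx; apply: differentiable_continuous; apply/derivable1_diffP.
  by have [] := is_derive_F (lt_le_trans d0 dx).
apply: ge0_continuous_FTC2y.
- move=> x dx; rewrite !mulr_ge0 ?(ltW alpha0) ?(ltW m0)// ?invr_ge0 ?expR_ge0//.
- apply: continuous_in_subspaceT => x; rewrite inE/= in_itv/= andbT => dx.
  have x0 := lt_le_trans d0 dx.
  by apply: cvgM; [exact: cvg_cst|exact: continuous_f].
- apply: (cvg_comp (fun t => Num.sqrt (alpha * t)) H); last exact: H_pinfty.
  apply/cvgryPge => A; near=> t.
  have At : A ^+ 2 / alpha <= t.
    by near: t; apply: nbhs_pinfty_ge; rewrite num_real.
  rewrite ler_pdivrMr// in At.
  apply: (le_trans (ler_norm A)).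
  by rewrite -(sqrtr_sqr A) ler_wsqrtr// mulrC.
- by move=> x dx; have [] := is_derive_F (lt_trans d0 dx).
- by apply: cvg_at_right_filter; exact: cF.
- move=> x; rewrite in_itv/= andbT => dx.
  by rewrite derive1E; have [] := is_derive_F (lt_trans d0 dx).
Unshelve. all: by end_near. Qed.

(** The substitution [s = sqrt (alpha t)] makes [F] an antiderivative of [alpha m f]. Its limit at
    infinity is [exp(-am) + exp(am)] and its limit at 0 is [exp(am)], so only [exp(-am)] survives.
    Since the expression for [F] divides by zero at 0, the integral is exhausted by the half-lines
    [[d n, +oo[]. *)
Lemma integral_gauss_inverse_time :
  (\int[mu]_(t in `]0%R, +oo[) (f t)%:E
   = (expR (- (a * m)) / (alpha * m))%:E)%E.
Proof.
have am0 : 0 < alpha * m by rewrite mulr_gt0.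
have mf : measurable_fun (`]0, +oo[%classic : set R) f.
  apply: open_continuous_measurable_fun => // x.
  by rewrite inE/= in_itv/= andbT; exact: continuous_f.
have mf' : measurable_fun (`]0, +oo[%classic : set R) (fun t => (alpha * m * f t)%:E).
  by apply/measurable_EFinP; apply: measurable_funM.
have f0 t : 0 <= f t by rewrite /f mulr_ge0 ?invr_ge0 ?expR_ge0.
suff : (\int[mu]_(t in `]0%R, +oo[) (alpha * m * f t)%:E
    = (expR (- (a * m)))%:E)%E.
  under eq_integral do rewrite EFinM.
  rewrite ge0_integralZl_EFin//; last 3 first.
  - by move=> x _; rewrite lee_fin.
  - exact/measurable_EFinP.
  - exact: ltW.
  move=> e; rewrite EFinM muleC -e muleA -EFinM mulVf ?gt_eqF// mul1e//.
pose s (n : nat) : R := n.+1%:R^-1.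
have s0 n : 0 < s n by rewrite invr_gt0.
(* Chosen so that [F (d n) = H (s n)], with [s n] the harmonic sequence. *)
pose d n := s n ^+ 2 / alpha.
have d0 n : 0 < d n by rewrite divr_gt0// exprn_gt0.
have -> : `]0%R, +oo[%classic = \bigcup_n `[d n, +oo[%classic.
  apply/seteqP; split=> [x /=|x [n _] /=]; rewrite !in_itv/= !andbT; last first.
    exact: lt_le_trans.
  move=> x0; exists (Num.truncn (alpha * x)^-1) => //=.
  rewrite in_itv/= andbT /d ler_pdivrMr// [x * _]mulrC.
  have ax0 : 0 < alpha * x by rewrite mulr_gt0.
  have := truncnS_gt (alpha * x)^-1.
  rewrite invf_plt ?posrE// => /ltW; apply: le_trans.
  by rewrite expr2 ger_pMl ?s0// invf_le1// ler1n.
have c1 := @ge0_nondecreasing_set_cvg_integral _ (measurableTypeR R) R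
  (fun n => `[d n, +oo[%classic) (fun t => (alpha * m * f t)%:E) mu.
have c2 : (\int[mu]_(t in `[d n, +oo[) (alpha * m * f t)%:E @[n --> \oo]
   --> (expR (- (a * m)))%:E)%E.
  under eq_fun do rewrite integral_f_from// -EFinB.
  apply: cvg_EFin; first by exact: nearW.
  rewrite (_ : _ \o _ = fun n => expR (- (a * m)) + expR (a * m) - H (s n)).
    rewrite -[X in _ --> X](addrK (expR (a * m))).
    apply: cvgB; first exact: cvg_cst.
    move/cvg_at_rightP : H_0; apply; split => //.
    exact: cvg_harmonic.
  apply/funext => n /=; rewrite /F /d mulrCA mulfV ?gt_eqF// mulr1.
  by rewrite sqrtr_sqr gtr0_norm.
apply: (cvg_unique _ (c1 _ _ _ _) c2) => //.
- move=> i j ij; rewrite subsetEset => x /=; rewrite !in_itv/= !andbT.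
  apply: le_trans; rewrite ler_pM2r ?invr_gt0// lerXn2r ?nnegrE ?(ltW (s0 _))//.
  by rewrite lef_pV2 ?posrE// ler_nat.
- move=> i; apply: measurable_funS mf' => // x /=; rewrite !in_itv/= !andbT.
  exact: lt_le_trans.
- by move=> n t _; rewrite lee_fin mulr_ge0// ltW.
Qed.
End gauss_inverse_time.

(** * Markov property for the augmented filtration *)

Lemma sigma_algebra_setI (T : Type) (G : set (set T)) (A B : set T) :
  <<s G >> A -> <<s G >> B -> <<s G >> (A `&` B).
Proof.
have := smallest_sigma_algebra setT G.
by move=> /(sigma_algebraP (fun X _ => @subsetT _ X))[_ _ _ + GA GB]; exact.
Qed.

(** The inverse of 0 is 0 by convention, so the single discontinuity is split off as a measurable
    point. *)
Lemma measurable_inv (R : realType) :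
  measurable_fun [set: R] (@GRing.inv R).
Proof.
have -> : [set: R] = [set 0] `|` ~` [set 0] by rewrite setUv.
apply/measurable_funU => //; first exact: measurableC.
split; first exact: measurable_fun_set1.
apply: open_continuous_measurable_fun.
  by rewrite openC; exact: closed_eq.
by move=> x; rewrite inE/= => /eqP x0; exact: inv_continuous.
Qed.

Lemma measurable_fun_select d1 d2 (T : measurableType d1) (U : measurableType d2)
    (kappa : T -> nat) (g : nat -> T -> U) :
  (forall k, measurable (kappa @^-1` [set k])) ->
  (forall k, measurable_fun setT (g k)) ->
  measurable_fun setT (fun x => g (kappa x) x).
Proof.
move=> mk mg _ C mC; rewrite setTI.
rewrite (_ : _ @^-1` C =
    \bigcup_k (kappa @^-1` [set k] `&` g k @^-1` C)); last first.
  apply/seteqP; split=> x /=; first by move=> Cx; exists (kappa x).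
  by move=> [k _ [<-]].
apply: bigcup_measurable => k _; apply: measurableI; first exact: mk.
by rewrite -[X in measurable X]setTI; exact: mg.
Qed.

Lemma within_continuous_seq (R : realType) (D : set R) (f : R -> R)
    (u : nat -> R) (l : R) : {within D, continuous f} ->
  (forall n, D (u n)) -> D l -> u n @[n --> \oo] --> l ->
  f (u n) @[n --> \oo] --> f l.
Proof.
move=> /subspace_continuousP cf Du Dl ul.
apply: (cvg_comp u f _ (cf _ Dl)).
move=> V lV.
have : \forall n \near \oo, D (u n) -> V (u n) by exact: ul _ lV.
by apply: filterS => n /= h; apply: h; exact: Du.
Qed.

(** For fixed [n] it takes countably many values, so a continuous path can be recovered from
    countably many of its time marginals. *)
Definition grid_below {R : realType} (n : nat) (t : R) : R :=
  (Num.truncn (n.+1%:R * t))%:R / n.+1%:R.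

Lemma grid_below_cvg {R : realType} (t : R) : 0 <= t ->
  grid_below n t @[n --> \oo] --> t.
Proof.
move=> t0.
apply: (@squeeze_cvgr _ _ _ _ (fun n => t - n.+1%:R^-1) (fun=> t)).
- apply: nearW => n; rewrite /grid_below.
  have n0 : 0 < n.+1%:R :> R by [].
  have nt0 : 0 <= n.+1%:R * t by rewrite mulr_ge0.
  have /andP[h1 h2] := truncn_itv nt0.
  rewrite ler_pdivlMr// ler_pdivrMr// [t * _]mulrC h1 andbT.
  rewrite mulrBl mulVf ?gt_eqF// [t * _]mulrC.
  by move: h2; rewrite -natr1; lra.
- rewrite -[X in _ --> X]subr0; apply: cvgB; [exact: cvg_cst|].
  exact: cvg_harmonic.
- exact: cvg_cst.
Qed.

Lemma measurable_truncn {R : realType} (k : nat) :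
  measurable ((@Num.truncn R) @^-1` [set k]).
Proof.
case: k => [|k].
  rewrite (_ : _ @^-1` _ = `]-oo, 1%R[%classic)//.
  apply/seteqP; split => x /=; rewrite in_itv/= ltNge -(@truncn_gt_nat _ x 0).
    by move=> ->.
  by rewrite lt0n negbK => /eqP.
rewrite (_ : _ @^-1` _ = `[k.+1%:R, k.+2%:R[%classic)//.
apply/seteqP; split => x /=; rewrite in_itv/= ltNge -!truncn_gt_nat -leqNgt.
  by move=> ->; rewrite !leqnn.
by move=> h; apply/eqP; rewrite eqn_leq andbC.
Qed.

Section brownian_measurability.
Context {R : realType} {d : measure_display} {Omega : measurableType d}.
Variables (P : probability Omega R) (B : R -> Omega -> R).
Hypothesis BM : standard_brownian_motion P B.

(** Path continuity makes the process the limit of its values at [grid_below], and each of these is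
    a countable selection among the measurable maps [B (k / n.+1)]. Time is clipped at 0 because [B]
    is unconstrained at negative times. *)
Lemma measurable_brownian_path :
  measurable_fun [set: Omega * R] (fun wt => B (Num.max 0 wt.2) wt.1).
Proof.
have m2 : measurable_fun [set: Omega * R] (fun wt => Num.max 0 wt.2).
  by apply: measurable_maxr.
pose proof (@measurable_fun_cvg _ (Omega * R)%type _ setT
  (fun n wt => B (grid_below n (Num.max 0 wt.2)) wt.1) (fun wt => B (Num.max 0 wt.2) wt.1)) as HH. apply: HH.
  move=> n; rewrite /grid_below.
  apply: (@measurable_fun_select _ _ (Omega * R)%type _
    (fun wt => Num.truncn (n.+1%:R * Num.max 0 wt.2))
    (fun k wt => B (k%:R / n.+1%:R) wt.1)).
    move=> k; have mm : measurable_fun [set: Omega * R]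
        (fun wt => n.+1%:R * Num.max 0 wt.2) by exact: measurable_funM.
    by have := mm measurableT _ (@measurable_truncn R k); rewrite setTI.
  move=> k; apply: (measurableT_comp (brownian_measurable BM _)) => //. 
move=> [w t] _ /=.
have t0 : 0 <= Num.max 0 t by rewrite le_max lexx.
apply: (@within_continuous_seq R `[0, +oo[%classic (fun t => B t w)
  (fun n => grid_below n (Num.max 0 t))).
- exact: (@brownian_continuous _ _ _ _ _ BM w).
- by move=> n; rewrite /= in_itv/= andbT divr_ge0.
- by rewrite /= in_itv/= andbT.
- exact: grid_below_cvg.
Qed.

Lemma natural_filtration_measurable (t : R) (A : set Omega) :
  natural_filtration B t A -> measurable A.
Proof.
apply: smallest_sub; first exact: sigma_algebra_measurable.
move=> _ [s [C [/andP[s0 _] mC ->]]].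
by have := brownian_measurable BM s0 measurableT mC; rewrite setTI.
Qed.

(** The events that differ from a natural one by a negligible set form a sigma-algebra, and it
    contains both kinds of generators. This is what transfers the independence hypothesis to the
    augmented filtration. *)
Lemma augmented_filtrationP (t : R) (A : set Omega) :
  augmented_filtration P B t A ->
  measurable A /\ exists2 A', natural_filtration B t A' &
    P.-negligible ((A `\` A') `|` (A' `\` A)).
Proof.
move: A; apply: smallest_sub; last first.
  move=> A [nA|[mA A0]].
    split; first exact: natural_filtration_measurable nA.
    by exists A => //; rewrite setDv setU0; exact: negligible_set0.
  split=> //; exists set0; first exact: sigma_algebra0.
  by rewrite setD0 set0D setU0; exists A; split.
split.
- split => //; exists set0; first exact: sigma_algebra0.
  by rewrite setDv setU0; exact: negligible_set0.
- move=> A [mA [A' nA' nAA']]; rewrite setTD; split; first exact: measurableC.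
  exists (~` A'); first exact: sigma_algebraC.
  apply: negligibleS nAA' => x /= [[nA /contrapT A'x]|[nA'x /contrapT Ax]].
    by right.
  by left.
- move=> A hA; split; first by apply: bigcup_measurable => k _; case: (hA k).
  have [A' A'P] := choice (fun k => let: conj _ (ex_intro2 A' a b) := hA k in
     ex_intro (fun A' => natural_filtration B t A' /\
       P.-negligible ((A k `\` A') `|` (A' `\` A k))) A' (conj a b)).
  exists (\bigcup_k A' k).
    by apply: sigma_algebra_bigcup => k; case: (A'P k).
  have : P.-negligible (\bigcup_k ((A k `\` A' k) `|` (A' k `\` A k))).
    by apply: negligible_bigcup => k; case: (A'P k).
  apply: negligibleS => x /= [[[k _ Ax] nx]|[[k _ Ax] nx]]; exists k => //.
    by left; split => // Ax'; apply: nx; exists k.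
  by right; split => // Ax'; apply: nx; exists k.
Qed.

Lemma negligible_diff_measure (X Y : set Omega) : measurable X -> measurable Y ->
  P.-negligible ((X `\` Y) `|` (Y `\` X)) -> P X = P Y.
Proof.
suff le (U V : set Omega) : measurable U -> measurable V ->
    P.-negligible (U `\` V) -> (P U <= P V)%E.
  move=> mX mY nXY; apply/eqP; rewrite eq_le !le//.
    by apply: negligibleS nXY; exact: subsetUr.
  by apply: negligibleS nXY; exact: subsetUl.
move=> mU mV [N [mN N0 UVN]].
apply: (@le_trans _ _ (P (V `|` N))).
  apply: le_measure; rewrite ?inE//; first exact: measurableU.
  by move=> x Ux; have [Vx|nVx] := pselect (V x); [left|right; exact: UVN].
apply: (le_trans (measureU2 _ mV mN)).
by move: N0 => /= ->; rewrite adde0.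
Qed.

(** Replacing [A] by an equivalent natural event changes neither of the two probabilities in which
    it occurs. *)
Lemma augmented_filtration_indep (s t : R) (A : set Omega) (C : set R) :
  0 <= s < t -> augmented_filtration P B s A -> measurable C ->
  P (A `&` increment B s t @^-1` C) = (P A * P (increment B s t @^-1` C))%E.
Proof.
move=> /andP[s0 st] /augmented_filtrationP[mA [A' nA' nAA']] mC.
have mA' := natural_filtration_measurable nA'.
have mI : measurable (increment B s t @^-1` C).
  rewrite -[X in measurable X]setTI; apply: measurable_funB => //.
    by apply: (brownian_measurable BM); rewrite (le_trans s0)// ltW.
  exact: (brownian_measurable BM).
rewrite (@negligible_diff_measure _ (A' `&` increment B s t @^-1` C)).
- rewrite (negligible_diff_measure mA mA' nAA').
  by apply: (brownian_independent BM) => //; rewrite s0.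
- exact: measurableI.
- exact: measurableI.
- by apply: negligibleS nAA' => x /=; rewrite /setD/=; tauto.
Qed.

End brownian_measurability.

Lemma ge0_integral_normal_prob {R : realType} (m s : R) (f : R -> \bar R) :
  measurable_fun setT f -> (forall x, 0 <= f x)%E ->
  (\int[normal_prob m s]_x f x =
   \int[lebesgue_measure]_x (f x * (normal_pdf m s x)%:E))%E.
Proof.
move=> mf f0.
apply: (@ge0_integral_density _ (measurableTypeR R) R) => //.
- exact: measurable_normal_pdf.
- by move=> x; exact: normal_pdf_ge0.
Qed.

Section markov.
Context {R : realType} {d : measure_display} {Omega : measurableType d}.
Variables (P : probability Omega R) (B : R -> Omega -> R).
Hypothesis BM : standard_brownian_motion P B.
Notation mu := (@lebesgue_measure R).

Lemma measurable_increment (s t : R) : 0 <= s <= t ->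
  measurable_fun setT (increment B s t).
Proof.
move=> /andP[s0 st]; apply: measurable_funB.
  by apply: (brownian_measurable BM); rewrite (le_trans s0).
exact: (brownian_measurable BM).
Qed.

Lemma augmented_filtration_brownian (s : R) (C : set R) : 0 <= s ->
  measurable C -> augmented_filtration P B s (B s @^-1` C).
Proof.
move=> s0 mC; apply: sub_sigma_algebra; left; apply: sub_sigma_algebra.
by exists s, C; rewrite s0 lexx.
Qed.

(** Under [P] restricted to [A], the pair made of [B s] and the increment has the law of a product
    with an independent normal variable. The two finite measures on the plane agree on measurable
    rectangles, a generating class stable under intersection, hence everywhere; Tonelli and the
    normal density then give the inner integral. *)
Lemma ge0_integral_increment (s t : R) (A : set Omega) (F : R * R -> \bar R) :
  0 <= s < t -> augmented_filtration P B s A ->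
  measurable_fun setT F -> (forall x, 0 <= F x)%E ->
  (\int[P]_(w in A) F (B s w, increment B s t w) =
   \int[P]_(w in A) \int[mu]_z
      (F (B s w, z) * (normal_pdf 0 (Num.sqrt (t - s)) z)%:E))%E.
Proof.
move=> /[dup] st0 /andP[s0 st] hA mF F0.
have [mA _] := augmented_filtrationP BM hA.
have mBs : measurable_fun setT (B s) by exact: (brownian_measurable BM).
have mI : measurable_fun setT (increment B s t).
  by apply: measurable_increment; rewrite s0 ltW.
pose N : probability (measurableTypeR R) R := normal_prob (0 : R) (Num.sqrt (t - s)).
have mpair : measurable_fun setT (fun w => (B s w, increment B s t w)).
  exact: measurable_fun_pair.
have mmap : measurable_fun setT (fun wz : Omega * R => (B s wz.1, wz.2)).
  by apply: measurable_fun_pair => //; exact: measurableT_comp.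
have mAT : measurable (A `*` [set: measurableTypeR R]) by exact: measurableX.
pose m1 := image_measure (mrestr P mA) mpair.
pose m2 := image_measure (mrestr (P \x N)%E mAT) mmap.
have m1E C1 C2 : measurable C1 -> measurable C2 ->
    m1 (C1 `*` C2) = m2 (C1 `*` C2).
  move=> mC1 mC2.
  (* [A] and the value of [B s] are both known at time [s], so independence applies to their
     intersection. *)
  have hBA : augmented_filtration P B s (A `&` B s @^-1` C1).
    apply: sigma_algebra_setI => //; exact: augmented_filtration_brownian.
  change (P ((fun w => (B s w, increment B s t w)) @^-1` (C1 `*` C2) `&` A) =
    (P \x N)%E ((fun wz : Omega * R => (B s wz.1, wz.2)) @^-1` (C1 `*` C2) `&`
             (A `*` [set: R]))).
  rewrite (_ : _ @^-1` _ `&` A =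
     (A `&` B s @^-1` C1) `&` increment B s t @^-1` C2); last first.
    by apply/seteqP; split => w /=; tauto.
  rewrite (augmented_filtration_indep BM st0 hBA mC2).
  rewrite (_ : _ @^-1` _ `&` _ = (A `&` B s @^-1` C1) `*` C2); last first.
    by apply/seteqP; split => w /=; tauto.
  rewrite (brownian_normal BM st0 mC2) product_measure1E//.
  by have [] := augmented_filtrationP BM hBA.
have m12 E : measurable E -> m1 E = m2 E.
  apply: (@measure_unique _ R (R * R)%type
    [set C | exists C1 C2, [/\ measurable C1, measurable C2 & C = C1 `*` C2]]
    (fun=> setT)).
  - rewrite measurable_prod_measurableType; congr (<<s _ >>).
    apply/seteqP; split => [C [C1 mC1 [C2 mC2 <-]]|C [C1 [C2 [mC1 mC2 ->]]]].
      by exists C1, C2.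
    by exists C1 => //; exists C2.
  - move=> _ _ [C1 [C2 [mC1 mC2 ->]]] [D1 [D2 [mD1 mD2 ->]]].
    exists (C1 `&` D1), (C2 `&` D2); split; [exact: measurableI..|].
    by rewrite setXI.
  - by move=> _; exists setT, setT; rewrite setXTT.
  - by apply/seteqP; split => // x _; exists 0%N.
  - by move=> _ [C1 [C2 [mC1 mC2 ->]]]; exact: m1E.
  - move=> _; change (P ((fun w => (B s w, increment B s t w)) @^-1` setT `&` A)
                      < +oo)%E.
    rewrite preimage_setT setTI; apply: le_lt_trans (ltry 1).
    exact: probability_le1.
transitivity (\int[m1]_x F x)%E.
  rewrite /m1 ge0_integral_image// ge0_integral_mrestr//.
  exact: measurableT_comp.
transitivity (\int[m2]_x F x)%E.
  by apply: eq_measure_integral => //= E mE _; exact: m12.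
rewrite /m2 ge0_integral_image// ge0_integral_mrestr//; last first.
  exact: measurableT_comp.
rewrite integral_mkcond fubini_tonelli1//; last 2 first.
- apply/(measurable_restrictT _ mAT).
  by apply: measurable_funTS; exact: measurableT_comp.
- by move=> x; apply: erestrict_ge0.
rewrite [RHS]integral_mkcond; apply: eq_integral => w _.
rewrite /fubini_F patchE; case: ifPn => wA.
  rewrite -ge0_integral_normal_prob//; last first.
    by apply: measurableT_comp => //; exact: measurable_fun_pair.
  apply: eq_integral => z _; rewrite patchE mem_set//.
  by split => //; rewrite inE in wA.
apply: integral0_eq => z _; rewrite patchE memNset// => -[/= Aw _].
by move: wA; rewrite notin_setE.
Qed.

End markov.

(** * Resolvent of the drifted Brownian motion *)

Lemma measurable_sqrt (R : realType) : measurable_fun [set: R] (@Num.sqrt R).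
Proof. by apply: continuous_measurable_fun; exact: sqrt_continuous. Qed.

Section green_kernel.
Context {R : realType}.
Notation mu := (@lebesgue_measure R).
Variables (theta b rho n1 n2 : R).

(* Density at v of b * t - theta * B_t. *)
Definition drifted_density (t v : R) : R :=
  expR (- (v - b * t) ^+ 2 / (2 * theta ^+ 2 * t)) /
  Num.sqrt (2 * pi * theta ^+ 2 * t).

Lemma drifted_density_ge0 (t v : R) : 0 <= drifted_density t v.
Proof. by rewrite mulr_ge0 ?expR_ge0 ?invr_ge0. Qed.

Lemma measurable_drifted_density d (T : measurableType d) (f g : T -> R) :
  measurable_fun setT f -> measurable_fun setT g ->
  measurable_fun setT (fun x => drifted_density (f x) (g x)).
Proof.
move=> mf mg; apply: measurable_funM.
  apply: measurableT_comp => //; apply: measurable_funM.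
    apply: measurableT_comp => //; apply: measurable_funX.
    by apply: measurable_funB => //; exact: measurable_funM.
  by apply: (measurableT_comp (@measurable_inv R)); exact: measurable_funM.
apply: (measurableT_comp (@measurable_inv R)).
by apply: (measurableT_comp (@measurable_sqrt R)); exact: measurable_funM.
Qed.

(* Resolvent kernel at rate rho of b * t - theta * B_t. *)
Definition green (v : R) : R := 2 / (theta ^+ 2 * (n1 - n2)) *
  expR (- (if 0 < v then n1 else n2) * v).

Hypothesis theta0 : theta != 0.
Hypotheses (n1_gt0 : 0 < n1) (n2_lt0 : n2 < 0).
Hypothesis n1_root : theta ^+ 2 / 2 * n1 ^+ 2 + b * n1 - rho = 0.
Hypothesis n2_root : theta ^+ 2 / 2 * n2 ^+ 2 + b * n2 - rho = 0.

Lemma green_ge0 (v : R) : 0 <= green v.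
Proof.
rewrite mulr_ge0 ?expR_ge0// divr_ge0// mulr_ge0 ?sqr_ge0// subr_ge0.
by rewrite (le_trans (ltW n2_lt0))// ltW.
Qed.

Lemma measurable_green : measurable_fun setT green.
Proof.
apply: measurable_funM => //; apply: measurableT_comp => //.
apply: measurable_funM => //; apply: measurableT_comp => //.
by apply: measurable_fun_ifT => //; exact: measurable_fun_ltr.
Qed.

(** The difference of the two root equations has the factor [n1 - n2], which is positive. *)
Lemma vieta_sum : b = - (theta ^+ 2 * (n1 + n2)) / 2.
Proof.
have h : (n1 - n2) * (theta ^+ 2 / 2 * (n1 + n2) + b) = 0.
  transitivity ((theta ^+ 2 / 2 * n1 ^+ 2 + b * n1 - rho)
     - (theta ^+ 2 / 2 * n2 ^+ 2 + b * n2 - rho)); first by ring.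
  by rewrite n1_root n2_root subrr.
move/eqP: h; rewrite mulf_eq0 => /orP[/eqP|/eqP]; last lra.
by move: n1_gt0 n2_lt0; lra.
Qed.

Lemma vieta_prod : rho = - (theta ^+ 2 * n1 * n2) / 2.
Proof.
by have := n1_root; rewrite vieta_sum => h; lra.
Qed.

(** With [m = (n1 - n2) / 2], Vieta gives [b^2 / (2 theta^2) + rho = theta^2 m^2 / 2]. Expanding the
    square thus leaves the factor [c = exp(-(n1 + n2) v / 2)], constant in time, and the symmetric
    kernel with parameters [m] and [a = |v|], whose integral is [exp(-m |v|) / (theta^2 m)]. In the
    product the exponent becomes [-n1 v] for [v > 0] and [-n2 v] for [v < 0]. The point [v = 0] is
    excluded because the kernel was integrated for [a > 0]. *)
Lemma integral_density_green (v : R) : v != 0 ->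
  (\int[mu]_(t in `]0%R, +oo[) (expR (- rho * t) * drifted_density t v)%:E
   = (green v)%:E)%E.
Proof.
move=> v0.
pose m := (n1 - n2) / 2; pose a := `|v|.
have m0 : 0 < m by rewrite divr_gt0// subr_gt0 (lt_trans n2_lt0).
have a0 : 0 < a by rewrite normr_gt0.
have al0 : 0 < theta ^+ 2 by rewrite exprn_even_gt0.
pose c := expR (- (n1 + n2) * v / 2).
transitivity (\int[mu]_(t in `]0%R, +oo[) (c%:E *
  (expR (- (theta ^+ 2 * m ^+ 2 * t) / 2 - a ^+ 2 / (2 * theta ^+ 2 * t)) /
   Num.sqrt (2 * pi * theta ^+ 2 * t))%:E))%E.
  apply: eq_integral => t; rewrite inE/= in_itv/= andbT => t0.
  rewrite -EFinM; congr EFin; rewrite /drifted_density !mulrA -!expRD.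
  congr (expR _ / _).
  rewrite /a real_normK ?num_real// vieta_prod vieta_sum /m.
  by field; rewrite theta0 gt_eqF.
rewrite ge0_integralZl_EFin//; last 2 first.
- apply/measurable_EFinP; apply: measurable_funTS.
  apply: measurable_funM.
    apply: measurableT_comp => //; apply: measurable_funB.
      by apply: measurable_funM => //; apply: measurableT_comp.
    apply: measurable_funM => //.
    by apply: (measurableT_comp (@measurable_inv R)); exact: measurable_funM.
  apply: (measurableT_comp (@measurable_inv R)).
  by apply: (measurableT_comp (@measurable_sqrt R)); exact: measurable_funM.
- exact: expR_ge0.
rewrite integral_gauss_inverse_time// -EFinM; congr EFin.
rewrite /c /green /a /m [LHS]mulrA -expRD [LHS]mulrC; congr (_ * expR _).
  by field; rewrite theta0 gt_eqF// subr_gt0 (lt_trans n2_lt0).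
case: ltrP => v0'; first by rewrite gtr0_norm//; field.
by rewrite ler0_norm//; field.
Qed.

Lemma integral_density_green_shift (s v : R) : v != 0 ->
  (\int[mu]_t (\1_(`]s, +oo[%classic : set R) t * expR (- rho * t)
     * drifted_density (t - s) v)%:E = (expR (- rho * s) * green v)%:E)%E.
Proof.
move=> v0.
pose f t := (\1_(`]s, +oo[%classic : set R) t * expR (- rho * t)
     * drifted_density (t - s) v)%:E.
have mf : measurable_fun setT f.
  apply/measurable_EFinP; apply: measurable_funM.
    apply: measurable_funM; first exact: measurable_indic.
    by apply: measurableT_comp => //; exact: measurable_funM.
  by apply: measurable_drifted_density => //; exact: measurable_funB.
have f0 t : (0 <= f t)%E.
  by rewrite lee_fin !mulr_ge0 ?expR_ge0 ?drifted_density_ge0.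
rewrite (@ge0_integral_affine _ f s 1 (oner_neq0 _) mf f0) normr1 mul1e.
rewrite EFinM -(integral_density_green v0).
rewrite -ge0_integralZl_EFin//; last 2 first.
- by move=> t _; rewrite lee_fin mulr_ge0 ?expR_ge0 ?drifted_density_ge0.
- apply/measurable_EFinP; apply: measurable_funTS; apply: measurable_funM.
    by apply: measurableT_comp => //; exact: measurable_funM.
  by apply: measurable_drifted_density.
rewrite [RHS]integral_mkcond; apply: eq_integral => t _.
rewrite /f patchE indicE mul1r addrAC subrr add0r -EFinM.
rewrite (_ : (s + t \in `]s, +oo[%classic) = (t \in `]0, +oo[%classic)); last first.
  by apply/idP/idP; rewrite !in_setE/= !in_itv/= !andbT ltrDl.
case: ifP => _; last by rewrite !mul0r.
by rewrite mul1r [in RHS]mulrA -[in RHS]expRD -mulrDr.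
Qed.

End green_kernel.

Section resolvent.
Context {R : realType} {d : measure_display} {Omega : measurableType d}.
Variables (P : probability Omega R) (B : R -> Omega -> R).
Hypothesis BM : standard_brownian_motion P B.
Notation mu := (@lebesgue_measure R).
Variables (theta b rho n1 n2 x0 : R).
Hypothesis theta0 : theta != 0.

Definition drifted_brownian (t : R) (w : Omega) : R := x0 + b * t - theta * B t w.

Local Notation X := drifted_brownian.
Local Notation q := (drifted_density theta b).

Lemma measurable_drifted_brownian (t : R) : 0 <= t -> measurable_fun setT (X t).
Proof.
move=> t0; apply: measurable_funB => //; apply: measurable_funM => //.
exact: (brownian_measurable BM).
Qed.

(** The affine substitution from the Brownian increment [z] to the position [u] of [X t] has slope
    [-theta]; its Jacobian turns the normal density of the increment into [q]. *)
Lemma markov_drifted (s t : R) (A : set Omega) (G : R -> \bar R) :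
  0 <= s < t -> augmented_filtration P B s A ->
  measurable_fun setT G -> (forall x, 0 <= G x)%E ->
  (\int[P]_(w in A) G (X t w) =
   \int[P]_(w in A) \int[mu]_u (G u * (q (t - s) (u - X s w))%:E))%E.
Proof.
move=> /[dup] st0 /andP[s0 st] hA mG G0.
pose F (xz : R * R) := G (x0 + b * t - theta * (xz.1 + xz.2)).
have mF : measurable_fun setT F.
  apply: measurableT_comp => //; apply: measurable_funB => //.
  by apply: measurable_funM => //; exact: measurable_funD.
transitivity (\int[P]_(w in A) F (B s w, increment B s t w))%E.
  apply: eq_integral => w _; rewrite /F /X /increment/=; congr G; ring.
have F0 x : (0 <= F x)%E by exact: G0.
apply: (etrans (ge0_integral_increment BM st0 hA mF F0)).
apply: eq_integral => w _.
pose h u := (G u * (q (t - s) (u - X s w))%:E)%E.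
have mh : measurable_fun setT h.
  apply: emeasurable_funM => //.
  apply/measurable_EFinP; apply: measurable_drifted_density => //.
  exact: measurable_funB.
have h0 u : (0 <= h u)%E by rewrite mule_ge0// lee_fin drifted_density_ge0.
have ntheta0 : - theta != 0 by rewrite oppr_eq0.
have maff : measurable_fun setT
    (fun z => x0 + b * t - theta * B s w + - theta * z).
  by apply: measurable_funD => //; exact: measurable_funM.
rewrite -/h (ge0_integral_affine (x0 + b * t - theta * B s w) ntheta0 mh h0).
have ts0 : 0 < t - s by rewrite subr_gt0.
rewrite -ge0_integralZl_EFin//; last exact: measurableT_comp.
apply: eq_integral => z _; rewrite /h muleCA; congr (_ * _)%E.
  by rewrite /F/=; congr G; ring.
rewrite -EFinM normal_pdfE; last by rewrite gt_eqF// sqrtr_gt0.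
rewrite /normal_peak /normal_fun /drifted_density !sqr_sqrtr ?(ltW ts0)//.
congr EFin.
have tn0 : 0 < `|theta| by rewrite normr_gt0.
have -> : 2 * pi * theta ^+ 2 * (t - s) = theta ^+ 2 * ((t - s) * pi *+ 2) by ring.
rewrite (sqrtrM _ (sqr_ge0 theta)) sqrtr_sqr normrN [(`|theta| * _)^-1]invfM.
rewrite [X in _ = _ * X]mulrCA mulVKf ?gt_eqF// mulrC; congr (expR _ * _).
rewrite /X; field.
by rewrite theta0 gt_eqF.
Qed.

Lemma measurable_drifted_path :
  measurable_fun [set: Omega * R] (fun wt => X (Num.max 0 wt.2) wt.1).
Proof.
have m2 : measurable_fun [set: Omega * R] (fun wt => Num.max 0 wt.2).
  by apply: measurable_maxr.
apply: measurable_funB.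
  by apply: measurable_funD => //; exact: measurable_funM.
by apply: measurable_funM => //; exact: measurable_brownian_path BM.
Qed.

Hypotheses (n1_gt0 : 0 < n1) (n2_lt0 : n2 < 0).
Hypothesis n1_root : theta ^+ 2 / 2 * n1 ^+ 2 + b * n1 - rho = 0.
Hypothesis n2_root : theta ^+ 2 / 2 * n2 ^+ 2 + b * n2 - rho = 0.

(** Tonelli exchanges [w] and [t], the Markov property is applied at each fixed [t > s], and two
    further exchanges bring the time integral innermost, where the transition density integrates to
    the Green kernel. *)
Lemma resolvent_drifted (s : R) (A : set Omega) (G : R -> \bar R) :
  0 <= s -> augmented_filtration P B s A ->
  measurable_fun setT G -> (forall x, 0 <= G x)%E ->
  (\int[P]_(w in A) \int[mu]_(t in `]s, +oo[) ((expR (- rho * t))%:E * G (X t w)) =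
   \int[P]_(w in A) ((expR (- rho * s))%:E *
     \int[mu]_u (G u * (green theta n1 n2 (u - X s w))%:E)))%E.
Proof.
move=> s0 hA mG G0.
have [mA _] := augmented_filtrationP BM hA.
pose I : set R := `]s, +oo[%classic.
have mI : measurable I by rewrite /I.
(* The event, the time interval and the discount factor are put into one weight, so that every
   exchange takes place on whole product spaces. *)
pose c (wt : Omega * R) := \1_(A `*` I) wt * expR (- rho * wt.2).
have mc : measurable_fun [set: Omega * R] c.
  apply: measurable_funM.
    by apply: measurable_indic; apply: measurableX.
  by apply: measurableT_comp => //; exact: measurable_funM.
have c0 wt : 0 <= c wt by rewrite !mulr_ge0 ?expR_ge0.
have cE w t : c (w, t) = \1_A w * \1_I t * expR (- rho * t).
  by rewrite /c/= !indicE in_setX/=; case: (w \in A); case: (t \in I);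
    rewrite ?mul1r ?mul0r.
pose Phi (wt : Omega * R) : \bar R := ((c wt)%:E * G (X (Num.max 0 wt.2)%R wt.1))%E.
have mPhi : measurable_fun [set: Omega * R] Phi.
  apply: emeasurable_funM; first exact/measurable_EFinP.
  by apply: measurableT_comp => //; exact: measurable_drifted_path.
have Phi0 wt : (0 <= Phi wt)%E by rewrite mule_ge0 ?lee_fin.
pose Psi (x : Omega * R * R) : \bar R :=
  ((c x.1)%:E * (G x.2 * (q (x.1.2 - s) (x.2 - X s x.1.1))%:E))%E.
have mXs := measurable_drifted_brownian s0.
have mPsi : measurable_fun [set: Omega * R * R] Psi.
  apply: emeasurable_funM.
    by apply/measurable_EFinP; exact: measurableT_comp.
  apply: emeasurable_funM; first exact: measurableT_comp.
  apply/measurable_EFinP; apply: measurable_drifted_density.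
    by apply: measurable_funB => //; exact: measurableT_comp.
  apply: measurable_funB => //; apply: measurableT_comp => //.
  exact: measurableT_comp.
have Psi0 x : (0 <= Psi x)%E.
  by rewrite mule_ge0 ?lee_fin// mule_ge0// lee_fin drifted_density_ge0.
transitivity (\int[P]_w \int[mu]_t Phi (w, t))%E.
  rewrite [LHS]integral_mkcond; apply: eq_integral => w _.
  rewrite patchE /Phi; under [in RHS]eq_integral do rewrite cE indicE.
  case: ifP => wA; last first.
    by rewrite integral0_eq// => t _; rewrite !mul0r mul0e.
  rewrite [LHS]integral_mkcond; apply: eq_integral => t _; rewrite patchE indicE.
  case: ifPn => tI; last by rewrite mulr0 mul0r mul0e.
  rewrite !mul1r max_r//.
  by move: tI; rewrite inE/= in_itv/= andbT => /ltW; exact: le_trans.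
rewrite fubini_tonelli//.
transitivity (\int[mu]_t \int[P]_w \int[mu]_u Psi ((w, t), u))%E.
  apply: eq_integral => t _.
  have [st|ts] := ltP s t; last first.
    have ctE w : c (w, t) = 0.
      rewrite cE (_ : \1_I t = 0) ?mulr0 ?mul0r// indicE memNset//.
      by rewrite /I/= in_itv/= andbT ltNge ts.
    rewrite [LHS]integral0_eq; last by move=> w _; rewrite /Phi ctE mul0e.
    rewrite [RHS]integral0_eq// => w _.
    by rewrite integral0_eq// => u _; rewrite /Psi ctE mul0e.
  have t0 := le_lt_trans s0 st.
  have ctE w : c (w, t) = \1_A w * expR (- rho * t).
    rewrite cE (_ : \1_I t = 1) ?mulr1// indicE mem_set//.
    by rewrite /I/= in_itv/= andbT.
  transitivity (\int[P]_(w in A) ((expR (- rho * t))%:E * G (X t w)))%E.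
    rewrite [RHS]integral_mkcond; apply: eq_integral => w _.
    rewrite /Phi ctE patchE indicE max_r ?(ltW t0)//.
    by case: ifP => _; rewrite ?mul1r// mul0r mul0e.
  have st0 : 0 <= s < t by rewrite s0.
  have mXt : measurable_fun A (fun w => G (X t w)).
    apply: measurable_funTS; apply: measurableT_comp => //.
    by apply: measurable_drifted_brownian; exact: ltW.
  rewrite ge0_integralZl_EFin//.
  rewrite (markov_drifted st0 hA mG G0).
  have mD : measurable_fun setT
     (fun w : Omega => \int[mu]_u (G u * (q (t - s) (u - X s w))%:E))%E.
    pose D (x : Omega * R) := (G x.2 * (q (t - s) (x.2 - X s x.1))%:E)%E.
    apply: (measurable_fun_fubini_tonelli_F (m2 := mu) D).
      apply: emeasurable_funM; first exact: measurableT_comp.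
      apply/measurable_EFinP; apply: measurable_drifted_density => //.
      by apply: measurable_funB => //; exact: measurableT_comp.
    by move=> x; rewrite mule_ge0// lee_fin drifted_density_ge0.
  rewrite -ge0_integralZl_EFin//; last 2 first.
  - move=> w _; apply: integral_ge0 => u _.
    by rewrite mule_ge0// lee_fin drifted_density_ge0.
  - exact: measurable_funTS.
  rewrite [LHS]integral_mkcond; apply: eq_integral => w _.
  rewrite patchE; case: ifPn => wA; last first.
    rewrite integral0_eq// => u _.
    by rewrite /Psi ctE indicE (negbTE wA) mul0r mul0e.
  rewrite -ge0_integralZl_EFin//; last 2 first.
  - by move=> u _; rewrite mule_ge0// lee_fin drifted_density_ge0.
  - apply: emeasurable_funM => //; apply/measurable_EFinP.
    by apply: measurable_drifted_density => //; exact: measurable_funB.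
  by apply: eq_integral => u _; rewrite /Psi ctE indicE wA mul1r.
pose Psi1 (wt : Omega * R) : \bar R := (\int[mu]_u Psi (wt, u))%E.
have mPsi1 : measurable_fun setT Psi1.
  exact: (measurable_fun_fubini_tonelli_F (m2 := mu) Psi).
have Psi10 wt : (0 <= Psi1 wt)%E by apply: integral_ge0.
apply: (etrans (esym (fubini_tonelli (m1 := P) (m2 := mu) Psi1 mPsi1 Psi10))).
rewrite [RHS]integral_mkcond; apply: eq_integral => w _.
pose Psi2 (tu : R * R) : \bar R := Psi ((w, tu.1), tu.2).
have mPsi2 : measurable_fun setT Psi2.
  apply: (measurableT_comp mPsi).
  by apply: measurable_fun_pair => //; exact: measurable_fun_pair.
have Psi20 tu : (0 <= Psi2 tu)%E by exact: Psi0.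
apply: (etrans (fubini_tonelli (m1 := mu) (m2 := mu) Psi2 mPsi2 Psi20)).
rewrite patchE; case: ifPn => wA; last first.
  rewrite integral0_eq// => u _; rewrite integral0_eq// => t _.
  by rewrite /Psi2 /Psi /= cE indicE (negbTE wA) !mul0r mul0e.
have mgr : measurable_fun setT (fun u : R => (green theta n1 n2 (u - X s w))%:E).
  apply/measurable_EFinP; apply: (measurableT_comp (measurable_green _ _ _)).
  exact: measurable_funB.
have gr0 (u : R) : (0 <= (green theta n1 n2 (u - X s w))%:E)%E.
  by rewrite lee_fin green_ge0.
rewrite -ge0_integralZl_EFin//; last 2 first.
- by move=> u _; rewrite mule_ge0.
- exact: emeasurable_funM.
apply: ge0_ae_eq_integral; first exact: measurableT.
- exact: (measurable_fun_fubini_tonelli_G (m1 := mu) Psi2).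
- by apply: measurable_funeM; exact: emeasurable_funM.
- by move=> u _; apply: integral_ge0.
- by move=> u _; rewrite mule_ge0 ?lee_fin ?expR_ge0// mule_ge0.
(* The time integral of the density was computed off [v = 0], that is, for [u] other than [X s w], a
   Lebesgue-null exception. *)
exists [set X s w]; split => //.
  exact: lebesgue_measure_set1.
move=> u /=; apply: contra_notP => ux _.
have v0 : u - X s w != 0 by rewrite subr_eq0; exact/eqP.
rewrite muleCA -EFinM.
rewrite -(integral_density_green_shift theta0 n1_gt0 n2_lt0 n1_root n2_root s v0).
have mqs : measurable_fun setT (fun t : R => (\1_I t * expR (- rho * t) *
    q (t - s) (u - X s w))%:E).
  apply/measurable_EFinP; apply: measurable_funM.
    apply: measurable_funM; first exact: measurable_indic.
    by apply: measurableT_comp => //; exact: measurable_funM.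
  by apply: measurable_drifted_density => //; exact: measurable_funB.
rewrite -ge0_integralZl//; last first.
  by move=> t _; rewrite lee_fin !mulr_ge0 ?expR_ge0 ?drifted_density_ge0.
apply: eq_integral => t _; rewrite /Psi2 /Psi /= cE indicE wA mul1r.
by rewrite muleCA -EFinM.
Qed.

End resolvent.

(** * Xi as the potential of the Green kernel *)

Section potential.
Context {R : realType}.
Notation mu := (@lebesgue_measure R).
Variables (theta n1 n2 : R).
Hypothesis theta0 : theta != 0.
Hypotheses (n1_gt0 : 0 < n1) (n2_lt0 : n2 < 0).

Local Notation K := (2 / (theta ^+ 2 * (n1 - n2))).

(** Under [nu = exp u] the Green kernel becomes a power of [nu / x], with exponent [-n2] below [x]
    and [-n1] above it; the Jacobian [1 / nu] accounts for the [- 1] in the exponents of [Xi].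
    Integrals stay in [\bar R], so no convergence is assumed here. *)
Lemma ge0_green_potential (g : R -> R) (x : R) :
  measurable_fun setT g -> (forall nu, 0 <= g nu) -> 0 < x ->
  (\int[mu]_u ((g (expR u))%:E * (green theta n1 n2 (u - ln x))%:E) =
   (K * x `^ n2)%:E * \int[mu]_(nu in `]0%R, x[) (nu `^ (- n2 - 1) * g nu)%:E +
   (K * x `^ n1)%:E *
     \int[mu]_(nu in `]x, +oo[) (nu `^ (- n1 - 1) * g nu)%:E)%E.
Proof.
move=> mg g0 x0.
have K0 : 0 <= K.
  by rewrite divr_ge0// mulr_ge0 ?sqr_ge0// subr_ge0 (le_trans (ltW n2_lt0))// ltW.
pose f (nu : R) : \bar R :=
  ((g nu)%:E * (green theta n1 n2 (ln nu - ln x) / nu)%:E)%E.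
have gr0 v : 0 <= green theta n1 n2 v by exact: green_ge0.
have mf : measurable_fun (`]0, +oo[%classic : set R) f.
  apply: emeasurable_funM; first exact/measurable_EFinP/measurable_funTS.
  apply/measurable_EFinP; apply: measurable_funTS; apply: measurable_funM.
    apply: (measurableT_comp (measurable_green _ _ _)).
    by apply: measurable_funB => //; exact: measurable_ln.
  exact: measurable_inv.
have mgp p : measurable_fun setT (fun nu : R => (nu `^ p * g nu)%:E).
  by apply/measurable_EFinP; apply: measurable_funM => //; apply: measurable_powR.
(* The change of variables asks for a function that is nonnegative and measurable on the whole line,
   which [f] need not be off the positive axis. *)
pose f' (nu : R) : \bar R := if 0 < nu then f nu else 0%E.
have f0 nu : 0 < nu -> (0 <= f nu)%E.
  by move=> nu0; rewrite mule_ge0 ?lee_fin ?divr_ge0// ltW.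
have f'0 nu : (0 <= f' nu)%E by rewrite /f'; case: ifPn => // /f0.
have mf' : measurable_fun setT f'.
  rewrite (_ : f' = f \_ `]0, +oo[%classic).
    exact/(measurable_restrictT f _).
  apply/funext => nu; rewrite /f' patchE; case: ifPn => nu0.
    by rewrite mem_set//= in_itv/= nu0.
  by rewrite memNset//= in_itv/= (negbTE nu0).
transitivity (\int[mu]_(nu in `]0%R, +oo[) f nu)%E.
  transitivity (\int[mu]_(nu in `]0%R, +oo[) f' nu)%E.
    rewrite ge0_integral_expR//; apply: eq_integral => u _.
    rewrite /f' expR_gt0 /f expRK -muleA; congr (_ * _)%E.
    by rewrite -EFinM divfK// gt_eqF// expR_gt0.
  apply: eq_integral => nu; rewrite inE/= in_itv/= andbT /f'.
  by move=> ->.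
have -> : `]0%R, +oo[%classic = `]0%R, x[%classic `|` `[x, +oo[%classic.
  apply/seteqP; split => nu /=; rewrite !in_itv/= !andbT.
    by move=> nu0; have [|] := ltP nu x; [left|right] => //; rewrite nu0.
  by move=> [/andP[]//|]; exact: lt_le_trans.
have sub1 : `]0%R, x[%classic `<=` (`]0, +oo[%classic : set R).
  by move=> nu /=; rewrite !in_itv/= andbT => /andP[].
have sub2 : `[x, +oo[%classic `<=` (`]0, +oo[%classic : set R).
  by move=> nu /=; rewrite !in_itv/= !andbT; exact: lt_le_trans.
rewrite ge0_integral_setU//; last 3 first.
- by apply: measurable_funS mf => // nu [/sub1|/sub2].
- move=> nu [/sub1|/sub2]; rewrite /= in_itv/= andbT => nu0; exact: f0.
- rewrite disj_set2E; apply/eqP; rewrite -subset0 => nu /=; rewrite !in_itv/=.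
  by move=> [/andP[_ h1] /andP[h2 _]]; move: (lt_le_trans h1 h2); rewrite ltxx.
rewrite -integral_itv_obnd_cbnd; last first.
  apply: measurable_funS mf => // nu /=; rewrite !in_itv/= !andbT.
  exact: lt_trans.
congr (_ + _)%E.
  rewrite -ge0_integralZl_EFin//; last 3 first.
  - by move=> nu _; rewrite lee_fin mulr_ge0// powR_ge0.
  - by apply: measurable_funTS; exact: mgp.
  - by rewrite mulr_ge0// powR_ge0.
  apply: eq_integral => nu; rewrite inE/= in_itv/= => /andP[nu0 nux].
  rewrite /f /green -!EFinM; congr EFin.
  rewrite subr_gt0 ltr_ln ?posrE// ltNge (ltW nux)/= powRD; last first.
    by rewrite (gt_eqF nu0) implybT.
  rewrite powR_inv1 ?(ltW nu0)// /powR !gt_eqF//.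
  rewrite (_ : - n2 * (ln nu - ln x) = n2 * ln x + - n2 * ln nu); last by ring.
  by rewrite expRD; ring.
rewrite -ge0_integralZl_EFin//; last 3 first.
- by move=> nu _; rewrite lee_fin mulr_ge0// powR_ge0.
- by apply: measurable_funTS; exact: mgp.
- by rewrite mulr_ge0// powR_ge0.
apply: eq_integral => nu; rewrite inE/= in_itv/= andbT => nux.
have nu0 := lt_trans x0 nux.
rewrite /f /green -!EFinM; congr EFin.
rewrite subr_gt0 ltr_ln ?posrE// nux powRD; last first.
  by rewrite (gt_eqF nu0) implybT.
rewrite powR_inv1 ?(ltW nu0)// /powR !gt_eqF//.
rewrite (_ : - n1 * (ln nu - ln x) = n1 * ln x + - n1 * ln nu); last by ring.
by rewrite expRD; ring.
Qed.

(** Convergence makes both extended integrals finite, so the real integrals in [Xi] carry their true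
    values and not the default one. *)
Lemma green_potential_Xi (g : R -> R) (x : R) :
  measurable_fun setT g -> (forall nu, 0 <= g nu) -> Xi_converges n1 n2 g ->
  0 < x ->
  (\int[mu]_u ((g (expR u))%:E * (green theta n1 n2 (u - ln x))%:E) =
   (Xi theta n1 n2 g x)%:E)%E.
Proof.
move=> mg g0 cg x0; rewrite ge0_green_potential//.
have [i1 i2] := cg _ x0.
rewrite /Xi /lower_integral /upper_integral /Rintegral.
set I1 := integral _ _ _; set I2 := integral _ _ _.
have f1 : I1 \is a fin_num by exact: integrable_fin_num i1.
have f2 : I2 \is a fin_num by exact: integrable_fin_num i2.
rewrite -(fineK f1) -(fineK f2) -!EFinM -EFinD; congr EFin.
by rewrite [RHS]mulrDr !mulrA.
Qed.

Lemma Xi_converges_funrpos (f : R -> R) :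
  Xi_converges n1 n2 f -> Xi_converges n1 n2 f^\+.
Proof.
have E p : (fun nu : R => (nu `^ p * f^\+ nu)%:E) =
    ((fun nu : R => (nu `^ p * f nu)%:E) ^\+)%E.
  apply/funext => nu; rewrite funeposE /funrpos -EFin_max; congr EFin.
  by rewrite maxr_pMr ?powR_ge0// mulr0.
by move=> cf y y0; have [i1 i2] := cf y y0; split;
  rewrite E; exact: integrable_funepos.
Qed.

Lemma Xi_convergesN (f : R -> R) :
  Xi_converges n1 n2 f -> Xi_converges n1 n2 (\- f).
Proof.
have E p : (fun nu : R => (nu `^ p * (\- f) nu)%:E) =
    (fun nu : R => - (nu `^ p * f nu)%:E)%E.
  by apply/funext => nu; rewrite mulrN.
by move=> cf y y0; have [i1 i2] := cf y y0; split;
  rewrite E; exact: integrableN.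
Qed.

Lemma XiB (f g : R -> R) (x : R) : Xi_converges n1 n2 f ->
  Xi_converges n1 n2 g -> 0 < x ->
  Xi theta n1 n2 (f \- g) x = Xi theta n1 n2 f x - Xi theta n1 n2 g x.
Proof.
move=> cf cg x0; have [f1 f2] := cf _ x0; have [g1 g2] := cg _ x0.
rewrite /Xi /lower_integral /upper_integral.
under eq_Rintegral do rewrite mulrBr.
rewrite RintegralB//.
under [X in _ + _ * X]eq_Rintegral do rewrite mulrBr.
rewrite RintegralB//.
repeat match goal with |- context [Rintegral ?m ?D ?f] =>
  move: (Rintegral m D f) => ? end.
by ring.
Qed.

End potential.

(** * Discounted rewards after a stopping time *)

Section restart.
Context {R : realType} {d : measure_display} {Omega : measurableType d}.
Variables (P : probability Omega R) (B : R -> Omega -> R).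
Hypothesis BM : standard_brownian_motion P B.
Notation mu := (@lebesgue_measure R).
Variables (r rho theta n1 n2 y : R).
Hypothesis theta0 : theta != 0.
Hypotheses (n1_gt0 : 0 < n1) (n2_lt0 : n2 < 0).
Hypothesis n1_root :
  theta ^+ 2 / 2 * n1 ^+ 2 + (rho - r - theta ^+ 2 / 2) * n1 - rho = 0.
Hypothesis n2_root :
  theta ^+ 2 / 2 * n2 ^+ 2 + (rho - r - theta ^+ 2 / 2) * n2 - rho = 0.
Hypothesis y0 : 0 < y.

Local Notation X := (drifted_brownian B theta (rho - r - theta ^+ 2 / 2) (ln y)).
Local Notation Y := (dual_process B r rho theta y).

Lemma dual_process_expR (t : R) (w : Omega) : Y t w = expR (X t w).
Proof.
rewrite /dual_process /state_price -{1}(lnK (x := y)) ?posrE// -!expRD.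
by congr expR; rewrite /drifted_brownian; ring.
Qed.

Lemma dual_process_gt0 (t : R) (w : Omega) : 0 < Y t w.
Proof. by rewrite dual_process_expR expR_gt0. Qed.

(* Time is clipped to [0, +oo[, where the process is meaningful. *)
Definition discounted_flow (f : R -> R) (z : Omega * R) : R :=
  expR (- rho * z.2) * f (Y (Num.max 0 z.2) z.1).

Lemma measurable_discounted_flow (f : R -> R) :
  measurable_fun setT f -> measurable_fun setT (discounted_flow f).
Proof.
move=> mf; apply: measurable_funM.
  by apply: measurableT_comp => //; exact: measurable_funM.
apply: measurableT_comp => //.
rewrite (_ : (fun z => _) =
    expR \o (fun wt : Omega * R => X (Num.max 0 wt.2) wt.1)); last first.
  by apply/funext => z; rewrite dual_process_expR.
by apply: measurableT_comp => //; exact: (measurable_drifted_path BM).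
Qed.

Local Notation M := (P \x mu)%E.

Section ge0.
Variable g : R -> R.
Hypotheses (mg : measurable_fun setT g) (g0 : forall x, 0 <= g x).
Hypothesis cg : Xi_converges n1 n2 g.

Let gx0 u : (0 <= (g (expR u))%:E)%E. Proof. by rewrite lee_fin. Qed.

Let Xi_dualE (s : R) (w : Omega) : (Xi theta n1 n2 g (Y s w))%:E =
  (\int[mu]_u ((g (expR u))%:E * (green theta n1 n2 (u - X s w))%:E))%E.
Proof.
have := green_potential_Xi theta n1_gt0 n2_lt0 mg g0 cg (dual_process_gt0 s w).
by rewrite {1}dual_process_expR expRK => ->.
Qed.

Lemma measurable_Xi_dual (s : R) : 0 <= s ->
  measurable_fun setT (fun w => (Xi theta n1 n2 g (Y s w))%:E).
Proof.
move=> s0.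
pose f (x : Omega * R) : \bar R :=
  ((g (expR x.2))%:E * (green theta n1 n2 (x.2 - X s x.1))%:E)%E.
rewrite (_ : (fun w => _) = fun w => (\int[mu]_u f (w, u))%E); last first.
  by apply/funext => w; exact: Xi_dualE.
have mXs : measurable_fun setT (X s) by exact: (measurable_drifted_brownian BM).
apply: (measurable_fun_fubini_tonelli_F (m2 := mu) f).
  apply: emeasurable_funM.
    apply/measurable_EFinP; apply: measurableT_comp => //.
    exact: measurableT_comp.
  apply/measurable_EFinP; apply: (measurableT_comp (measurable_green _ _ _)).
  by apply: measurable_funB => //; exact: measurableT_comp.
by move=> x; rewrite mule_ge0// lee_fin// green_ge0.
Qed.

(** The reward collected after the deterministic time [s] on an event known at [s]. It is the
    resolvent identity for [g] composed with the exponential, the potential being recognized as [Xi]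
    at the current position. *)
Lemma ge0_integral_restart (s : R) (A : set Omega) :
  0 <= s -> augmented_filtration P B s A ->
  (\int[M]_(z in A `*` `]s, +oo[) (discounted_flow g z)%:E =
   \int[P]_(w in A) (expR (- rho * s) * Xi theta n1 n2 g (Y s w))%:E)%E.
Proof.
move=> s0 hA; have [mA _] := augmented_filtrationP BM hA.
have mD := measurable_discounted_flow mg.
have mAs : measurable (A `*` (`]s, +oo[%classic : set R)) by exact: measurableX.
have mgx : measurable_fun setT (fun u => (g (expR u))%:E).
  by apply/measurable_EFinP; exact: measurableT_comp.
rewrite integral_mkcond fubini_tonelli1//; last 2 first.
- apply/(measurable_restrictT _ mAs).
  by apply: measurable_funTS; exact/measurable_EFinP.
- move=> z; apply: erestrict_ge0 => x _.
  by rewrite lee_fin mulr_ge0// expR_ge0.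
transitivity (\int[P]_(w in A) \int[mu]_(t in `]s, +oo[)
    ((expR (- rho * t))%:E * (g (expR (X t w)))%:E))%E.
  rewrite [RHS]integral_mkcond; apply: eq_integral => w _; rewrite /fubini_F.
  rewrite [RHS]patchE; case: ifPn => wA; last first.
    apply: integral0_eq => t _; rewrite patchE memNset// => -[/= Aw _].
    by move: wA; rewrite notin_setE.
  rewrite [RHS]integral_mkcond; apply: eq_integral => t _.
  rewrite !patchE in_setX wA/=; case: ifPn => // ts.
  rewrite /discounted_flow /= max_r ?dual_process_expR//.
  by move: ts; rewrite inE/= in_itv/= andbT => /ltW; exact: le_trans.
rewrite (resolvent_drifted BM (ln y) theta0 n1_gt0 n2_lt0 n1_root n2_root s0 hA
  mgx gx0).
by apply: eq_integral => w _; rewrite EFinM Xi_dualE.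
Qed.

Lemma Xi_ge0 (x : R) : 0 < x -> 0 <= Xi theta n1 n2 g x.
Proof.
move=> x0.
rewrite -lee_fin -(green_potential_Xi theta n1_gt0 n2_lt0 mg g0 cg x0).
by apply: integral_ge0 => u _; rewrite mule_ge0// lee_fin// green_ge0.
Qed.

(** Restarting at time 0, where the process is almost surely at [y]. The value is finite, which is
    the source of all integrability statements on the product space. *)
Lemma integral_restart0 :
  (\int[M]_(z in setT `*` `]0%R, +oo[) (discounted_flow g z)%:E =
   (Xi theta n1 n2 g y)%:E)%E.
Proof.
have hT : augmented_filtration P B 0 setT.
  rewrite -setC0; apply: sigma_algebraC; exact: sigma_algebra0.
rewrite (ge0_integral_restart (lexx 0) hT).
rewrite (ae_eq_integral (cst (Xi theta n1 n2 g y)%:E))//.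
- by rewrite integral_cst// [X in (_ * X)%E]probability_setT mule1.
- under eq_fun do rewrite mulr0 expR0 mul1r.
  exact: measurable_Xi_dual.
- have := brownian0 BM; apply: filterS => w Bw0 _ /=.
  rewrite mulr0 expR0 mul1r /dual_process /state_price Bw0 !mulr0 subr0 subr0.
  by rewrite expR0 !mulr1.
Qed.

Lemma ge0_integrable_discounted_flow :
  M.-integrable (setT `*` `]0, +oo[) (EFin \o discounted_flow g).
Proof.
apply/integrableP; split.
  apply/measurable_EFinP; apply: measurable_funTS.
  exact: measurable_discounted_flow.
under eq_integral => z _.
  rewrite /= ger0_norm ?mulr_ge0 ?expR_ge0//. over.
by rewrite integral_restart0 ltry.
Qed.

End ge0.

End restart.

Section stopping.
Context {R : realType} {d : measure_display} {Omega : measurableType d}.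
Variables (P : probability Omega R) (B : R -> Omega -> R).
Hypothesis BM : standard_brownian_motion P B.
Notation mu := (@lebesgue_measure R).
Variables (r rho theta n1 n2 y : R).
Hypothesis theta0 : theta != 0.
Hypotheses (n1_gt0 : 0 < n1) (n2_lt0 : n2 < 0).
Hypothesis n1_root :
  theta ^+ 2 / 2 * n1 ^+ 2 + (rho - r - theta ^+ 2 / 2) * n1 - rho = 0.
Hypothesis n2_root :
  theta ^+ 2 / 2 * n2 ^+ 2 + (rho - r - theta ^+ 2 / 2) * n2 - rho = 0.
Hypothesis y0 : 0 < y.

Local Notation Y := (dual_process B r rho theta y).
Local Notation flow := (discounted_flow B r rho theta y).
Local Notation M := (P \x mu)%E.
Local Notation OR := (Omega * measurableTypeR R)%type.
Local Notation D0 := (([set: Omega] `*` `]0, +oo[%classic) : set OR).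

Section signed.
Variable f : R -> R.
Hypotheses (mf : measurable_fun setT f) (cf : Xi_converges n1 n2 f).

Let mp : measurable_fun setT f^\+. Proof. exact: measurable_funrpos. Qed.
Let mn : measurable_fun setT (\- f)^\+.
Proof. by apply: measurable_funrpos; exact: measurable_funN. Qed.
Let cp : Xi_converges n1 n2 f^\+. Proof. exact: Xi_converges_funrpos. Qed.
Let cn : Xi_converges n1 n2 (\- f)^\+.
Proof. by apply: Xi_converges_funrpos; exact: Xi_convergesN. Qed.
Let p0 x : 0 <= f^\+ x. Proof. by []. Qed.
Let n0 x : 0 <= (\- f)^\+ x. Proof. by []. Qed.

Let fE : f = f^\+ \- (\- f)^\+.
Proof. by rewrite funrposN; apply/funext => x; rewrite -{1}(funrposBneg f). Qed.

Let mD0 : measurable D0. Proof. exact: measurableX. Qed.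

(** The positive and negative parts of [f] inherit convergence of [Xi], so each has a finite total
    reward. *)
Lemma integrable_discounted_flow : M.-integrable D0 (EFin \o flow f).
Proof.
have i1 := ge0_integrable_discounted_flow BM theta0 n1_gt0 n2_lt0 n1_root
  n2_root y0 mp p0 cp.
have i2 := ge0_integrable_discounted_flow BM theta0 n1_gt0 n2_lt0 n1_root
  n2_root y0 mn n0 cn.
apply: (eq_integrable mD0 _ _ _ (integrableB mD0 i1 i2)) => z _ /=.
by rewrite -EFinB /discounted_flow -mulrBr {3}fE.
Qed.

(** The nonnegative restart formula is applied to both parts of [f] and subtracted; integrability of
    each side, proved along with it, makes the subtraction legitimate. *)
Lemma integrable_Xi_dual (s : R) (A : set Omega) : 0 <= s ->
  augmented_filtration P B s A ->
  P.-integrable A (fun w => (expR (- rho * s) * Xi theta n1 n2 f (Y s w))%:E) /\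
  (\int[M]_(z in A `*` `]s, +oo[) (flow f z)%:E =
   \int[P]_(w in A) (expR (- rho * s) * Xi theta n1 n2 f (Y s w))%:E)%E.
Proof.
move=> s0 hA; have [mA _] := augmented_filtrationP BM hA.
pose v g w := expR (- rho * s) * Xi theta n1 n2 g (Y s w).
have mAs : measurable (A `*` `]s, +oo[%classic : set OR) by exact: measurableX.
have sub : A `*` `]s, +oo[%classic `<=` D0.
  move=> [w t] [/= _]; rewrite !in_itv/= !andbT => st; split => //=.
  exact: le_lt_trans st.
have aux (g : R -> R) : measurable_fun setT g -> (forall x, 0 <= g x) ->
    Xi_converges n1 n2 g -> [/\ P.-integrable A (EFin \o v g),
      M.-integrable (A `*` `]s, +oo[) (EFin \o flow g) &
      (\int[M]_(z in A `*` `]s, +oo[) (flow g z)%:E =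
       \int[P]_(w in A) (v g w)%:E)%E].
  move=> mg g0 cg.
  have E := ge0_integral_restart BM theta0 n1_gt0 n2_lt0 n1_root n2_root y0 mg
    g0 cg s0 hA.
  have I : M.-integrable (A `*` `]s, +oo[) (EFin \o flow g).
    apply: (integrableS mD0 mAs sub).
    exact: (ge0_integrable_discounted_flow BM theta0 n1_gt0 n2_lt0 n1_root
      n2_root y0 mg g0 cg).
  split => //; apply/integrableP; split.
    apply: measurable_funTS.
    have := measurable_Xi_dual BM r rho theta n1_gt0 n2_lt0 y0 mg g0 cg s0.
    by move=> m; apply/measurable_EFinP; apply: measurable_funM => //;
      exact/measurable_EFinP.
  have v0 w : 0 <= v g w.
    rewrite mulr_ge0 ?expR_ge0//; apply: Xi_ge0 => //.
    exact: dual_process_gt0.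
  under eq_integral => w _ do rewrite /= ger0_norm//.
  (* The restart formula read backwards: the expectation of the nonnegative [v g] is the integral of
     an integrable flow. *)
  rewrite -E; have /integrableP[_] := I; apply: le_lt_trans.
  apply: ge0_le_integral => //.
  - move=> z _; rewrite lee_fin mulr_ge0 ?expR_ge0//.
  - apply/measurable_EFinP/measurable_funTS.
    exact: (measurable_discounted_flow BM _ _ _ y0).
  - apply: measurableT_comp => //.
    apply/measurable_EFinP/measurable_funTS.
    exact: (measurable_discounted_flow BM _ _ _ y0).
  - by move=> z _; rewrite /= lee_fin ler_norm.
have [i1 j1 e1] := aux _ mp p0 cp; have [i2 j2 e2] := aux _ mn n0 cn.
have vE w : v f w = v f^\+ w - v (\- f)^\+ w.
  by rewrite /v {1}fE XiB ?dual_process_gt0// mulrBr.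
split.
  apply: (eq_integrable mA _ _ _ (integrableB mA i1 i2)) => w _ /=.
  by rewrite -EFinB -/(v f w) vE.
under [RHS]eq_integral do rewrite -/(v f _) vE EFinB.
rewrite integralB_EFin// -e1 -e2 -integralB_EFin//.
by apply: eq_integral => z _; rewrite -EFinB /discounted_flow -mulrBr {1}fE.
Qed.

End signed.

End stopping.

(** * Discretization of stopping times from above *)

Section stopping.
Context {R : realType} {d : measure_display} {Omega : measurableType d}.
Variables (P : probability Omega R) (B : R -> Omega -> R).
Hypothesis BM : standard_brownian_motion P B.
Notation mu := (@lebesgue_measure R).
Variables (r rho theta n1 n2 y : R).
Hypothesis theta0 : theta != 0.
Hypotheses (n1_gt0 : 0 < n1) (n2_lt0 : n2 < 0).
Hypothesis n1_root :
  theta ^+ 2 / 2 * n1 ^+ 2 + (rho - r - theta ^+ 2 / 2) * n1 - rho = 0.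
Hypothesis n2_root :
  theta ^+ 2 / 2 * n2 ^+ 2 + (rho - r - theta ^+ 2 / 2) * n2 - rho = 0.
Hypothesis y0 : 0 < y.

Local Notation Y := (dual_process B r rho theta y).
Local Notation flow := (discounted_flow B r rho theta y).
Local Notation M := (P \x mu)%E.
Local Notation OR := (Omega * measurableTypeR R)%type.
Local Notation D0 := (([set: Omega] `*` `]0, +oo[%classic) : set OR).

Lemma augmented_filtration_le (s t : R) : s <= t ->
  augmented_filtration P B s `<=` augmented_filtration P B t.
Proof.
move=> st; apply: sub_sigma_algebra2 => A [nA|]; last by right.
left; apply: sub_sigma_algebra2 nA => C [u [D [/andP[u0 us] mD ->]]].
by exists u, D; rewrite u0 (le_trans us st).
Qed.

Lemma augmented_filtration_setD (t : R) (A C : set Omega) :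
  augmented_filtration P B t A -> augmented_filtration P B t C ->
  augmented_filtration P B t (A `\` C).
Proof.
move=> hA hC; rewrite setDE; apply: sigma_algebra_setI => //.
exact: sigma_algebraC.
Qed.

Lemma augmented_filtration_bigsetU (t : R) (A : nat -> set Omega) (k : nat) :
  (forall j, (j < k)%N -> augmented_filtration P B t (A j)) ->
  augmented_filtration P B t (\big[setU/set0]_(j < k) A j).
Proof.
elim: k => [|k IH] hA; first by rewrite big_ord0; exact: sigma_algebra0.
rewrite big_ord_recr /= -[X in augmented_filtration _ _ _ X]setCK setCU.
apply: sigma_algebraC; apply: sigma_algebra_setI; apply: sigma_algebraC.
  by apply: IH => j jk; apply: hA; rewrite ltnW.
exact: hA.
Qed.

Definition grid (n k : nat) : R := k%:R / n.+1%:R.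

Lemma grid_ge0 n k : 0 <= grid n k. Proof. by rewrite divr_ge0. Qed.

Lemma grid_le n j k : (j <= k)%N -> grid n j <= grid n k.
Proof. by move=> jk; rewrite ler_pM2r ?invr_gt0// ler_nat. Qed.

Lemma gridS n k : grid n k.+1 = grid n k + n.+1%:R^-1.
Proof. by rewrite /grid -natr1 mulrDl mul1r. Qed.

Section fixed_time.
Variable tau : Omega -> \bar R.
Hypothesis stau : stopping_time P B tau.

(* The event that the first grid point not before tau is grid n k. *)
Definition first_grid (n : nat) : nat -> set Omega :=
  seqDU (fun k => [set w | (tau w <= (grid n k)%:E)%E]).

Lemma first_grid_augmented n k :
  augmented_filtration P B (grid n k) (first_grid n k).
Proof.
apply: augmented_filtration_setD; first exact: (stau.2 _ (grid_ge0 n k)).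
apply: (@augmented_filtration_bigsetU _ (fun j => [set w | (tau w <= (grid n j)%:E)%E])) => j jk.
apply: (augmented_filtration_le (grid_le n (ltnW jk))).
exact: (stau.2 _ (grid_ge0 n j)).
Qed.

Lemma first_grid_measurable n k : measurable (first_grid n k).
Proof. by have [] := augmented_filtrationP BM (@first_grid_augmented n k). Qed.

Lemma first_gridP n k w : first_grid n k w ->
  (tau w <= (grid n k)%:E)%E /\ ((grid n k - n.+1%:R^-1)%:E <= tau w)%E.
Proof.
move=> [/= tk ntk]; split => //; case: k => [|k] in tk ntk *.
  apply: (le_trans _ (stau.1 w)).
  by rewrite lee_fin /grid mul0r sub0r oppr_le0.
rewrite gridS addrK; apply: ltW; rewrite ltNge; apply/negP => tk'.
apply: ntk.
rewrite -(bigcup_mkord _ (fun j => [set w | (tau w <= (grid n j)%:E)%E])).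
by exists k => /=.
Qed.

Lemma first_grid_cover n w : (tau w < +oo)%E -> exists k, first_grid n k w.
Proof.
move=> tw; suff : (\bigcup_k first_grid n k) w by move=> [k _]; exists k.
rewrite -seqDU_bigcup_eq.
have := stau.1 w; move: tw; case E: (tau w) => [t| |]// _ t0.
exists (Num.truncn (t * n.+1%:R)).+1 => //=.
by rewrite E lee_fin ler_pdivlMr// ltW// truncnS_gt.
Qed.

Lemma first_grid_lty n k w : first_grid n k w -> (tau w < +oo)%E.
Proof. by move=> /first_gridP[h _]; apply: le_lt_trans h (ltry _). Qed.

Definition after_grid (n : nat) : set OR :=
  \bigcup_k (first_grid n k `*` `](grid n k), +oo[%classic).

Definition after : set OR := [set z | (tau z.1 < z.2%:E)%E].

Lemma measurable_first_gridX n k :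
  measurable (first_grid n k `*` `](grid n k), +oo[%classic : set OR).
Proof. by apply: measurableX => //; exact: first_grid_measurable. Qed.

Lemma measurable_after_grid n : measurable (after_grid n).
Proof. by apply: bigcup_measurable => k _; exact: measurable_first_gridX. Qed.

Lemma after_grid_sub n : after_grid n `<=` after.
Proof.
move=> [w t] [k _ [/= /first_gridP[h _]]]; rewrite in_itv/= andbT => kt.
by rewrite /after/= (le_lt_trans h)// lte_fin.
Qed.

(** The grids of step [1 / n.+1] are not nested, so the sets [after_grid n] need not increase.
    Still, the first grid point exceeds [tau] by at most one step, so each point strictly after
    [tau] is eventually covered; this is enough for dominated convergence. *)
Lemma after_grid_near z : after z -> \forall n \near \oo, after_grid n z.
Proof.
case: z => w t; rewrite /after/= => tt.
have := stau.1 w; case E: (tau w) tt => [x| |]//; rewrite lte_fin lee_fin => xt x0.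
near=> n.
have nx : n.+1%:R^-1 < t - x.
  by near: n; apply: near_infty_natSinv_lt (PosNum _); rewrite subr_gt0.
have [|k Fk] := @first_grid_cover n w; first by rewrite E ltry.
exists k => //; split => //=; rewrite in_itv/= andbT.
have [_] := first_gridP Fk; rewrite E lee_fin lerBlDr => h.
by rewrite (le_lt_trans h)// -ltrBrDl.
Unshelve. all: by end_near. Qed.

Lemma after_sub : after `<=` D0.
Proof.
move=> [w t] /= tt; split => //=; rewrite in_itv/= andbT.
by rewrite -lte_fin (le_lt_trans (stau.1 w)).
Qed.

Lemma measurable_after : measurable after.
Proof.
rewrite (_ : after = \bigcup_n after_grid n).
  by apply: bigcup_measurable => n _; exact: measurable_after_grid.
apply/seteqP; split => z; last by move=> [n _]; exact: after_grid_sub.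
by move=> /after_grid_near[n _ h]; exists n => //; exact: (h n (leqnn n)).
Qed.

(** Time 0 is left out, in contrast with the closed range of integration in [stopped_value]. *)
Definition before : set OR := D0 `\` after.

Lemma measurable_before : measurable before.
Proof. by apply: measurableD; [exact: measurableX|exact: measurable_after]. Qed.

(** Integrability on the product allows Fubini; for each [w] the section of [before] is the range of
    integration of [stopped_value] deprived of the single time 0. *)
Lemma stopped_valueE (f : R -> R) :
  measurable_fun setT f -> Xi_converges n1 n2 f ->
  stopped_value P B r rho theta f y tau =
    (\int[M]_(z in before) (flow f z)%:E)%E.
Proof.
move=> mf cf.
have I : M.-integrable before (EFin \o flow f).
  apply: integrableS (integrable_discounted_flow BM theta0 n1_gt0 n2_lt0
    n1_root n2_root y0 mf cf); first exact: measurableX.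
    exact: measurable_before.
  exact: subDsetl.
rewrite integral_mkcond -integral12_prod_meas1; last first.
  by apply/(integrable_mkcond _ measurable_before).
apply: eq_integral => w _; rewrite /fubini_F.
have mfw : measurable_fun setT (fun t => flow f (w, t)).
  exact: measurableT_comp (measurable_discounted_flow BM r rho theta y0 mf) _.
have bE : [set t | before (w, t)] =
    [set t | 0 <= t /\ (t%:E <= tau w)%E] `\ (0 : R).
  apply/seteqP; split => t /=.
    move=> [[_ /=]]; rewrite in_itv/= andbT => t0 /negP; rewrite -leNgt => tt.
    by split; [split => //; exact: ltW|apply/eqP; rewrite gt_eqF].
  move=> [[t0 tt] /eqP tn0]; split; last by apply/negP; rewrite -leNgt.
  by split => //=; rewrite in_itv/= andbT lt_neqAle eq_sym tn0.
have mb : measurable [set t | before (w, t)].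
  have := measurable_xsection w measurable_before.
  by rewrite /xsection; under eq_set do rewrite in_setE.
transitivity (\int[mu]_(t in [set t | before (w, t)]) (flow f (w, t))%:E)%E;
  last first.
  rewrite [LHS]integral_mkcond; apply: eq_integral => t _; rewrite !patchE.
  by congr (if _ then _ else _); apply/idP/idP; rewrite !inE.
rewrite bE integral_setD1; last 2 first.
- by rewrite -bE.
- by apply: measurable_funTS; exact/measurable_EFinP.
apply: eq_integral => t; rewrite inE/= => -[t0 _].
by rewrite /discounted_flow/= max_r.
Qed.

Section flow.
Variable g : R -> R.
Hypotheses (mg : measurable_fun setT g) (cg : Xi_converges n1 n2 g).

Let mD0 : measurable D0. Proof. exact: measurableX. Qed.

Let ig : M.-integrable D0 (EFin \o flow g).
Proof.
exact: (integrable_discounted_flow BM theta0 n1_gt0 n2_lt0 n1_root n2_root y0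
  mg cg).
Qed.

Lemma integral_flow : (\int[M]_(z in D0) (flow g z)%:E = (Xi theta n1 n2 g y)%:E)%E.
Proof.
have hT : augmented_filtration P B 0 setT.
  by rewrite -setC0; apply: sigma_algebraC; exact: sigma_algebra0.
have [I ->] := integrable_Xi_dual BM theta0 n1_gt0 n2_lt0 n1_root n2_root y0 mg
  cg (lexx 0) hT.
rewrite (ae_eq_integral (cst (Xi theta n1 n2 g y)%:E))//.
- by rewrite integral_cst// [X in (_ * X)%E]probability_setT mule1.
- exact: measurable_int I.
- have := brownian0 BM; apply: filterS => w Bw0 _ /=.
  rewrite mulr0 expR0 mul1r /dual_process /state_price Bw0 !mulr0 subr0 subr0.
  by rewrite expR0 !mulr1.
Qed.

Lemma integral_before_after :
  (\int[M]_(z in before) (flow g z)%:E +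
   \int[M]_(z in after) (flow g z)%:E = (Xi theta n1 n2 g y)%:E)%E.
Proof.
rewrite -integral_flow -integral_setU.
- by congr (integral _ _ _); rewrite /before setDKU//; exact: after_sub.
- exact: measurable_before.
- exact: measurable_after.
- apply: measurable_funS (measurable_int _ ig) => //.
  by move=> z [[]//|/after_sub].
- by rewrite disj_set2E /before setIC setDIK.
Qed.

Lemma after_grid_integrable n : M.-integrable (after_grid n) (EFin \o flow g).
Proof.
apply: integrableS ig => //; first exact: measurable_after_grid.
by move=> z /after_grid_sub/after_sub.
Qed.

(** The substitute for the strong Markov property: the region is a disjoint union of rectangles, and
    on each one the restart formula applies at the deterministic time [grid n k] to an event known
    at that time. *)
Lemma integral_after_grid n :
  (\int[M]_(z in after_grid n) (flow g z)%:E =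
   \sum_(k <oo) \int[P]_(w in first_grid n k)
     (expR (- rho * grid n k) * Xi theta n1 n2 g (Y (grid n k) w))%:E)%E.
Proof.
rewrite integral_bigcup; last 3 first.
- apply/trivIsetP => i j _ _ ij; rewrite -setXI.
  have := @trivIset_seqDU _ (fun k => [set w | (tau w <= (grid n k)%:E)%E]).
  by move=> /trivIsetP/(_ _ _ I I ij); rewrite -/(first_grid n) => ->; rewrite set0X.
- by move=> k; exact: measurable_first_gridX.
- exact: after_grid_integrable.
apply: eq_eseriesr => k _.
by have [_ ->] := integrable_Xi_dual BM theta0 n1_gt0 n2_lt0 n1_root n2_root y0
  mg cg (grid_ge0 n k) (@first_grid_augmented n k).
Qed.

(** Dominated convergence with bound [|flow g|]: the indicator of [after_grid n] is eventually
    constant at every point, being 0 throughout off [after]. *)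
Lemma cvg_integral_after_grid :
  (\int[M]_(z in after_grid n) (flow g z)%:E @[n --> \oo] -->
   \int[M]_(z in after) (flow g z)%:E)%E.
Proof.
have E (A : set OR) : A `<=` D0 -> (\int[M]_(z in A) (flow g z)%:E =
    \int[M]_(z in D0) ((EFin \o flow g) \_ A) z)%E.
  by move=> AD; rewrite -integral_mkcondr setIidr.
rewrite E; last exact: after_sub.
have subn n : after_grid n `<=` D0 by move=> z /after_grid_sub/after_sub.
under eq_fun => n do rewrite (E _ (subn n)).
have mr (A : set OR) : measurable A ->
    measurable_fun D0 ((EFin \o flow g) \_ A).
  move=> mA; apply/(measurable_restrict _ mA mD0).
  by apply: measurable_funS (measurable_int _ ig).
have [| | | | |_ _ h] := @dominated_convergence _ _ _ M D0 mD0
  (fun n => (EFin \o flow g) \_ (after_grid n)) ((EFin \o flow g) \_ after)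
  (abse \o (EFin \o flow g)); last exact: h.
- by move=> n; apply: mr; exact: measurable_after_grid.
- by apply: mr; exact: measurable_after.
- apply: aeW => z _.
  have [az|naz] := pselect (after z).
    apply: cvg_near_cst; have := after_grid_near az; apply: filterS => n nz.
    by rewrite !patchE !mem_set.
  apply: cvg_near_cst; apply: nearW => n; rewrite !patchE !memNset//.
  by move/after_grid_sub.
- exact: integrable_abse.
- by apply: aeW => z n _; rewrite patchE; case: ifP => _; rewrite ?abse0 ?abse_ge0.
Qed.

Lemma integral_after_ge0 : (forall x, 0 < x -> 0 <= Xi theta n1 n2 g x) ->
  (0 <= \int[M]_(z in after) (flow g z)%:E)%E.
Proof.
move=> g0; apply: (cvge_ge _ cvg_integral_after_grid).
apply: nearW => n; rewrite integral_after_grid; apply: nneseries_ge0 => k _ _.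
apply: integral_ge0 => w _; rewrite lee_fin mulr_ge0 ?expR_ge0// g0//.
exact: dual_process_gt0.
Qed.

End flow.

Lemma stopped_value_le (f g : R -> R) :
  measurable_fun setT f -> Xi_converges n1 n2 f ->
  measurable_fun setT g -> Xi_converges n1 n2 g ->
  (forall x, 0 < x -> f x <= g x) ->
  (forall x, 0 < x -> 0 <= Xi theta n1 n2 g x) ->
  (stopped_value P B r rho theta f y tau <= (Xi theta n1 n2 g y)%:E)%E.
Proof.
move=> mf cf mg cg fg g0; rewrite stopped_valueE//.
rewrite -(integral_before_after mg cg).
have iD h : measurable_fun setT h -> Xi_converges n1 n2 h ->
    M.-integrable before (EFin \o flow h).
  move=> mh ch.
  apply: integrableS (integrable_discounted_flow BM theta0 n1_gt0 n2_lt0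
    n1_root n2_root y0 mh ch); first exact: measurableX.
    exact: measurable_before.
  exact: subDsetl.
apply: (@le_trans _ _ (\int[M]_(z in before) (flow g z)%:E)%E).
  apply: le_integral; [exact: measurable_before|exact: iD|exact: iD|].
  move=> z _; rewrite lee_fin ler_wpM2l ?expR_ge0// fg//.
  exact: dual_process_gt0.
by rewrite leeDl// integral_after_ge0.
Qed.

End fixed_time.

End stopping.

(** * Hitting times of a level *)

Section stopping.
Context {R : realType} {d : measure_display} {Omega : measurableType d}.
Variables (P : probability Omega R) (B : R -> Omega -> R).
Hypothesis BM : standard_brownian_motion P B.
Notation mu := (@lebesgue_measure R).
Variables (r rho theta n1 n2 y : R).
Hypothesis theta0 : theta != 0.
Hypotheses (n1_gt0 : 0 < n1) (n2_lt0 : n2 < 0).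
Hypothesis n1_root :
  theta ^+ 2 / 2 * n1 ^+ 2 + (rho - r - theta ^+ 2 / 2) * n1 - rho = 0.
Hypothesis n2_root :
  theta ^+ 2 / 2 * n2 ^+ 2 + (rho - r - theta ^+ 2 / 2) * n2 - rho = 0.
Hypothesis y0 : 0 < y.

Local Notation Y := (dual_process B r rho theta y).
Local Notation flow := (discounted_flow B r rho theta y).
Local Notation M := (P \x mu)%E.
Local Notation OR := (Omega * measurableTypeR R)%type.
Local Notation D0 := (([set: Omega] `*` `]0, +oo[%classic) : set OR).

Section hitting.
Variable z : R.
Hypothesis z0 : 0 < z.

Local Notation tau := (hitting_time B r rho theta z y).

Lemma dual_process_continuous (w : Omega) :
  {within `[0, +oo[, continuous (fun t => Y t w)}.
Proof.
rewrite (_ : (fun t => Y t w) = expR \o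
    (fun t => drifted_brownian B theta (rho - r - theta ^+ 2 / 2) (ln y) t w));
  last first.
  by apply/funext => t; rewrite dual_process_expR.
have /subspace_continuousP cB := @brownian_continuous _ _ _ _ _ BM w.
apply/subspace_continuousP => t Dt.
apply: (cvg_comp _ expR); last exact: continuous_expR.
apply: cvgB; last by apply: cvgM; [exact: cvg_cst|exact: cB].
apply: cvgD; first exact: cvg_cst.
by apply: cvgM; [exact: cvg_cst|exact: cvg_within].
Qed.

Lemma cvg_dual_process (w : Omega) (u : nat -> R) (s : R) :
  (forall n, 0 <= u n) -> 0 <= s -> u n @[n --> \oo] --> s ->
  Y (u n) w @[n --> \oo] --> Y s w.
Proof.
move=> u0 s0 us.
apply: (@within_continuous_seq R `[0, +oo[%classic (fun t => Y t w) u s) => //.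
- exact: dual_process_continuous.
- by move=> n; rewrite /= in_itv/= andbT.
- by rewrite /= in_itv/= andbT.
Qed.

Lemma hitting_time_ge0 w : (0 <= tau w)%E.
Proof. by apply: le_ereal_inf_tmp => _ [t [t0 _] <-]; rewrite lee_fin. Qed.

Lemma hitting_time_gt (t : R) w : 0 <= t -> (t%:E < tau w)%E -> z < Y t w.
Proof.
move=> t0 tt; rewrite ltNge; apply/negP => Yz.
move: tt; rewrite ltNge => /negP; apply.
by apply: ereal_inf_lbound; exists t.
Qed.

(** Times at which the path is at or below [z] can be chosen within [1 / n.+1] of the infimum; by
    continuity the bound passes to the limit. *)
Lemma hitting_time_attained w : (tau w < +oo)%E ->
  exists s, [/\ 0 <= s, tau w = s%:E & Y s w <= z].
Proof.
move=> tw; have := hitting_time_ge0 w.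
case E: (tau w) tw => [s| |]// _; rewrite lee_fin => s0.
exists s; split => //.
have h (n : nat) : exists t, [/\ s <= t, t < s + n.+1%:R^-1 & 0 <= t /\ Y t w <= z].
  have : (tau w < (s + n.+1%:R^-1)%:E)%E by rewrite E lte_fin ltrDl invr_gt0.
  move=> /ereal_inf_lt[_ [t [t0 Yt] <-]]; rewrite lte_fin => tn.
  exists t; split => //; rewrite -lee_fin -E.
  by apply: ereal_inf_lbound; exists t.
have [u uP] := choice h.
have us : u n @[n --> \oo] --> s.
  apply: (@squeeze_cvgr _ _ _ _ (fun=> s) (fun n => s + n.+1%:R^-1)).
  - by apply: nearW => n; have [-> /ltW ->] := uP n.
  - exact: cvg_cst.
  - rewrite -[X in _ --> X]addr0; apply: cvgD; [exact: cvg_cst|].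
    exact: cvg_harmonic.
have u0 n : 0 <= u n by have [_ _ []] := uP n.
have cY : Y (u n) w @[n --> \oo] --> Y s w by exact: cvg_dual_process.
apply: (cvgr_to_le cY).
by apply: nearW => n; have [_ _ []] := uP n.
Qed.

Lemma hitting_time_leP (t : R) w : 0 <= t ->
  (tau w <= t%:E)%E <-> exists2 s, 0 <= s <= t & Y s w <= z.
Proof.
move=> t0; split=> [tt|[s /andP[s0 st] Ys]].
  have [s [s0 E Ys]] := hitting_time_attained (le_lt_trans tt (ltry t)).
  by exists s => //; rewrite s0 -lee_fin -E.
apply: (@le_trans _ _ s%:E); last by rewrite lee_fin.
by apply: ereal_inf_lbound; exists s.
Qed.

(** The margin above [z] is needed because a path may touch [z] only at a time that belongs to no
    grid; by continuity it is then within any margin of [z] at nearby grid times. *)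
Let level (m n k : nat) (t : R) : set Omega :=
  [set w | grid n k <= t /\ Y (grid n k) w < z + m.+1%:R^-1].

Let level_augmented m n k t : augmented_filtration P B t (level m n k t).
Proof.
have [kt|tk] := leP (grid n k) t; last first.
  rewrite (_ : level m n k t = set0); first exact: sigma_algebra0.
  by rewrite -subset0 => w []; rewrite leNgt tk.
apply: sub_sigma_algebra; left; apply: sub_sigma_algebra.
pose C := [set x : R | y * expR (rho * grid n k) *
  expR (- r * grid n k - theta ^+ 2 / 2 * grid n k - theta * x)
    < z + m.+1%:R^-1].
exists (grid n k), C; split.
- by rewrite grid_ge0.
- rewrite /C -[X in measurable X]setTI.
  apply: (measurable_fun_ltr (f := fun x : R => y * expR (rho * grid n k) *
  expR (- r * grid n k - theta ^+ 2 / 2 * grid n k - theta * x))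
    (g := cst (z + m.+1%:R^-1)) _ _ measurableT (Y := [set true])) => //.
  apply: measurable_funM => //; apply: measurableT_comp => //.
  by apply: measurable_funB => //; exact: measurable_funM.
- by apply/seteqP; split => w; [move=> []|move=> h; split].
Qed.

(** The event [tau <= t] says that for every margin some grid time up to [t] has the path below [z]
    plus the margin. Double complements express the countable intersection through the closure
    properties of a generated sigma-algebra. *)
Lemma hitting_time_stopping : stopping_time P B tau.
Proof.
split; first exact: hitting_time_ge0.
move=> t t0.
rewrite (_ : [set w | _] =
   ~` \bigcup_m ~` \bigcup_n \bigcup_k level m n k t); last first.
  apply/seteqP; split => w.
    move=> /(hitting_time_leP w t0)[s /andP[s0 st] Ys] [m _]; apply.
    have us := grid_below_cvg s0.
    have g0 n : 0 <= grid_below n s by rewrite divr_ge0.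
    have cY : Y (grid_below n s) w @[n --> \oo] --> Y s w.
      exact: cvg_dual_process.
    have : \forall n \near \oo, Y (grid_below n s) w < z + m.+1%:R^-1.
      apply: (cvgr_lt _ cY); rewrite (le_lt_trans Ys)// ltrDl invr_gt0//.
    move=> [n _ /(_ n (leqnn n)) h].
    exists n => //; exists (Num.truncn (n.+1%:R * s)) => //; split => //.
    rewrite (le_trans _ st)// ler_pdivrMr// mulrC.
    by rewrite truncn_le mulr_ge0.
  move=> h; apply/(hitting_time_leP w t0).
  have cY : {within `[0, t], continuous (fun s => Y s w)}.
    have sub : `[0, t]%classic `<=` (`[0, +oo[%classic : set R).
      by move=> s /=; rewrite !in_itv/= andbT => /andP[].
    exact: (continuous_subspaceW sub (@dual_process_continuous w)).
  (* Conversely, the minimum of the path over [[0, t]] lies below [z] plus every margin, hence is at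
     most [z]. *)
  have [s] := EVT_min t0 cY; rewrite in_itv/= => st smin.
  exists s => //; apply/ler_addgt0Pl => e e0; rewrite addrC.
  pose m := Num.truncn e^-1.
  have me : m.+1%:R^-1 <= e.
    by rewrite invf_ple ?posrE// ltW// truncnS_gt.
  apply: (@le_trans _ _ (z + m.+1%:R^-1)); last by rewrite lerD2l.
  have : ~ (~` \bigcup_n \bigcup_k level m n k t) w by move=> nw; apply: h; exists m.
  move=> /contrapT[n _ [k _ [kt Yk]]]; apply: le_trans (ltW Yk).
  by apply: smin; rewrite in_itv/= grid_ge0.
apply: sigma_algebraC; apply: sigma_algebra_bigcup => m.
apply: sigma_algebraC; apply: sigma_algebra_bigcup => n.
by apply: sigma_algebra_bigcup => k; exact: level_augmented.
Qed.

(** If [y <= z] the hitting time is 0 and the process has not moved. Otherwise the path is above [z]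
    strictly before the hitting time and at most [z] at it, so continuity from the left gives [z].
    Null events enter only through [B 0 = 0]. *)
Lemma dual_process_at_hitting :
  {ae P, forall w s, tau w = s%:E -> Y s w = Num.min y z}.
Proof.
have := brownian0 BM; apply: filterS => w Bw0 s E.
have Y0 : Y 0 w = y.
  rewrite /dual_process /state_price Bw0 !mulr0 subr0 subr0.
  by rewrite expR0 !mulr1.
have [|s' [s0 E' Ys]] := @hitting_time_attained w; first by rewrite E ltry.
have ss' : s = s' by move: E'; rewrite E => -[].
rewrite -{}ss' in s0 Ys.
have [yz|zy] := leP y z.
  suff -> : s = 0 by rewrite Y0.
  apply/eqP; rewrite eq_le s0 andbT -lee_fin -E.
  by apply: ereal_inf_lbound; exists 0 => //; split => //; rewrite Y0.
apply/eqP; rewrite eq_le Ys/=.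
have sp : 0 < s.
  rewrite lt_neqAle s0 andbT; apply/eqP => s00.
  by move: Ys; rewrite -s00 Y0 leNgt zy.
pose u (n : nat) := s - s * n.+1%:R^-1.
have nle1 n : n.+1%:R^-1 <= 1 :> R by rewrite invf_le1// ler1n.
have u0 n : 0 <= u n by rewrite subr_ge0 ler_piMr.
have us : u n @[n --> \oo] --> s.
  rewrite -[X in _ --> X]subr0; apply: cvgB; first exact: cvg_cst.
  rewrite -[X in _ --> X](mulr0 s); apply: cvgM; first exact: cvg_cst.
  exact: cvg_harmonic.
have cY : Y (u n) w @[n --> \oo] --> Y s w by exact: cvg_dual_process.
apply: (cvgr_to_ge cY).
apply: nearW => n; apply: ltW; apply: hitting_time_gt => //.
by rewrite E lte_fin gtrBl mulr_gt0// invr_gt0.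
Qed.

Hypothesis rho_ge0 : 0 <= rho.

Local Notation c := (Num.min y z).
Local Notation first_grid := (first_grid tau).
Local Notation after := (after tau).

Let stau : stopping_time P B tau. Proof. exact: hitting_time_stopping. Qed.

Let stopped_event : set Omega := [set w | (tau w < +oo)%E].

(** Where [tau] is infinite no grid point qualifies and the index defaults to 0: hence the
    additional piece for [k = 0] in the measurability proof, and the restriction of the integrals
    below to [stopped_event]. *)
Let first_grid_index n w : nat := xget 0%N [set k | first_grid n k w].

Let first_grid_indexP n w : stopped_event w ->
  first_grid n (first_grid_index n w) w.
Proof.
move=> sw; rewrite /first_grid_index; case: xgetP => [k _ //|].
by have [k Fk] := first_grid_cover stau n sw; move=> /(_ k).
Qed.

Let bigcup_first_grid n : \bigcup_k first_grid n k = stopped_event.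
Proof.
apply/seteqP; split => w; first by move=> [k _ /(first_grid_lty stau)].
by move=> /(first_grid_cover stau n)[k Fk]; exists k.
Qed.

Let measurable_stopped_event : measurable stopped_event.
Proof.
rewrite -(bigcup_first_grid 0); apply: bigcup_measurable => k _.
exact: (first_grid_measurable BM stau).
Qed.

Let first_grid_inj n j k w : first_grid n j w -> first_grid n k w -> j = k.
Proof.
move=> Fj Fk; apply/eqP; apply: contraT => jk.
have /trivIsetP/(_ j k I I jk) :=
  @trivIset_seqDU _ (fun k => [set w | (tau w <= (grid n k)%:E)%E]).
by move=> E; have : set0 w by rewrite -E.
Qed.

Let measurable_first_grid_index n k :
  measurable (first_grid_index n @^-1` [set k]).
Proof.
have mF j : measurable (first_grid n j) by exact: (first_grid_measurable BM stau).
rewrite (_ : _ @^-1` _ = first_grid n k `|`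
    ((if k == 0%N then setT else set0) `\` stopped_event)); last first.
  apply/seteqP; split => w /=.
    have [sw <-|nsw] := pselect (stopped_event w).
      by left; exact: first_grid_indexP.
    rewrite /first_grid_index; case: xgetP => [j _ Fj _|_ <-]; last by right.
    by case: nsw; exact: (first_grid_lty stau Fj).
  move=> [Fk|[]].
    have sw : stopped_event w by exact: (first_grid_lty stau Fk).
    by apply: first_grid_inj Fk; exact: first_grid_indexP.
  case: eqP => [-> _|//] nsw.
  rewrite /first_grid_index; case: xgetP => [j _ Fj|//].
  by case: nsw; exact: (first_grid_lty stau Fj).
by apply: measurableU => //; apply: measurableD => //; case: ifP.
Qed.

Let cvg_first_grid (w : Omega) (s : R) : tau w = s%:E ->
  grid n (first_grid_index n w) @[n --> \oo] --> s.
Proof.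
move=> E; have sw : stopped_event w by rewrite /stopped_event/= E ltry.
apply: (@squeeze_cvgr _ _ _ _ (fun=> s) (fun n => s + n.+1%:R^-1)).
- apply: nearW => n.
  have [] := first_gridP stau (first_grid_indexP n sw).
  by rewrite E !lee_fin lerBlDr => -> ->.
- exact: cvg_cst.
- rewrite -[X in _ --> X]addr0; apply: cvgD; [exact: cvg_cst|].
  exact: cvg_harmonic.
Qed.

(** The reward after the hitting time is the limit of the expectations of [exp(-rho T) Xi(Y_T)],
    with [T] the grid approximation. The bound [C] dominates; the position tends almost surely to
    [min y z], so by continuity the absolute values tend to [|Xi(min y z)|], and the event of
    hitting has probability at most 1. An inequality suffices, as it serves to show that the reward
    vanishes. *)
Lemma integral_after_hitting_le (g : R -> R) (C : R) :
  measurable_fun setT g -> Xi_converges n1 n2 g ->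
  (forall x, 0 < x -> `|Xi theta n1 n2 g x| <= C) ->
  {for c, continuous (Xi theta n1 n2 g)} ->
  (`|\int[M]_(x in after) (flow g x)%:E| <= `|Xi theta n1 n2 g c|%:E)%E.
Proof.
move=> mg cg gC gc.
pose v := Xi theta n1 n2 g.
have hT s : augmented_filtration P B s setT.
  by rewrite -setC0; apply: sigma_algebraC; exact: sigma_algebra0.
have mev s : 0 <= s -> measurable_fun setT (fun w => expR (- rho * s) * v (Y s w)).
  move=> s0; apply/measurable_EFinP.
  have [I _] := integrable_Xi_dual BM theta0 n1_gt0 n2_lt0 n1_root n2_root y0
    mg cg s0 (hT s).
  exact: measurable_int I.
have mv s : 0 <= s -> measurable_fun setT (fun w => v (Y s w)).
  move=> s0; rewrite (_ : (fun w => _) =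
    fun w => expR (rho * s) * (expR (- rho * s) * v (Y s w))).
    by apply: measurable_funM => //; exact: mev.
  by apply/funext => w; rewrite mulrA -expRD mulNr subrr expR0 mul1r.
pose T (n : nat) (w : Omega) : R := grid n (first_grid_index n w).
pose Phi (n : nat) (w : Omega) : R := expR (- rho * T n w) * v (Y (T n w) w).
pose psi (n : nat) (w : Omega) : R := `|v (Y (T n w) w)|.
have mPhi n : measurable_fun setT (Phi n).
  apply: (measurable_fun_select (kappa := first_grid_index n)
    (g := fun k w => expR (- rho * grid n k) * v (Y (grid n k) w))).
    exact: measurable_first_grid_index.
  by move=> k; apply: mev; exact: grid_ge0.
have mpsi n : measurable_fun setT (psi n).
  apply: measurableT_comp => //.
  apply: (measurable_fun_select (kappa := first_grid_index n)
    (g := fun k w => v (Y (grid n k) w))).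
    exact: measurable_first_grid_index.
  by move=> k; apply: mv; exact: grid_ge0.
have psiC n w : psi n w <= C by apply: gC; exact: dual_process_gt0.
(* The discount factor is at most 1 because [rho >= 0] and grid times are nonnegative. *)
have Phipsi n w : `|Phi n w| <= psi n w.
  rewrite normrM ger0_norm ?expR_ge0// ler_piMl// -[leRHS]expR0 ler_expR.
  by rewrite mulNr oppr_le0 mulr_ge0// grid_ge0.
have iC : P.-integrable stopped_event (EFin \o cst C).
  by apply: finite_measure_integrable_cst.
have iPhi n : P.-integrable stopped_event (EFin \o Phi n).
  apply: le_integrable iC => //; first exact/measurable_EFinP/measurable_funTS.
  move=> w _ /=; rewrite lee_fin (le_trans (Phipsi n w))// (le_trans (psiC n w))//.
  exact: ler_norm.
have le n : (`|\int[M]_(x in after_grid tau n) (flow g x)%:E| <=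
    \int[P]_(w in stopped_event) (psi n w)%:E)%E.
  rewrite (integral_after_grid BM theta0 n1_gt0 n2_lt0 n1_root n2_root y0 stau
    mg cg).
  have -> : (\sum_(k <oo) \int[P]_(w in first_grid n k)
     (expR (- rho * grid n k) * Xi theta n1 n2 g (Y (grid n k) w))%:E)%E =
     (\int[P]_(w in stopped_event) (Phi n w)%:E)%E.
    rewrite -(bigcup_first_grid n) integral_bigcup.
    - apply: eq_eseriesr => k _; apply: eq_integral => w; rewrite inE => Fk.
      have -> : k = first_grid_index n w; last by [].
      have sw : stopped_event w by exact: (first_grid_lty stau Fk).
      by apply: (first_grid_inj Fk); exact: first_grid_indexP.
    - exact: trivIset_seqDU.
    - by move=> k; exact: (first_grid_measurable BM stau).
    - by rewrite bigcup_first_grid; exact: iPhi.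
  apply: (le_trans (le_abse_integral _ _ _)) => //.
    exact/measurable_EFinP/measurable_funTS.
  apply: ge0_le_integral => //.
  - by apply: measurableT_comp => //; exact/measurable_EFinP/measurable_funTS.
  - exact/measurable_EFinP/measurable_funTS.
  - by move=> w _; rewrite lee_fin.
have c1 := cvg_integral_after_grid BM theta0 n1_gt0 n2_lt0 n1_root n2_root y0
  stau mg cg.
have c2 : (\int[P]_(w in stopped_event) (psi n w)%:E @[n --> \oo] -->
    \int[P]_(w in stopped_event) (cst `|v c|%:E w))%E.
  have [| | | | |_ _ h] := @dominated_convergence _ _ _ P stopped_event
    measurable_stopped_event (fun n => EFin \o psi n) (cst `|v c|%:E)
    (EFin \o cst C); last exact: h.
  - by move=> n; exact/measurable_EFinP/measurable_funTS.
  - exact: measurable_cst.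
  - have := dual_process_at_hitting; apply: filterS => w hw sw.
    have [s [s0 E _]] := hitting_time_attained sw.
    apply: cvg_EFin; first by apply: nearW.
    apply: cvg_norm.
    apply: (cvg_comp (fun n => Y (T n w) w) v); last exact: gc.
    rewrite -(hw s E); apply: cvg_dual_process => //; first by move=> n; exact: grid_ge0.
    exact: cvg_first_grid.
  - exact: iC.
  - by apply: aeW => w n _; rewrite lee_fin normr_id; exact: psiC.
have : (`|\int[M]_(x in after) (flow g x)%:E| <=
    \int[P]_(w in stopped_event) (cst `|v c|%:E w))%E.
  rewrite -(cvg_lim _ (cvg_abse c1))// -(cvg_lim _ c2)//.
  apply: lee_lim; [exact: cvgP (cvg_abse c1)|exact: cvgP c2|].
  by apply: nearW => n; exact: le.
move/le_trans; apply.
rewrite integral_cst//.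
rewrite -[leRHS]mule1; apply: lee_pmul => //.
exact: probability_le1.
Qed.

End hitting.

End stopping.

(** * The function Xi and its truncations *)

Section Xi_analysis.
Context {R : realType}.
Notation mu := (@lebesgue_measure R).
Variables (theta n1 n2 : R).

Lemma powR_continuous (p x : R) : 0 < x -> {for x, continuous (fun t => t `^ p)}.
Proof.
move=> x0; apply: differentiable_continuous; apply/derivable1_diffP.
by apply: derivable_powR; rewrite in_itv/= x0.
Qed.

Section converges.
Variable f : R -> R.
Hypothesis cf : Xi_converges n1 n2 f.

Lemma Xi_converges_itv (p a b : R) : p = - n1 - 1 \/ p = - n2 - 1 -> 0 < a ->
  mu.-integrable `[a, b] (fun nu => (nu `^ p * f nu)%:E).
Proof.
move=> [->|->] a0.
- have [_ I] := cf (divr_gt0 a0 (ltr0n _ 2)).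
  apply: integrableS I => // nu /=; rewrite !in_itv/= andbT => /andP[+ _].
  by apply: lt_le_trans; rewrite ltr_pdivrMr// ltr_pMr// ltr1n.
(* If [b + 1 <= 0], the interval [[a, b]] is empty because [a > 0]. *)
- have [a1b|ba] := ltP 0 (b + 1); last first.
    rewrite set_itv_ge; first exact: integrable_set0.
    by rewrite bnd_simp -ltNge; move: a0 ba; lra.
  have [I _] := cf a1b.
  apply: integrableS I => // nu /=; rewrite !in_itv/= => /andP[an nb].
  by rewrite (lt_le_trans a0 an)/= (le_lt_trans nb)// ltrDl.
Qed.

Lemma lower_integral_split (a u : R) : 0 < a <= u ->
  lower_integral n2 f u = lower_integral n2 f a
    + \int[mu]_(nu in `[a, u]) (nu `^ (- n2 - 1) * f nu).
Proof.
move=> /andP[a0 au]; have u0 := lt_le_trans a0 au.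
have [I _] := cf (ltr_wpDr ler01 u0).
have Iu : mu.-integrable `]0, u] (fun nu => (nu `^ (- n2 - 1) * f nu)%:E).
  apply: integrableS I => // nu /=; rewrite !in_itv/= => /andP[-> nu1]/=.
  by rewrite (le_lt_trans nu1)// ltrDl.
have E : `]0, u]%classic = `]0, a[%classic `|` `[a, u]%classic :> set R.
  by rewrite -itv_bndbnd_setU// bnd_simp// ltW.
rewrite /lower_integral Rintegral_itv_bndo_bndc; last first.
  apply: integrableS Iu => // nu /=; rewrite !in_itv/= => /andP[->/= /ltW].
  by [].
rewrite E Rintegral_setU//; first by rewrite -E.
rewrite disj_set2E; apply/eqP; rewrite -subset0 => nu /=; rewrite !in_itv/=.
by move=> [/andP[_ h1] /andP[h2 _]]; move: (lt_le_trans h1 h2); rewrite ltxx.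
Qed.

Lemma upper_integral_split (a u : R) : 0 < a <= u ->
  upper_integral n1 f a = \int[mu]_(nu in `[a, u]) (nu `^ (- n1 - 1) * f nu)
    + upper_integral n1 f u.
Proof.
move=> /andP[a0 au]; have u0 := lt_le_trans a0 au.
have [_ I] := cf a0.
have E : `]a, +oo[%classic = `]a, u]%classic `|` `]u, +oo[%classic :> set R.
  by rewrite -itv_bndbnd_setU// bnd_simp// ltW.
have Iu : mu.-integrable `]a, u] (fun nu => (nu `^ (- n1 - 1) * f nu)%:E).
  by apply: integrableS I => //; rewrite E; exact: subsetUl.
rewrite /upper_integral -Rintegral_itv_obnd_cbnd//.
rewrite E Rintegral_setU//; first by rewrite -E.
rewrite disj_set2E; apply/eqP; rewrite -subset0 => nu /=; rewrite !in_itv/=.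
by move=> [/andP[_ h1] /andP[h2 _]]; move: (le_lt_trans h1 h2); rewrite ltxx.
Qed.

(** Continuity of an integral in its upper end is local: the lower end [x / 2] stays away from 0,
    where only weighted integrability is known. *)
Let cvg_param (p x : R) : p = - n1 - 1 \/ p = - n2 - 1 -> 0 < x ->
  {for x, continuous (fun u => \int[mu]_(nu in `[x / 2, u]) (nu `^ p * f nu))}.
Proof.
move=> hp x0.
have x20 : 0 < x / 2 by rewrite divr_gt0.
have xx2 : x / 2 < x by rewrite ltr_pdivrMr// ltr_pMr// ltr1n.
have := @parameterized_integral_continuous R (x / 2) (x + 1)
  (fun nu => nu `^ p * f nu).
have x2x1 : x / 2 < x + 1 by rewrite (lt_trans xx2)// ltrDl.
move=> /(_ (ltW x2x1) (Xi_converges_itv _ hp x20)) c.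
have /continuous_within_itvP := c; move=> /(_ x2x1)[+ _ _] => /(_ x); apply.
by rewrite in_itv/= xx2 ltrDl/=.
Qed.

Let half_near (x : R) : 0 < x -> \forall u \near x, 0 < x / 2 <= u.
Proof.
move=> x0; have x20 : 0 < x / 2 by rewrite divr_gt0.
have xx2 : x / 2 < x by rewrite ltr_pdivrMr// ltr_pMr// ltr1n.
have xI : x \in `](x / 2), (x + 1)[ by rewrite in_itv/= xx2 ltrDl/=.
apply: filterS (near_in_itvoo xI) => u; rewrite in_itv/= x20 => /andP[+ _].
exact: ltW.
Qed.

Lemma lower_integral_continuous (x : R) : 0 < x ->
  {for x, continuous (lower_integral n2 f)}.
Proof.
move=> x0; have nx := half_near x0.
have x20 : 0 < x / 2 by rewrite divr_gt0.
have xx2 : x / 2 < x by rewrite ltr_pdivrMr// ltr_pMr// ltr1n.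
suff : lower_integral n2 f u @[u --> x] --> lower_integral n2 f x by [].
rewrite (lower_integral_split (a := x / 2)); last by rewrite x20 ltW.
have H : cvg_to (lower_integral n2 f u @[u --> x]) ((lower_integral n2 f (x / 2)
    + \int[mu]_(nu in `[x / 2, u]) (nu `^ (- n2 - 1) * f nu)) @[u --> x]).
  apply: near_eq_cvg; apply: filterS nx => u xu /=.
  by rewrite -lower_integral_split.
apply: (cvg_trans H).
have c1 : lower_integral n2 f (x / 2) @[u --> x] --> lower_integral n2 f (x / 2).
  exact: cvg_cst.
have c2 : \int[mu]_(nu in `[x / 2, u]) (nu `^ (- n2 - 1) * f nu) @[u --> x] -->
  \int[mu]_(nu in `[x / 2, x]) (nu `^ (- n2 - 1) * f nu).
  exact: (cvg_param (or_intror erefl) x0).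
exact: (cvgD c1 c2).
Qed.

Lemma upper_integral_continuous (x : R) : 0 < x ->
  {for x, continuous (upper_integral n1 f)}.
Proof.
move=> x0; have nx := half_near x0.
have x20 : 0 < x / 2 by rewrite divr_gt0.
have xx2 : x / 2 < x by rewrite ltr_pdivrMr// ltr_pMr// ltr1n.
suff : upper_integral n1 f u @[u --> x] --> upper_integral n1 f x by [].
have E u : 0 < x / 2 <= u -> upper_integral n1 f u = upper_integral n1 f (x / 2)
    - \int[mu]_(nu in `[x / 2, u]) (nu `^ (- n1 - 1) * f nu).
  by move=> /upper_integral_split ->; rewrite addrAC subrr add0r.
rewrite E; last by rewrite x20 ltW.
have H : cvg_to (upper_integral n1 f u @[u --> x]) ((upper_integral n1 f (x / 2)
    - \int[mu]_(nu in `[x / 2, u]) (nu `^ (- n1 - 1) * f nu)) @[u --> x]).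
  by apply: near_eq_cvg; apply: filterS nx => u xu /=; rewrite -E.
apply: (cvg_trans H).
have c1 : upper_integral n1 f (x / 2) @[u --> x] --> upper_integral n1 f (x / 2).
  exact: cvg_cst.
have c2 : \int[mu]_(nu in `[x / 2, u]) (nu `^ (- n1 - 1) * f nu) @[u --> x] -->
  \int[mu]_(nu in `[x / 2, x]) (nu `^ (- n1 - 1) * f nu).
  exact: (cvg_param (or_introl erefl) x0).
exact: (cvgB c1 c2).
Qed.

Lemma Xi_continuous (x : R) : 0 < x -> {for x, continuous (Xi theta n1 n2 f)}.
Proof.
move=> x0.
have cl : lower_integral n2 f u @[u --> x] --> lower_integral n2 f x.
  exact: lower_integral_continuous.
have cu : upper_integral n1 f u @[u --> x] --> upper_integral n1 f x.
  exact: upper_integral_continuous.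
have p2 : u `^ n2 @[u --> x] --> x `^ n2 by exact: powR_continuous.
have p1 : u `^ n1 @[u --> x] --> x `^ n1 by exact: powR_continuous.
have k0 : 2 / (theta ^+ 2 * (n1 - n2)) @[u --> x] --> 2 / (theta ^+ 2 * (n1 - n2)).
  exact: cvg_cst.
exact: (cvgM k0 (cvgD (cvgM p2 cl) (cvgM p1 cu))).
Qed.

Hypothesis mf : measurable_fun setT f.

Lemma measurable_powRM (p : R) : measurable_fun setT (fun nu : R => nu `^ p * f nu).
Proof. by apply: measurable_funM => //; exact: measurable_powR. Qed.

Lemma Xi_converges_restrict (A : set R) : measurable A ->
  Xi_converges n1 n2 (f \_ A).
Proof.
move=> mA x x0.
have mfA : measurable_fun setT (f \_ A).
  by apply/(measurable_restrictT f mA); exact: measurable_funTS.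
have aux p D : measurable D -> mu.-integrable D (fun nu => (nu `^ p * f nu)%:E) ->
    mu.-integrable D (fun nu => (nu `^ p * (f \_ A) nu)%:E).
  move=> mD; apply: le_integrable => //.
    apply/measurable_EFinP; apply: measurable_funTS.
    by apply: measurable_funM => //; exact: measurable_powR.
  move=> nu _ /=; rewrite lee_fin patchE; case: ifP => // _.
  by rewrite mulr0 normr0.
by have [I1 I2] := cf x0; split; apply: aux.
Qed.

(** The bound does not depend on [D], hence not on the point at which [Xi] is evaluated. *)
Lemma normr_Rintegral_restrict (p a b : R) (D : set R) : measurable D ->
  p = - n1 - 1 \/ p = - n2 - 1 -> 0 < a ->
  `|\int[mu]_(nu in D) (nu `^ p * (f \_ `[a, b]) nu)| <=
  \int[mu]_(nu in `[a, b]) `|nu `^ p * f nu|.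
Proof.
move=> mD hp a0; have I := Xi_converges_itv b hp a0.
pose F nu := nu `^ p * f nu.
have mF : measurable_fun setT F := measurable_powRM p.
have E : (fun nu => (nu `^ p * (f \_ `[a, b]) nu)) = F \_ `[a, b].
  by apply/funext => nu; rewrite !patchE; case: ifP => //; rewrite mulr0.
have ID : mu.-integrable D (EFin \o (F \_ `[a, b])).
  rewrite (_ : EFin \o _ = (EFin \o F) \_ `[a, b]); last first.
    by apply/funext => nu; rewrite /= !patchE; case: ifP.
  apply/integrable_restrict => //.
  by apply: integrableS I => //; exact: measurableI.
rewrite E.
have := @le_normr_Rintegral _ _ _ mu D (F \_ `[a, b]) mD ID; move=> /le_trans; apply.
rewrite -lee_fin /Rintegral !fineK; last 2 first.
- by apply: integrable_fin_num => //; exact: (integrable_norm I).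
- by apply: integrable_fin_num => //; exact: (integrable_norm ID).
rewrite (_ : (fun nu => _) = ((fun nu => `|F nu|%:E) \_ `[a, b])); last first.
  by apply/funext => nu; rewrite !patchE; case: ifP => // _; rewrite normr0.
rewrite -integral_mkcondr; apply: ge0_subset_integral => //.
- exact: measurableI.
- apply/measurable_EFinP/measurable_funTS; exact: measurableT_comp.
Qed.

End converges.

End Xi_analysis.

Section truncation.
Context {R : realType}.
Notation mu := (@lebesgue_measure R).
Variables (theta n1 n2 : R).
Hypotheses (n1_gt0 : 0 < n1) (n2_lt0 : n2 < 0).
Variables (f : R -> R) (z : R).
Hypotheses (mf : measurable_fun setT f) (cf : Xi_converges n1 n2 f) (z0 : 0 < z).

Definition flow_above : R -> R := f \_ `[z, +oo[.
(** The cut-off at [m] confines the reward to a compact interval away from 0, which makes [Xi]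
    bounded on the positive axis. *)
Definition flow_between (m : nat) : R -> R := f \_ `[z, m%:R].

Let powM_restrict (p : R) (A : set R) :
  (fun nu => nu `^ p * (f \_ A) nu) = (fun nu => nu `^ p * f nu) \_ A.
Proof. by apply/funext => nu; rewrite !patchE; case: ifP => //; rewrite mulr0. Qed.

Lemma measurable_flow_above : measurable_fun setT flow_above.
Proof. by apply/(measurable_restrictT f _) => //; exact: measurable_funTS. Qed.

Lemma measurable_flow_between m : measurable_fun setT (flow_between m).
Proof. by apply/(measurable_restrictT f _) => //; exact: measurable_funTS. Qed.

Lemma Xi_converges_flow_above : Xi_converges n1 n2 flow_above.
Proof. exact: Xi_converges_restrict. Qed.

Lemma Xi_converges_flow_between m : Xi_converges n1 n2 (flow_between m).
Proof. exact: Xi_converges_restrict. Qed.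

Lemma lower_integral_restrict0 (A : set R) (x : R) : A `<=` `[z, +oo[%classic ->
  x <= z -> lower_integral n2 (f \_ A) x = 0.
Proof.
move=> Az xz; rewrite /lower_integral (@eq_Rintegral _ _ _ _ _ (cst 0)).
  by rewrite /Rintegral/= integral0.
move=> nu; rewrite inE/= in_itv/= => /andP[_ nx]; rewrite patchE memNset ?mulr0//.
by move=> /Az/=; rewrite in_itv/= andbT leNgt (lt_le_trans nx).
Qed.

Lemma upper_integral_between0 (m : nat) (x : R) :
  m%:R <= x -> upper_integral n1 (flow_between m) x = 0.
Proof.
move=> mx; rewrite /upper_integral (@eq_Rintegral _ _ _ _ _ (cst 0)).
  by rewrite /Rintegral/= integral0.
move=> nu; rewrite inE/= in_itv/= andbT => xn; rewrite /flow_between patchE.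
rewrite memNset ?mulr0//= in_itv/= => /andP[_]; rewrite leNgt.
by rewrite (le_lt_trans mx xn).
Qed.

Lemma upper_integral_above_le (x : R) : 0 < x <= z ->
  upper_integral n1 flow_above x = upper_integral n1 f z.
Proof.
move=> /andP[x0 xz]; rewrite /upper_integral /flow_above powM_restrict.
rewrite -Rintegral_mkcondr.
have [xz'|zx] := ltP x z; last first.
  have -> : z = x by apply/le_anti/andP.
  by rewrite setIidl//; apply: subset_itvr; rewrite bnd_simp.
rewrite setIidr; last by apply: subset_itvr; rewrite bnd_simp.
rewrite Rintegral_itv_obnd_cbnd//.
have [_ I] := cf x0; apply: integrableS I => //.
by apply: subset_itvr; rewrite bnd_simp.
Qed.

Lemma upper_integral_above_ge (x : R) : z <= x ->
  upper_integral n1 flow_above x = upper_integral n1 f x.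
Proof.
move=> zx; apply: eq_Rintegral => nu; rewrite inE/= in_itv/= andbT => xn.
rewrite /flow_above patchE mem_set//= in_itv/= andbT.
by rewrite (le_trans zx)// ltW.
Qed.

Lemma lower_integral_above (x : R) : z <= x ->
  lower_integral n2 flow_above x = lower_integral n2 f x - lower_integral n2 f z.
Proof.
move=> zx; rewrite (lower_integral_split cf (a := z) (u := x)) ?z0//.
rewrite addrAC subrr add0r /lower_integral /flow_above powM_restrict.
rewrite -Rintegral_mkcondr -Rintegral_itv_bndo_bndc.
  congr Rintegral; apply/seteqP; split => nu /=; rewrite !in_itv/= ?andbT.
    by move=> [/andP[_ ->] ->].
  by move=> /andP[zn ->]; rewrite zn (lt_le_trans z0 zn).
have := Xi_converges_itv cf x (or_intror erefl) z0; apply: integrableS => //.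
by apply: subset_itvl; rewrite bnd_simp.
Qed.

Hypothesis Uz : upper_integral n1 f z = 0.

Lemma Xi_above_le (x : R) : 0 < x <= z -> Xi theta n1 n2 flow_above x = 0.
Proof.
move=> /andP[x0 xz]; rewrite /Xi lower_integral_restrict0//.
by rewrite upper_integral_above_le ?x0// Uz !mulr0 addr0 mulr0.
Qed.

Lemma Xi_above_ge (x : R) : z <= x -> Xi theta n1 n2 flow_above x =
  homogeneous_coef theta n1 n2 f z * x `^ n2 + Xi theta n1 n2 f x.
Proof.
move=> zx; rewrite /Xi upper_integral_above_ge// lower_integral_above//.
by rewrite /homogeneous_coef; ring.
Qed.

(** The lower integral vanishes for [x <= z], and beyond [z] the factor [x^n2] is at most [z^n2];
    the upper integral vanishes for [x >= m], and before [m] the factor [x^n1] is at most [m^n1]. *)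
Lemma Xi_between_bounded (m : nat) :
  exists C, forall x, 0 < x -> `|Xi theta n1 n2 (flow_between m) x| <= C.
Proof.
pose A := \int[mu]_(nu in `[z, m%:R]) `|nu `^ (- n2 - 1) * f nu|.
pose C := \int[mu]_(nu in `[z, m%:R]) `|nu `^ (- n1 - 1) * f nu|.
have A0 : 0 <= A by apply: Rintegral_ge0.
have C0 : 0 <= C by apply: Rintegral_ge0.
exists (`|2 / (theta ^+ 2 * (n1 - n2))| * (z `^ n2 * A + m%:R `^ n1 * C)) => x x0.
have zm : `[z, m%:R]%classic `<=` `[z, +oo[%classic.
  by apply: subset_itvl; rewrite bnd_simp.
have lowb : x `^ n2 * `|lower_integral n2 (flow_between m) x| <= z `^ n2 * A.
  have [xz|zx] := leP x z.
    rewrite (lower_integral_restrict0 zm xz) normr0 mulr0.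
    by rewrite (mulr_ge0 (powR_ge0 _ _) A0).
  apply: ler_pM; [exact: powR_ge0|exact: normr_ge0| |].
    rewrite -[n2]opprK (powRN x) (powRN z) lef_pV2 ?posrE ?powR_gt0//.
    by rewrite ge0_ler_powR ?nnegrE ?oppr_ge0 1?ltW.
  by apply: (normr_Rintegral_restrict cf mf _ _ (or_intror erefl) z0).
have uppb : x `^ n1 * `|upper_integral n1 (flow_between m) x| <= m%:R `^ n1 * C.
  have [mx|xm] := leP m%:R x.
    rewrite (upper_integral_between0 mx) normr0 mulr0.
    by rewrite (mulr_ge0 (powR_ge0 _ _) C0).
  apply: ler_pM; [exact: powR_ge0|exact: normr_ge0| |].
    by apply: ge0_ler_powR; rewrite ?nnegrE ?ler0n// ltW.
  by apply: (normr_Rintegral_restrict cf mf _ _ (or_introl erefl) z0).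
rewrite /Xi normrM; apply: ler_wpM2l; first exact: normr_ge0.
apply: (le_trans (ler_normD _ _)); apply: lerD.
  rewrite normrM (ger0_norm (powR_ge0 x n2)); exact: lowb.
rewrite normrM (ger0_norm (powR_ge0 x n1)); exact: uppb.
Qed.

Lemma flow_between_near (x : R) : \forall m \near \oo, flow_between m x = flow_above x.
Proof.
near=> m; rewrite /flow_between /flow_above !patchE.
have xm : x <= m%:R by near: m; exact: nbhs_infty_ger.
have -> : (x \in `[z, m%:R]%classic) = (x \in `[z, +oo[%classic) => //.
by apply/idP/idP; rewrite !inE/= !in_itv/= andbT ?xm ?andbT// => /andP[].
Unshelve. all: by end_near. Qed.

Lemma normr_flow_between (m : nat) (x : R) : `|flow_between m x| <= `|flow_above x|.
Proof.
rewrite /flow_between /flow_above !patchE.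
case: ifPn => [|_]; last by rewrite normr0.
by rewrite inE/= in_itv/= => /andP[zx _]; rewrite mem_set//= in_itv/= zx.
Qed.

(** At a point [c <= z] only the upper integral is left. By dominated convergence it tends to the
    one for [flow_above], which is the upper integral of [f] from [z], zero by [Uz]. *)
Lemma Xi_between_cvg (c : R) : 0 < c <= z ->
  Xi theta n1 n2 (flow_between m) c @[m --> \oo] --> 0.
Proof.
move=> cz; have /andP[c0 cz'] := cz.
have E m : Xi theta n1 n2 (flow_between m) c =
    2 / (theta ^+ 2 * (n1 - n2)) * c `^ n1 * upper_integral n1 (flow_between m) c.
  rewrite /Xi lower_integral_restrict0 ?mulr0 ?add0r ?mulrA//.
  by move=> nu /=; rewrite !in_itv/= andbT => /andP[].
under eq_fun do rewrite E.
rewrite -(mulr0 (2 / (theta ^+ 2 * (n1 - n2)) * c `^ n1)).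
have H : upper_integral n1 (flow_between m) c @[m --> \oo] --> 0.
  have Ic : mu.-integrable `]c, +oo[ (fun nu => (nu `^ (- n1 - 1) * flow_above nu)%:E).
    by have [_] := Xi_converges_flow_above c0.
  have [| | | | |_ _ h] := @dominated_convergence _ _ _ mu `]c, +oo[%classic
    (measurable_itv _)
    (fun m nu => (nu `^ (- n1 - 1) * flow_between m nu)%:E)
    (fun nu => (nu `^ (- n1 - 1) * flow_above nu)%:E)
    (fun nu => `|nu `^ (- n1 - 1) * flow_above nu|%:E).
  - move=> m; apply/measurable_EFinP/measurable_funTS.
    by apply: measurable_powRM; exact: measurable_flow_between.
  - apply/measurable_EFinP/measurable_funTS.
    by apply: measurable_powRM; exact: measurable_flow_above.
  - apply: aeW => nu _; apply: cvg_near_cst.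
    by apply: filterS (flow_between_near nu) => m ->.
  - exact: (integrable_norm Ic).
  - by apply: aeW => nu m _; rewrite lee_fin !normrM ler_wpM2l// normr_flow_between.
  rewrite -Uz -(upper_integral_above_le cz); apply: fine_cvg.
  by rewrite fineK//; apply: integrable_fin_num.
exact: (cvgM (cvg_cst _) H).
Qed.

End truncation.

(** * Value and optimality of the hitting rule *)

Section stopping.
Context {R : realType} {d : measure_display} {Omega : measurableType d}.
Variables (P : probability Omega R) (B : R -> Omega -> R).
Hypothesis BM : standard_brownian_motion P B.
Notation mu := (@lebesgue_measure R).
Variables (r rho theta n1 n2 y : R).
Hypothesis theta0 : theta != 0.
Hypotheses (n1_gt0 : 0 < n1) (n2_lt0 : n2 < 0).
Hypothesis n1_root :
  theta ^+ 2 / 2 * n1 ^+ 2 + (rho - r - theta ^+ 2 / 2) * n1 - rho = 0.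
Hypothesis n2_root :
  theta ^+ 2 / 2 * n2 ^+ 2 + (rho - r - theta ^+ 2 / 2) * n2 - rho = 0.
Hypothesis y0 : 0 < y.

Local Notation Y := (dual_process B r rho theta y).
Local Notation flow := (discounted_flow B r rho theta y).
Local Notation M := (P \x mu)%E.
Local Notation OR := (Omega * measurableTypeR R)%type.
Local Notation D0 := (([set: Omega] `*` `]0, +oo[%classic) : set OR).

Variables (f : R -> R) (z : R).
Hypotheses (mf : measurable_fun setT f) (cf : Xi_converges n1 n2 f) (z0 : 0 < z).
Hypothesis rho_ge0 : 0 <= rho.
Hypothesis Uz : upper_integral n1 f z = 0.

Local Notation tau := (hitting_time B r rho theta z y).
Local Notation g := (flow_above f z).
Local Notation gm := (flow_between f z).

Let stau : stopping_time P B tau.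
Proof. exact: (hitting_time_stopping BM r rho theta y0 z). Qed.

(** The region [before] contains the hitting time itself, at which the strict inequality may fail;
    the weak one follows by approaching [t] from the left. *)
Lemma before_hitting_ge (w : Omega) (t : R) : before tau (w, t) -> z <= Y t w.
Proof.
move=> [/= [_]]; rewrite in_itv/= andbT => t0 /negP; rewrite -leNgt => tt.
pose u (n : nat) := t * (1 - n.+1%:R^-1).
have u0 n : 0 <= u n.
  by rewrite mulr_ge0 ?(ltW t0)// subr_ge0 invf_le1// ler1n.
have ut : u n @[n --> \oo] --> t.
  rewrite (_ : nbhs t = nbhs (t * (1 - 0))); last by rewrite subr0 mulr1.
  apply: cvgM; first exact: cvg_cst.
  by apply: cvgB; [exact: cvg_cst|exact: cvg_harmonic].
apply: (cvgr_to_ge (cvg_dual_process BM y0 (w := w) u0 (ltW t0) ut)).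
apply: nearW => n; apply: ltW; apply: (hitting_time_gt (u0 n)).
by apply: lt_le_trans tt; rewrite lte_fin /u gtr_pMr// ltrBlDr ltrDl invr_gt0.
Qed.

(** The bound by [|Xi(min y z)|] is passed to the limit in the cut-off: its left side is dominated
    by [|flow g|], and its right side tends to 0 since [min y z <= z]. *)
Lemma integral_after_hitting_eq0 : (\int[M]_(x in after tau) (flow g x)%:E = 0)%E.
Proof.
have mg := measurable_flow_above z mf; have cg : Xi_converges n1 n2 g by exact: Xi_converges_flow_above.
have ig : M.-integrable (after tau) (EFin \o flow g).
  apply: integrableS (integrable_discounted_flow BM theta0 n1_gt0 n2_lt0 n1_root
    n2_root y0 mg cg); first exact: measurableX.
    exact: (measurable_after BM stau).
  exact: (after_sub stau).
have mgm m := measurable_flow_between z mf m.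
have cgm m : Xi_converges n1 n2 (gm m) by exact: Xi_converges_flow_between.
have c0 : 0 < Num.min y z by rewrite lt_min y0 z0.
(* [Xi g] need not be bounded, hence the truncation of [g] to [z, m]. *)
have lim1 : (\int[M]_(x in after tau) (flow (gm m) x)%:E @[m --> \oo] -->
    \int[M]_(x in after tau) (flow g x)%:E)%E.
  have [| | | | |_ _ h] := @dominated_convergence _ _ _ M (after tau)
    (measurable_after BM stau) (fun m => EFin \o flow (gm m)) (EFin \o flow g)
    (abse \o (EFin \o flow g)); last exact: h.
  - move=> m; apply/measurable_EFinP/measurable_funTS.
    exact: (measurable_discounted_flow BM r rho theta y0 (mgm m)).
  - exact: measurable_int ig.
  - apply: aeW => x _; apply: cvg_near_cst.
    apply: filterS (flow_between_near f z (Y (Num.max 0 x.2) x.1)).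
    by move=> m E; congr (_ * _)%:E; exact: E.
  - exact: integrable_abse.
  - apply: aeW => x m _; rewrite /= lee_fin /discounted_flow !normrM ler_wpM2l//.
    exact: normr_flow_between.
have lim2 : (`|\int[M]_(x in after tau) (flow (gm m) x)%:E| @[m --> \oo] --> 0)%E.
  apply: (@squeeze_cvge _ _ _ _ (fun=> 0%E) _
    (fun m => `|Xi theta n1 n2 (gm m) (Num.min y z)|%:E)).
  - apply: nearW => m; rewrite abse_ge0/=.
    have [C hC] := Xi_between_bounded theta n1_gt0 n2_lt0 mf cf z0 m.
    apply: (integral_after_hitting_le BM theta0 n1_gt0 n2_lt0 n1_root n2_root y0
      rho_ge0 (mgm m) (cgm m) hC).
    exact: Xi_continuous.
  - exact: cvg_cst.
  - apply: cvg_EFin; first exact: nearW.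
    rewrite -[X in _ --> X](normr0 R); apply: cvg_norm.
    apply: Xi_between_cvg => //.
    by rewrite c0 ge_min lexx orbT.
have : (`|\int[M]_(x in after tau) (flow g x)%:E| = 0)%E.
  exact: (cvg_unique _ (cvg_abse lim1) lim2).
by move/eqP; rewrite abse_eq0 => /eqP.
Qed.

Lemma stopped_value_hitting :
  stopped_value P B r rho theta f y tau = (Xi theta n1 n2 g y)%:E.
Proof.
have mg := measurable_flow_above z mf; have cg : Xi_converges n1 n2 g by exact: Xi_converges_flow_above.
rewrite (stopped_valueE BM theta0 n1_gt0 n2_lt0 n1_root n2_root y0 stau mf cf).
rewrite -(integral_before_after BM theta0 n1_gt0 n2_lt0 n1_root n2_root y0 stau
  mg cg) integral_after_hitting_eq0 adde0.
apply: eq_integral => -[w t]; rewrite inE => wt.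
have zY := before_hitting_ge wt; case: wt => -[_ /=]; rewrite in_itv/= andbT => t0 _.
congr EFin; rewrite /discounted_flow/= max_r ?ltW//.
by rewrite /flow_above patchE mem_set//= in_itv/= andbT.
Qed.

Lemma optimal_value_hitting :
  (forall x, 0 < x <= z -> f x <= 0) ->
  (forall x, z <= x ->
    0 <= homogeneous_coef theta n1 n2 f z * x `^ n2 + Xi theta n1 n2 f x) ->
  optimal_value P B r rho theta f y = (Xi theta n1 n2 g y)%:E.
Proof.
move=> f0 v0.
have mg := measurable_flow_above z mf; have cg : Xi_converges n1 n2 g by exact: Xi_converges_flow_above.
apply/le_anti/andP; split; last first.
  by apply: ereal_sup_ubound; exists tau => //; exact: stopped_value_hitting.
apply: ge_ereal_sup => _ [s ss <-].
apply: (stopped_value_le BM theta0 n1_gt0 n2_lt0 n1_root n2_root y0 ss mf cf mg cg).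
- move=> x x0; rewrite /flow_above patchE; case: ifPn => //.
  rewrite notin_setE/= in_itv/= andbT => /negP; rewrite -ltNge => xz.
  by rewrite f0// x0 ltW.
- move=> x x0; have [xz|zx] := leP x z; first by rewrite Xi_above_le ?x0.
  by rewrite Xi_above_ge// ?v0// ltW.
Qed.

End stopping.

(** * Conjugate utility *)

Section utility_theory.
Context {R : realType}.
Notation mu := (@lebesgue_measure R).
Variables (n2 : R) (D : set R) (u : R -> R).
Hypothesis hu : utility_class n2 D u.
Local Notation I := (inverse_marginal u).
Local Notation u' := (derive1 u).

Lemma utility_domain_pos (c : R) : 0 < c -> D c.
Proof.
by move=> c0; case: (utility_domain hu) => ->; rewrite /= in_itv/= andbT// ltW.
Qed.

Let weak_tangent (a b : R) : 0 < a -> 0 < b -> u b <= u a + u' a * (b - a).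
Proof.
move=> a0 b0; have [->|ab] := eqVneq b a; first by rewrite subrr mulr0 addr0.
have du := utility_derivable hu a0.
have diffu : differentiable u a by apply/derivable1_diffP.
have dv : derivable u a (b - a) by exact: diff_derivable.
have E : 'D_(b - a) u a = u' a * (b - a).
  rewrite deriveE// derive1E' //.
  by rewrite -[X in 'd u a X]mulr1 [_ * 1]/((b - a) *: (1 : R^o)) linearZ/= mulrC.
have lim0 : (fun t : R => t^-1 *: (u (t *: (b - a) + a) - u a)) t @[t --> 0^'+]
    --> u' a * (b - a).
  rewrite -E; apply: cvg_dnbhs_at_right; exact: dv.
rewrite -lerBlDl; apply: (cvgr_to_ge lim0).
near=> t.
have t0 : 0 < t by near: t; exact: nbhs_right_gt.
have t1 : t < 1 by near: t; apply: nbhs_right_lt.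
have tt : 0 < t < 1 by rewrite t0.
have := utility_concave hu (utility_domain_pos b0) (utility_domain_pos a0) ab tt.
have -> : t * b + (1 - t) * a = t *: (b - a) + a.
  by rewrite /GRing.scale/=; ring.
move=> h; rewrite /GRing.scale/= mulrC ler_pdivlMr//.
by move: h; rewrite /GRing.scale/=; lra.
Unshelve. all: by end_near. Qed.

(** Strictness is lost in the limit defining the derivative. It is recovered by using the weak
    inequality at the midpoint of [a] and [b], where strict concavity puts [u] above the chord. *)
Lemma utility_lt_tangent (a b : R) : 0 < a -> 0 < b -> a != b ->
  u b < u a + u' a * (b - a).
Proof.
move=> a0 b0 ab.
have m0 : 0 < 2^-1 * a + (1 - 2^-1) * b by lra.
have half : 0 < (2^-1 : R) < 1 by lra.
have := utility_concave hu (utility_domain_pos a0) (utility_domain_pos b0) ab half.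
have := weak_tangent a0 m0.
have -> : u' a * (2^-1 * a + (1 - 2^-1) * b - a) = 2^-1 * (u' a * (b - a)) by field.
lra.
Qed.

Lemma marginal_lt (a b : R) : 0 < a -> a < b -> u' b < u' a.
Proof.
move=> a0 ab; have b0 := lt_trans a0 ab.
have h1 := utility_lt_tangent a0 b0 (negbT (lt_eqF ab)).
have h2 := utility_lt_tangent b0 a0 (negbT (gt_eqF ab)).
have : 0 < (u' a - u' b) * (b - a) by lra.
by rewrite pmulr_lgt0 ?subr_gt0.
Qed.

(** The marginal utility is decreasing, so its limit at 0 is a supremum. In this form
    [y < marginal0 u] yields a point with marginal utility above [y], one end for the intermediate
    value theorem. *)
Lemma marginal0E : marginal0 u = ereal_sup ((EFin \o u') @` `]0, +oo[).
Proof.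
apply/cvg_lim => //; apply: nonincreasing_at_right_cvge => //.
move=> a b; rewrite !in_itv/= !andbT => a0 b0; rewrite le_eqVlt => /predU1P[->//|ab].
by rewrite lee_fin ltW// marginal_lt.
Qed.

Lemma inverse_marginal_ge0 (y : R) : 0 <= I y.
Proof.
rewrite /inverse_marginal; case: ifP => // _.
by case: xgetP => // c _ [/ltW].
Qed.

(** Below [marginal0 u] a preimage exists by the intermediate value theorem, as the marginal utility
    is continuous and tends to 0 at infinity; the choice in [inverse_marginal] is then not the
    default one. *)
Lemma inverse_marginalP (y : R) : 0 < y ->
  (0 < I y /\ u' (I y) = y) \/ (I y = 0 /\ forall c, 0 < c -> u' c < y).
Proof.
move=> y0; rewrite /inverse_marginal y0/= marginal0E; case: ifPn => [ys|].
  left; suff [c hc] : exists c, [set c | 0 < c /\ u' c = y] c.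
    by case: xgetP => [x _//|/(_ c)].
  have [x [a /= + <-] ya] := ereal_sup_gt ys.
  rewrite in_itv/= andbT => a0; rewrite /= lte_fin in ya.
  have [b [ab b_lt]] : exists b, a < b /\ u' b < y.
    near +oo_R => b; exists b; split.
      by near: b; apply: nbhs_pinfty_gt; rewrite num_real.
    by near: b; have := utility_marginal_pinfty hu; move/cvgr_lt; apply.
  have [|||c cab uc] := @IVT _ u' a b y.
  - exact: ltW.
  - apply: continuous_in_subspaceT => c; rewrite inE/= in_itv/= => /andP[ac _].
    by apply: (utility_C1 hu); exact: lt_le_trans ac.
  - by rewrite ge_min le_max (ltW ya) (ltW b_lt) orbT.
  - exists c; split => //.
    by move: cab; rewrite in_itv/= => /andP[+ _]; exact: lt_le_trans.
rewrite -leNgt => ys; right; split => // c c0.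
(* The supremum gives only a weak bound; comparing with the larger marginal utility at [c / 2] makes
   it strict. *)
have c20 : 0 < c / 2 by rewrite divr_gt0.
apply: (@lt_le_trans _ _ (u' (c / 2))).
  by apply: marginal_lt => //; rewrite ltr_pdivrMr// ltr_pMr// ltr1n.
rewrite -lee_fin (le_trans _ ys)//; apply: ereal_sup_ubound.
by exists (c / 2) => //=; rewrite in_itv/= c20.
Unshelve. all: by end_near. Qed.

Lemma marginal_lt_inverse (y c : R) : 0 < y -> I y < c -> u' c < y.
Proof.
move=> y0 Ic; have c0 := le_lt_trans (inverse_marginal_ge0 y) Ic.
have [[I0 E]|[_]] := inverse_marginalP y0; last exact.
by rewrite -[ltRHS]E; exact: marginal_lt.
Qed.

Lemma marginal_gt_inverse (y c : R) : 0 < y -> 0 < c -> c < I y -> y < u' c.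
Proof.
move=> y0 c0 cI; have [[I0 E]|[I0]] := inverse_marginalP y0.
  by rewrite -[ltLHS]E; exact: marginal_lt.
by move: (lt_trans c0 cI); rewrite I0 ltxx.
Qed.

(** An order argument that also covers the junction at [marginal0 u]: once [x] exceeds the marginal
    utility at [I y + e], the value [I x] stays below [I y + e], and symmetrically from below. *)
Lemma inverse_marginal_continuous (y : R) : 0 < y -> {for y, continuous I}.
Proof.
move=> y0; apply/(@cvgrPdist_lt _ _ _ _ _ I) => e e0.
have above : \forall x \near y, I x < I y + e.
  have c0 : I y < I y + e by rewrite ltrDl.
  have c00 := le_lt_trans (inverse_marginal_ge0 y) c0.
  have uy := marginal_lt_inverse y0 c0.
  near=> x.
  have x0 : 0 < x by near: x; exact: lt_nbhsr.
  have ux : u' (I y + e) < x by near: x; exact: lt_nbhsr.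
  rewrite ltNge le_eqVlt; apply/negP => /orP[/eqP h|h].
    have [[_ E]|[Ix _]] := inverse_marginalP x0.
      by move: ux; rewrite h E ltxx.
    by move: c00; rewrite h Ix ltxx.
  by move: (marginal_gt_inverse x0 c00 h) => /(lt_trans ux); rewrite ltxx.
have below : \forall x \near y, I y - e < I x.
  have [I0|I0] := leP (I y) 0.
    near=> x; apply: (@lt_le_trans _ _ 0); last exact: inverse_marginal_ge0.
    by rewrite subr_lt0 (le_lt_trans I0).
  (* The second term keeps [c] positive when [e] is larger than [I y]. *)
  pose c := Num.max (I y - e) (I y / 2).
  have c0 : 0 < c by rewrite lt_max divr_gt0// orbT.
  have cI : c < I y by rewrite gt_max ltrBlDr ltrDl e0 ltr_pdivrMr// ltr_pMr// ltr1n.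
  have uy := marginal_gt_inverse y0 c0 cI.
  near=> x.
  have x0 : 0 < x by near: x; exact: lt_nbhsr.
  have ux : x < u' c by near: x; exact: lt_nbhsl.
  apply: (@le_lt_trans _ _ c); first by rewrite le_max lexx.
  rewrite ltNge le_eqVlt; apply/negP => /orP[/eqP h|h].
    have [[_ E]|[_ /(_ c c0)]] := inverse_marginalP x0; last first.
      by move/(lt_trans ux); rewrite ltxx.
    by move: ux; rewrite -h E ltxx.
  by move: (marginal_lt_inverse x0 h) => /(lt_trans ux); rewrite ltxx.
near=> x; rewrite ltr_distlC; apply/andP; split.
  by near: x; exact: below.
by near: x; exact: above.
Unshelve. all: by end_near. Qed.

End utility_theory.

Section conjugate_theory.
Context {R : realType}.
Notation mu := (@lebesgue_measure R).
Variables (n2 : R) (D : set R) (u : R -> R).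
Hypothesis hu : utility_class n2 D u.
Local Notation I := (inverse_marginal u).
Local Notation u' := (derive1 u).

Lemma utility_value0E : utility_value u 0 = ereal_inf ((EFin \o u) @` `]0, +oo[).
Proof.
rewrite /utility_value ltxx.
apply/cvg_lim => //; apply: nondecreasing_at_right_cvge => //.
move=> a b; rewrite !in_itv/= !andbT => a0 b0; rewrite le_eqVlt => /predU1P[->//|ab].
by rewrite lee_fin ltW// (utility_incr hu)//; exact: (utility_domain_pos hu).
Qed.

(** A real-valued version, so that derivatives can be computed; [utility_value_inverse] shows that
    no infinite value is lost. *)
Definition utility_at_inverse (y : R) : R := fine (utility_value u (I y)).
Local Notation k := utility_at_inverse.

(** When [I y = 0] all slopes are at most [y]. For [x < c] the tangent at [x] gives the bound, and
    for [x >= c] monotonicity does. Being uniform in [x], it survives the limit at 0. *)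
Let utility_lower (y c x : R) : 0 < y -> I y = 0 -> 0 < c -> 0 < x ->
  u c - y * c <= u x.
Proof.
move=> y0 I0 c0 x0; have [xc|cx] := ltP x c.
  have := utility_lt_tangent hu x0 c0 (negbT (lt_eqF xc)).
  have uy : u' x <= y by apply/ltW/(marginal_lt_inverse hu y0); rewrite I0.
  have yx : 0 < y * x by rewrite mulr_gt0.
  have : u' x * (c - x) <= y * (c - x) by rewrite ler_wpM2r// subr_ge0 ltW.
  by rewrite (mulrBr y); lra.
rewrite lerBlDr; apply: (@le_trans _ _ (u x)); last first.
  by rewrite lerDl mulr_ge0// ltW.
move: cx; rewrite le_eqVlt => /predU1P[->//|cx].
by rewrite ltW// (utility_incr hu)//; exact: (utility_domain_pos hu).
Qed.

(** The only risk is [u(0) = -oo], met when [I y = 0]; there [utility_lower] bounds [u] from below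
    near 0. *)
Lemma utility_value_inverse (y : R) : 0 < y -> utility_value u (I y) = (k y)%:E.
Proof.
move=> y0; rewrite /k fineK//.
have [[I0 _]|[I0 _]] := inverse_marginalP hu y0; first by rewrite /utility_value I0.
rewrite I0 utility_value0E fin_numElt; apply/andP; split.
  apply: (@lt_le_trans _ _ (u 1 - y * 1)%:E); first exact: ltNyr.
  apply: le_ereal_inf_tmp => _ [x /= + <-]; rewrite in_itv/= andbT => x0.
  by rewrite lee_fin utility_lower.
apply: (@le_lt_trans _ _ (u 1)%:E); last exact: ltry.
by apply: ereal_inf_lbound; exists 1 => //=; rewrite in_itv/= ltr01.
Qed.

Let utility_le (y c : R) : 0 < y -> 0 < c -> u c - y * c <= k y - y * I y.
Proof.
move=> y0 c0; have E := utility_value_inverse y0.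
have [[I0 uI]|[I0 _]] := inverse_marginalP hu y0.
  move: E; rewrite /utility_value I0 => -[<-].
  have [->//|Ic] := eqVneq (I y) c.
  have := utility_lt_tangent hu I0 c0 Ic; rewrite uI.
  by lra.
rewrite I0 mulr0 subr0 -lee_fin -E I0 utility_value0E.
apply: le_ereal_inf_tmp => _ [x /= + <-]; rewrite in_itv/= andbT => x0.
by rewrite lee_fin utility_lower.
Qed.

Lemma utility_value_le (y c : R) : 0 < y -> 0 <= c ->
  (utility_value u c - (y * c)%:E <= (k y - y * I y)%:E)%E.
Proof.
move=> y0; rewrite le_eqVlt => /predU1P[<-|c0]; last first.
  by rewrite /utility_value c0 -EFinB lee_fin utility_le.
rewrite mulr0 sube0 utility_value0E; apply/lee_addgt0Pr => e e0.
(* At consumption [e / y] the linear cost is exactly [e], so the value at 0 is bounded up to [e]. *)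
have ey : 0 < e / y by rewrite divr_gt0.
apply: (@le_trans _ _ (u (e / y))%:E).
  by apply: ereal_inf_lbound; exists (e / y) => //=; rewrite in_itv/= ey.
rewrite -EFinD lee_fin; have := utility_le y0 ey.
by rewrite (mulrC y (e / y)) divfK ?gt_eqF//; lra.
Qed.

Lemma conjugateE (y : R) : 0 < y -> conjugate u y = k y - y * I y.
Proof.
move=> y0; rewrite /conjugate (_ : ereal_sup _ = (k y - y * I y)%:E)//.
apply/le_anti/andP; split.
  apply: ge_ereal_sup => _ [c /= + <-]; rewrite in_itv/= andbT => c0.
  exact: utility_value_le.
apply: ereal_sup_ubound; exists (I y); first by rewrite /= in_itv/= inverse_marginal_ge0.
by rewrite utility_value_inverse// EFinB.
Qed.

(** The maximizer [I y] at [y] is a competitor in the supremum defining the conjugate at [x]. *)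
Lemma conjugate_subgradient (y x : R) : 0 < y -> 0 < x ->
  conjugate u y - I y * (x - y) <= conjugate u x.
Proof.
move=> y0 x0; rewrite !conjugateE//.
have := utility_value_le x0 (inverse_marginal_ge0 u y).
rewrite utility_value_inverse// -EFinB lee_fin.
by rewrite (mulrBr (I y)) (mulrC (I y)) (mulrC (I y)); lra.
Qed.

Lemma conjugate_ge (y : R) : 0 < y -> u 1 - y <= conjugate u y.
Proof. by move=> y0; rewrite conjugateE// -[X in _ - X]mulr1 utility_le. Qed.

Lemma conjugate_nincr (y x : R) : 0 < y -> y <= x -> conjugate u x <= conjugate u y.
Proof.
move=> y0 yx; have x0 := lt_le_trans y0 yx.
apply: le_trans (conjugate_subgradient x0 y0).
by rewrite lerBrDl gerDr mulr_ge0_le0 ?inverse_marginal_ge0// subr_le0.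
Qed.

(** The subgradient inequalities at [y] and at [y + h] squeeze the difference quotient between
    [-I y] and [-I (y + h)]; continuity of [I] closes the gap. *)
Lemma is_derive_conjugate (y : R) : 0 < y ->
  is_derive y (1 : R) (conjugate u) (- I y).
Proof.
move=> y0.
have lim0 : h^-1 *: (conjugate u (h *: (1 : R) + y) - conjugate u y) @[h --> 0^']
    --> - I y.
  apply/cvgrPdist_lt => e e0.
  have := inverse_marginal_continuous hu y0; move=> /(@cvgrPdist_lt _ _ _ _ _ I).
  move=> /(_ e e0)/nbhs_ballP[r /= r0 hr].
  near=> h.
  have h0 : h != 0 by near: h; exact: nbhs_dnbhs_neq.
  have hr' : `|h| < r by near: h; exact: dnbhs0_lt.
  have hy : `|h| < y by near: h; exact: dnbhs0_lt.
  have -> : h *: (1 : R) + y = y + h by rewrite [_ *: _]mulr1 addrC.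
  have x0 : 0 < y + h by move: hy; rewrite ltr_norml => /andP[+ _]; lra.
  have := hr (y + h); rewrite /ball/= opprD addrA subrr add0r normrN => /(_ hr').
  apply: le_lt_trans.
  have s1 := conjugate_subgradient y0 x0; have s2 := conjugate_subgradient x0 y0.
  have -> : - I y - h^-1 *: (conjugate u (y + h) - conjugate u y) =
     - ((conjugate u (y + h) - conjugate u y + I y * h) / h).
    by rewrite /GRing.scale/=; field.
  rewrite normrN normrM normfV ler_pdivrMr ?normr_gt0// -normrM.
  have b1 : 0 <= conjugate u (y + h) - conjugate u y + I y * h.
    by move: s1; rewrite (addrC y h) addrK; lra.
  have b2 : conjugate u (y + h) - conjugate u y + I y * h <= (I y - I (y + h)) * h.
    by move: s2; rewrite opprD addrA subrr add0r; lra.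
  by rewrite ger0_norm// (le_trans b2)// ler_norm.
have dc : derivable (conjugate u) y 1 by apply/cvg_ex; eexists; exact: lim0.
by apply: DeriveDef => //; apply/cvg_lim.
Unshelve. all: by end_near. Qed.

Lemma conjugate_continuous (y : R) : 0 < y -> {for y, continuous (conjugate u)}.
Proof.
move=> y0; apply: differentiable_continuous; apply/derivable1_diffP.
by have [] := is_derive_conjugate y0.
Qed.

End conjugate_theory.

(** * Improper integrals on the positive half-line *)

Section improper.
Context {R : realType}.
Notation mu := (@lebesgue_measure R).

Lemma integrable_bigcup_bounded (S : nat -> set R) (G : R -> R) (C : R) :
  (forall n, measurable (S n)) -> nondecreasing_seq S ->
  measurable_fun (\bigcup_n S n) G -> (forall x, (\bigcup_n S n) x -> 0 <= G x) ->
  (forall n, \int[mu]_(x in S n) (G x)%:E <= C%:E)%E ->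
  mu.-integrable (\bigcup_n S n) (EFin \o G).
Proof.
move=> mS ndS mG G0 GC.
have mU : measurable (\bigcup_n S n) by exact: bigcup_measurable.
apply/integrableP; split; first exact/measurable_EFinP.
rewrite (@eq_integral _ _ _ mu _ (EFin \o G)); last first.
  by move=> x; rewrite inE => /G0 Gx; rewrite /= ger0_norm.
apply: (@le_lt_trans _ _ C%:E); last exact: ltry.
have mSG n : measurable_fun (S n) (EFin \o G).
  by apply/measurable_EFinP; apply: measurable_funS mG => //; exact: bigcup_sup.
have SG0 n x : S n x -> (0 <= (EFin \o G) x)%E.
  by move=> Sx; rewrite lee_fin G0//; exists n.
have c := @ge0_nondecreasing_set_cvg_integral _ (measurableTypeR R) R
  S (EFin \o G) mu ndS mS mSG SG0.
apply: (cvge_le _ c); apply: nearW; exact: GC.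
Qed.

Variables (F f : R -> R).
Hypothesis dF : forall x : R, 0 < x -> is_derive x (1 : R) F (f x).
Hypothesis cf : forall x : R, 0 < x -> {for x, continuous f}.

Lemma continuous_pos_within (g : R -> R) (a b : R) : 0 < a ->
  (forall x : R, 0 < x -> {for x, continuous g}) -> {within `[a, b], continuous g}.
Proof.
move=> a0 cg; apply: continuous_in_subspaceT => c; rewrite inE/= in_itv/=.
by move=> /andP[ac _]; apply: cg; exact: lt_le_trans ac.
Qed.

Lemma integral_pos_FTC (a b : R) : 0 < a -> a < b ->
  (\int[mu]_(x in `[a, b]) (f x)%:E = (F b - F a)%:E)%E.
Proof.
move=> a0 ab; rewrite EFinB; apply: continuous_FTC2 => //.
- exact: continuous_pos_within.
- have cF x : 0 < x -> {for x, continuous F}.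
    move=> x0; apply: differentiable_continuous; apply/derivable1_diffP.
    by have [] := dF x0.
  split.
  + move=> x; rewrite in_itv/= => /andP[ax _].
    by have [] := dF (lt_trans a0 ax).
  + by apply: cvg_at_right_filter; exact: cF.
  + by apply: cvg_at_left_filter; apply: cF; exact: lt_trans ab.
- move=> x; rewrite in_itv/= => /andP[ax _].
  by rewrite derive1E; have [] := dF (lt_trans a0 ax).
Qed.

End improper.

Section improper_powR.
Context {R : realType}.
Notation mu := (@lebesgue_measure R).

Lemma continuous_pos_measurable (g : R -> R) :
  (forall x : R, 0 < x -> {for x, continuous g}) ->
  measurable_fun (`]0, +oo[%classic : set R) g.
Proof.
move=> cg; apply: open_continuous_measurable_fun => // x.
by rewrite inE/= in_itv/= andbT; exact: cg.
Qed.

Lemma integrable_near0_bounded (G : R -> R) (y C : R) : 0 < y ->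
  (forall x : R, 0 < x -> {for x, continuous G}) ->
  (forall x, 0 < x <= y -> 0 <= G x) ->
  (forall a : R, (0 < a < y)%R -> \int[mu]_(x in `[a, y]) (G x)%:E <= C%:E)%E ->
  mu.-integrable `]0, y[ (EFin \o G).
Proof.
move=> y0 cG G0 GC; pose S (n : nat) := `[y / n.+2%:R, y]%classic.
have US : `]0, y]%classic `<=` \bigcup_n S n.
  move=> x /=; rewrite in_itv/= => /andP[x0 xy].
  exists (Num.truncn (y / x)) => //; rewrite /S/= in_itv/= xy andbT.
  rewrite ler_pdivrMr// mulrC -ler_pdivrMr//.
  by rewrite (le_trans (ltW (truncnS_gt _)))// ler_nat.
have SU : \bigcup_n S n `<=` `]0, y]%classic.
  move=> x [n _]; rewrite /S/= !in_itv/= => /andP[h ->]; rewrite andbT.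
  by apply: lt_le_trans h; rewrite divr_gt0.
have I : mu.-integrable (\bigcup_n S n) (EFin \o G).
  apply: (@integrable_bigcup_bounded _ _ _ C).
  - by move=> n; exact: measurable_itv.
  - move=> m n mn; rewrite subsetEset; apply: subset_itvr; rewrite bnd_simp.
    by rewrite ler_pM2l// lef_pV2 ?posrE// ler_nat.
  - apply: measurable_funS (continuous_pos_measurable cG) => //.
    by move=> x /SU/=; rewrite !in_itv/= => /andP[->].
  - by move=> x /SU/=; rewrite in_itv/=; exact: G0.
  - move=> n; apply: GC; rewrite divr_gt0//=.
    by rewrite ltr_pdivrMr// ltr_pMr// ltr1n.
apply: integrableS I => //.
  by apply: bigcup_measurable => n _; exact: measurable_itv.
by apply: (subset_trans _ US); apply: subset_itvl; rewrite bnd_simp.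
Qed.

Lemma integrable_infty_bounded (G : R -> R) (a C : R) : 0 < a ->
  (forall x : R, 0 < x -> {for x, continuous G}) ->
  (forall x, a <= x -> 0 <= G x) ->
  (forall b : R, (a < b)%R -> \int[mu]_(x in `[a, b]) (G x)%:E <= C%:E)%E ->
  mu.-integrable `]a, +oo[ (EFin \o G).
Proof.
move=> a0 cG G0 GC; pose S (n : nat) := `[a, a + n.+1%:R]%classic.
have US : `]a, +oo[%classic `<=` \bigcup_n S n.
  move=> x /=; rewrite in_itv/= andbT => ax.
  exists (Num.truncn x) => //; rewrite /S/= in_itv/= (ltW ax)/=.
  by rewrite (le_trans (ltW (truncnS_gt _)))// lerDr ltW.
have SU : \bigcup_n S n `<=` `[a, +oo[%classic.
  by move=> x [n _]; rewrite /S/= !in_itv/= andbT => /andP[].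
have I : mu.-integrable (\bigcup_n S n) (EFin \o G).
  apply: (@integrable_bigcup_bounded _ _ _ C).
  - by move=> n; exact: measurable_itv.
  - move=> m n mn; rewrite subsetEset; apply: subset_itvl; rewrite bnd_simp.
    by rewrite lerD2l ler_nat.
  - apply: measurable_funS (continuous_pos_measurable cG) => //.
    by move=> x /SU/=; rewrite !in_itv/= !andbT; exact: lt_le_trans.
  - by move=> x /SU/=; rewrite in_itv/= andbT; exact: G0.
  - by move=> n; apply: GC; rewrite ltrDl.
apply: integrableS I => //.
by apply: bigcup_measurable => n _; exact: measurable_itv.
Qed.

Lemma integral_powR (p a b : R) : p != 0 -> 0 < a -> a < b ->
  (\int[mu]_(x in `[a, b]) (x `^ (p - 1))%:E = (b `^ p / p - a `^ p / p)%:E)%E.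
Proof.
move=> p0 a0 ab; apply: (@integral_pos_FTC _ (fun x => x `^ p / p)) => //.
  move=> x x0; have -> : x `^ (p - 1) = p^-1 *: (p * x `^ (p - 1)).
    by rewrite [_ *: _]mulrA mulVf// mul1r.
  rewrite (_ : (fun t => t `^ p / p) = p^-1 \*: (fun t : R => t `^ p : R^o)).
    by apply: is_deriveZ; exact: is_derive1_powR.
  by apply/funext => t /=; rewrite mulrC.
by move=> x x0; exact: powR_continuous.
Qed.

Lemma integrable_powR_near0 (p y : R) : 0 < p -> 0 < y ->
  mu.-integrable `]0, y[ (EFin \o (fun x => x `^ (p - 1))).
Proof.
move=> p0 y0; apply: (@integrable_near0_bounded _ _ (y `^ p / p)) => //.
- by move=> x x0; exact: powR_continuous.
- by move=> x _; exact: powR_ge0.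
- move=> a /andP[a0 ay]; rewrite integral_powR ?gt_eqF// lee_fin gerBl.
  by rewrite divr_ge0 ?powR_ge0// ltW.
Qed.

Lemma integrable_powR_infty (p a : R) : p < 0 -> 0 < a ->
  mu.-integrable `]a, +oo[ (EFin \o (fun x => x `^ (p - 1))).
Proof.
move=> p0 a0; apply: (@integrable_infty_bounded _ _ (- (a `^ p / p))) => //.
- by move=> x x0; exact: powR_continuous.
- by move=> x _; exact: powR_ge0.
- move=> b ab; rewrite integral_powR ?lt_eqF// lee_fin gerDr.
  by rewrite mulr_ge0_le0 ?powR_ge0// invr_le0 ltW.
Qed.

End improper_powR.

(** * Convergence of the integrals defining Xi for a conjugate utility *)

Section conjugate_convergence.
Context {R : realType}.
Notation mu := (@lebesgue_measure R).
Variables (n1 n2 : R) (D : set R) (u : R -> R).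
Hypotheses (n1_gt1 : 1 < n1) (n2_lt0 : n2 < 0) (hu : utility_class n2 D u).
Local Notation I := (inverse_marginal u).
Local Notation conj := (conjugate u).

Let q0 : 0 < - n2. Proof. by rewrite oppr_gt0. Qed.

Let H (x : R) : R := x `^ (- n2) * I x.

Let H0 x : 0 <= H x.
Proof. by rewrite mulr_ge0 ?powR_ge0 ?inverse_marginal_ge0. Qed.

Let cH (x : R) : 0 < x -> {for x, continuous H}.
Proof.
move=> x0; apply: continuousM; first exact: powR_continuous.
exact: (inverse_marginal_continuous hu).
Qed.

(** The utility class controls the integral of [x^(-n2) I x], and [I] is minus the derivative of the
    conjugate. Subtracting [conj y] makes the integrand nonnegative on []0, y]], kills the boundary
    term at [y] and gives the one at [a] a favorable sign; the constant is added back since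
    [x^(-n2 - 1)] is integrable at 0. *)
Lemma conjugate_lower_integrable (y : R) : 0 < y ->
  mu.-integrable `]0, y[ (fun x => (x `^ (- n2 - 1) * conj x)%:E).
Proof.
move=> y0; pose G x := x `^ (- n2 - 1) * (conj x - conj y).
have cG (x : R) : 0 < x -> {for x, continuous G}.
  move=> x0; apply: continuousM; first exact: powR_continuous.
  apply: continuousB; first exact: (conjugate_continuous hu).
  exact: cst_continuous.
(* The range extends to [y + 1] so that it contains the closed intervals [[a, y]]. *)
pose C := fine (\int[mu]_(x in `]0%R, (y + 1)%R[) (H x)%:E).
have fC : (\int[mu]_(x in `]0%R, (y + 1)%R[) (H x)%:E)%E = C%:E.
  rewrite fineK// ge0_fin_numE; last by apply: integral_ge0 => x _; rewrite lee_fin.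
  by apply: (utility_integral hu); rewrite addr_gt0.
have IG : mu.-integrable `]0, y[ (EFin \o G).
  apply: (@integrable_near0_bounded _ G y (C / - n2)) => //.
    move=> x /andP[x0 xy]; rewrite mulr_ge0 ?powR_ge0// subr_ge0.
    exact: (conjugate_nincr hu).
  move=> a /andP[a0 ay].
  have cpt (g : R -> R) : (forall x : R, 0 < x -> {for x, continuous g}) ->
      mu.-integrable `[a, y] (EFin \o g).
    move=> cg; apply: continuous_compact_integrable; first exact: segment_compact.
    exact: continuous_pos_within.
  have cHq (x : R) : 0 < x -> {for x, continuous (fun x => H x / - n2)}.
    by move=> x0; apply: continuousM; [exact: cH|exact: cst_continuous].
  have leH : (\int[mu]_(x in `[a, y]) (H x / - n2)%:E <= (C / - n2)%:E)%E.
    rewrite EFinM -fC -ge0_integralZr//; last 3 first.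
    - apply/measurable_EFinP.
      apply: measurable_funS (continuous_pos_measurable cH) => //.
      by move=> x /=; rewrite !in_itv/= andbT => /andP[].
    - by move=> x _; rewrite lee_fin.
    - by rewrite lee_fin invr_ge0 ltW.
    apply: ge0_subset_integral => //.
    - apply/measurable_EFinP.
      apply: measurable_funM => //.
      apply: measurable_funS (continuous_pos_measurable cH) => //.
      by move=> x /=; rewrite !in_itv/= andbT => /andP[].
    - by move=> x _; rewrite lee_fin mulr_ge0// invr_ge0 ltW.
    - move=> x /=; rewrite !in_itv/= => /andP[ax xy].
      by rewrite (lt_le_trans a0 ax)/= (le_lt_trans xy)// ltrDl.
  apply: le_trans leH; rewrite -sube_le0.
  rewrite -integralB_EFin//; [|exact: cpt|exact: cpt].
  (* integration by parts, discarding the boundary term at [a] *)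
  pose F (x : R) : R := (- n2)^-1 *: (x `^ (- n2) * (conj x - conj y)).
  have dF (x : R) : 0 < x -> is_derive x (1 : R) F (G x - H x / - n2).
    move=> x0; have d1 := is_derive_conjugate hu x0.
    have d2 := is_derive1_powR (- n2) x0.
    apply: is_derive_eq; rewrite /G /H /GRing.scale/=.
    by field; rewrite lt_eqF.
  have cGH (x : R) : 0 < x -> {for x, continuous (fun x => G x - H x / - n2)}.
    by move=> x0; apply: continuousB; [exact: cG|exact: cHq].
  have E := integral_pos_FTC dF cGH a0 ay.
  apply: (@le_trans _ _ (F y - F a)%:E); first by rewrite -E.
  rewrite lee_fin /F subrr mulr0 scaler0 sub0r oppr_le0.
  rewrite mulr_ge0 ?invr_ge0 ?(ltW q0)// mulr_ge0 ?powR_ge0// subr_ge0.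
  by apply: (conjugate_nincr hu) => //; exact: ltW.
have := integrableD _ IG (integrableZr _ (conj y) (integrable_powR_near0 q0 y0)).
move=> /(_ (measurable_itv _) (measurable_itv _)).
apply: eq_integrable => // x _ /=.
by rewrite -EFinM -EFinD /G; congr EFin; ring.
Qed.

(** From [u 1 - x <= conj x <= conj y] the conjugate grows at most linearly, and [x > y] absorbs the
    constants into [C * x]; then [x^(-n1)] is integrable at infinity because [n1 > 1]. *)
Lemma conjugate_upper_integrable (y : R) : 0 < y ->
  mu.-integrable `]y, +oo[ (fun x => (x `^ (- n1 - 1) * conj x)%:E).
Proof.
move=> y0; pose C := (`|conj y| + `|u 1|) / y + 1.
have n10 : 1 - n1 < 0 by rewrite subr_lt0.
have := integrableZl _ C (integrable_powR_infty n10 y0).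
move=> /(_ (measurable_itv _)); apply: le_integrable => //.
  apply/measurable_EFinP; apply: measurable_funM.
    by apply: measurable_funTS; exact: measurable_powR.
  apply: measurable_funS (continuous_pos_measurable (conjugate_continuous hu)) => //.
  by move=> x /=; rewrite !in_itv/= !andbT; exact: lt_trans.
move=> x /=; rewrite in_itv/= andbT => yx; have x0 := lt_trans y0 yx.
have C0 : 0 <= C by rewrite addr_ge0// divr_ge0 ?addr_ge0// ltW.
rewrite lee_fin !normrM (ger0_norm C0) !(ger0_norm (powR_ge0 _ _)).
have -> : x `^ (1 - n1 - 1) = x * x `^ (- n1 - 1).
  have -> : 1 - n1 - 1 = 1 + (- n1 - 1) by ring.
  by rewrite powRD ?(gt_eqF x0) ?implybT// powRr1// ltW.
rewrite mulrA mulrC.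
apply: ler_wpM2r; first exact: powR_ge0.
have h1 : `|conj x| <= `|conj y| + `|u 1| + x.
  rewrite ler_norml; apply/andP; split.
    have := conjugate_ge hu x0; have := lerNnormlW (lexx `|u 1|).
    by have := normr_ge0 (conj y); lra.
  have := conjugate_nincr hu y0 (ltW yx); have := ler_norm (conj y).
  by have := normr_ge0 (u 1); lra.
apply: (le_trans h1); rewrite mulrDl mul1r lerD2r.
rewrite -[leLHS]mulr1 -mulrA ler_wpM2l ?addr_ge0//.
by rewrite mulrC ler_pdivlMr// mul1r ltW.
Qed.

Lemma Xi_converges_conjugate : Xi_converges n1 n2 conj.
Proof.
by move=> y y0; split; [exact: conjugate_lower_integrable|exact: conjugate_upper_integrable].
Qed.

End conjugate_convergence.

(** * Rewards with a single sign change *)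

Section single_crossing.
Context {R : realType}.
Notation mu := (@lebesgue_measure R).

Lemma powR_npos_le (p x y : R) : p <= 0 -> 0 < x -> x <= y -> y `^ p <= x `^ p.
Proof.
move=> p0 x0 xy; have y0 := lt_le_trans x0 xy.
rewrite -[p]opprK (powRN x) (powRN y) lef_pV2 ?posrE ?powR_gt0//.
by apply: ge0_ler_powR; rewrite ?nnegrE ?oppr_ge0// ltW.
Qed.

(** The function may vanish at the ends, so a positive minimum is taken on the closed middle third
    only. *)
Lemma Rintegral_itv_gt0 (g : R -> R) (a b : R) : 0 < a -> a < b ->
  (forall x : R, 0 < x -> {for x, continuous g}) ->
  (forall x, a <= x <= b -> 0 <= g x) -> (forall x, a < x < b -> 0 < g x) ->
  0 < \int[mu]_(x in `[a, b]) g x.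
Proof.
move=> a0 ab cg g0 gpos.
pose a' := (2 * a + b) / 3; pose b' := (a + 2 * b) / 3.
have aa' : a < a' by rewrite /a'; lra.
have a'b' : a' < b' by rewrite /a' /b'; lra.
have b'b : b' < b by rewrite /b'; lra.
have Ig : mu.-integrable `[a, b] (EFin \o g).
  apply: continuous_compact_integrable; first exact: segment_compact.
  exact: continuous_pos_within.
have [|c] := @EVT_min _ g a' b' (ltW a'b').
  by apply: continuous_pos_within => //; exact: lt_trans aa'.
rewrite in_itv/= => /andP[ac cb] gc.
have gc0 : 0 < g c by rewrite gpos// (lt_le_trans aa' ac)/= (le_lt_trans cb).
rewrite -lte_fin fineK; last by apply: integrable_fin_num.
apply: (@lt_le_trans _ _ (\int[mu]_(x in `[a', b']) (cst (g c)%:E x))%E).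
  rewrite integral_cst// [X in (_ * X)%E](_ : _ = (b' - a')%:E); last first.
    by rewrite [LHS]lebesgue_measure_itv/= lte_fin a'b' EFinB.
  rewrite -EFinM lte_fin.
  by rewrite mulr_gt0// subr_gt0.
have sub : `[a', b']%classic `<=` `[a, b]%classic.
  by apply: subset_itv; rewrite bnd_simp ltW.
apply: (@le_trans _ _ (\int[mu]_(x in `[a', b']) (g x)%:E)%E).
  apply: ge0_le_integral => //.
  - by move=> x _; rewrite lee_fin ltW.
  - by apply: measurable_funS (measurable_int _ Ig).
apply: ge0_subset_integral => //; exact: measurable_int Ig.
Qed.

Variables (theta n1 n2 zbar : R) (h : R -> R).
Hypotheses (n1_gt1 : 1 < n1) (n2_lt0 : n2 < 0) (zbar_gt0 : 0 < zbar).
Hypothesis ch : forall x : R, 0 < x -> {for x, continuous h}.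
Hypothesis Xh : Xi_converges n1 n2 h.
Hypothesis h_lt0 : forall x, 0 < x < zbar -> h x < 0.
Hypothesis h_gt0 : forall x, zbar < x -> 0 < h x.
Hypothesis h_zbar : h zbar = 0.

Local Notation F := (upper_integral n1 h).
Let w (x : R) : R := x `^ (- n1 - 1) * h x.

Let cw (x : R) : 0 < x -> {for x, continuous w}.
Proof.
by move=> x0; apply: continuousM; [exact: powR_continuous|exact: ch].
Qed.

Let h_le0 x : 0 < x <= zbar -> h x <= 0.
Proof.
move=> /andP[x0]; rewrite le_eqVlt => /predU1P[->|xz]; first by rewrite h_zbar.
by rewrite ltW// h_lt0// x0.
Qed.

Let h_ge0 x : zbar <= x -> 0 <= h x.
Proof.
by rewrite le_eqVlt => /predU1P[<-|/h_gt0/ltW//]; rewrite h_zbar.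
Qed.

Let Iw (a b : R) : 0 < a -> mu.-integrable `[a, b] (EFin \o w).
Proof. by move=> a0; apply: (Xi_converges_itv Xh) => //; left. Qed.

Lemma upper_integral_crossing_gt0 (z : R) : zbar <= z -> 0 < F z.
Proof.
move=> zz; have z0 := lt_le_trans zbar_gt0 zz.
rewrite (upper_integral_split Xh (a := z) (u := z + 1)); last by rewrite z0 lerDl/=.
apply: ltr_wpDr.
  apply: Rintegral_ge0 => x /=; rewrite in_itv/= andbT => zx.
  by rewrite mulr_ge0 ?powR_ge0 ?h_ge0//; move: zz zx; lra.
apply: Rintegral_itv_gt0 => //; first by rewrite ltrDl.
  by move=> x /andP[zx _]; rewrite mulr_ge0 ?powR_ge0 ?h_ge0// (le_trans zz).
move=> x /andP[zx _]; rewrite mulr_gt0 ?h_gt0 ?(le_lt_trans zz)//.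
by rewrite powR_gt0// (lt_trans z0).
Qed.

Lemma upper_integral_crossing_lt (a b : R) : 0 < a -> a < b -> b <= zbar ->
  F a < F b.
Proof.
move=> a0 ab bz.
rewrite (upper_integral_split Xh (a := a) (u := b)); last by rewrite a0 ltW.
rewrite gtrDr -oppr_gt0.
have := @Rintegral_itv_gt0 (fun x => - w x) a b a0 ab.
have -> : \int[mu]_(x in `[a, b]) (- w x) = - \int[mu]_(x in `[a, b]) w x.
  rewrite -[RHS]mulN1r -RintegralZl//; last exact: Iw.
  by apply: eq_Rintegral => x _; exact/esym/mulN1r.
apply.
- by move=> x x0; apply: continuousN; exact: cw.
- move=> x /andP[ax xb]; rewrite oppr_ge0 mulr_ge0_le0 ?powR_ge0// h_le0//.
  by rewrite (lt_le_trans a0 ax) (le_trans xb).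
- move=> x /andP[ax xb]; have x0 := lt_trans a0 ax.
  rewrite oppr_gt0 pmulr_rlt0 ?powR_gt0// h_lt0// x0/=.
  exact: lt_le_trans bz.
Qed.

Lemma upper_integral_crossing_uniq (a b : R) : 0 < a -> 0 < b ->
  F a = 0 -> F b = 0 -> a = b.
Proof.
suff H x y : 0 < x -> F x = 0 -> F y = 0 -> x < y -> False.
  move=> a0 b0 Fa Fb; case: (ltgtP a b) => //.
    by move/(H _ _ a0 Fa Fb).
  by move/(H _ _ b0 Fb Fa).
move=> x0 Fx Fy xy; have [yz|zy] := leP y zbar.
  by have := upper_integral_crossing_lt x0 xy yz; rewrite Fx Fy ltxx.
by have := upper_integral_crossing_gt0 (ltW zy); rewrite Fy ltxx.
Qed.

(** Near 0 the integrand is at most [-c x^(-n1)], not integrable there as [n1 > 1], so [F] takes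
    negative values close to 0; it is positive at [zbar], and continuity gives a zero. *)
Lemma upper_integral_crossing_exists (c delta : R) : 0 < c -> 0 < delta ->
  (forall x, 0 < x < delta -> h x <= - c * x) ->
  exists2 z, 0 < z < zbar & F z = 0.
Proof.
move=> c0 d0 hc; pose e := Num.min delta zbar / 2.
have min0 : 0 < Num.min delta zbar by rewrite lt_min d0 zbar_gt0.
have e0 : 0 < e by rewrite divr_gt0.
have em : e < Num.min delta zbar by rewrite ltr_pdivrMr// ltr_pMr// ltr1n.
have /andP[ed ez] : (e < delta) && (e < zbar) by rewrite -lt_min.
have p0 : 1 - n1 < 0 by rewrite subr_lt0.
have p1 : 0 < n1 - 1 by rewrite subr_gt0.
(* With [z^(1 - n1) = t], the integral of [-c x^(-n1)] over [[z, e]] equals [-(|F e| + 1)], just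
   enough to make [F z] negative. *)
pose t := e `^ (1 - n1) + (`|F e| + 1) * (n1 - 1) / c.
have te : e `^ (1 - n1) < t.
  by rewrite ltrDl divr_gt0// mulr_gt0// ltr_pwDr.
have t0 : 0 < t := lt_trans (powR_gt0 _ e0) te.
pose z := t `^ (1 - n1)^-1.
have z0 : 0 < z by rewrite powR_gt0.
have zt : z `^ (1 - n1) = t by rewrite /z -powRrM mulVf ?lt_eqF// powRr1// ltW.
have ze : z < e.
  rewrite ltNge; apply/negP => /(powR_npos_le (ltW p0) e0).
  by rewrite zt leNgt te.
have Fz : F z < 0.
  rewrite (upper_integral_split Xh (a := z) (u := e)); last by rewrite z0 ltW.
  have Ip : mu.-integrable `[z, e] (EFin \o (fun x => x `^ (1 - n1 - 1))).
    apply: integrableS (integrable_powR_infty p0 (divr_gt0 z0 (ltr0n _ 2))) => //.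
    move=> x /=; rewrite !in_itv/= andbT => /andP[zx _].
    by apply: lt_le_trans zx; rewrite ltr_pdivrMr// ltr_pMr// ltr1n.
  have le1 : \int[mu]_(x in `[z, e]) w x <=
      \int[mu]_(x in `[z, e]) (- c * x `^ (1 - n1 - 1)).
    apply: le_Rintegral => //; first exact: Iw.
      apply: eq_integrable (integrableZl _ (- c) Ip) => //.
    move=> x /=; rewrite in_itv/= => /andP[zx xe].
    have x0 := lt_le_trans z0 zx.
    have -> : x `^ (1 - n1 - 1) = x * x `^ (- n1 - 1).
      have -> : 1 - n1 - 1 = 1 + (- n1 - 1) by ring.
      by rewrite powRD ?(gt_eqF x0) ?implybT// powRr1// ltW.
    rewrite /w mulrA mulrC ler_wpM2r ?powR_ge0// hc// x0/=.
    exact: le_lt_trans ed.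
  have E : \int[mu]_(x in `[z, e]) (- c * x `^ (1 - n1 - 1)) =
      - c * (e `^ (1 - n1) / (1 - n1) - t / (1 - n1)).
    rewrite RintegralZl//; congr (_ * _).
    by rewrite /Rintegral integral_powR ?lt_eqF//= zt.
  have E2 : - c * (e `^ (1 - n1) / (1 - n1) - t / (1 - n1)) = - (`|F e| + 1).
    rewrite /t; field.
    by rewrite (gt_eqF c0)/= lt_eqF.
  apply: (@le_lt_trans _ _ (- (`|F e| + 1) + F e)); last first.
    by rewrite addrC subr_lt0 (le_lt_trans (ler_norm _))// ltrDl.
  by rewrite lerD2r -E2 -E; exact: le1.
have [||x] := @IVT _ F z zbar 0 (ltW (lt_trans ze ez)).
- apply: continuous_pos_within => // x x0.
  exact: (upper_integral_continuous Xh).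
- have Fzb := upper_integral_crossing_gt0 (lexx zbar).
  by rewrite ge_min (ltW Fz) le_max (ltW Fzb) orbT.
rewrite in_itv/= => /andP[zx xzb] Fx; exists x => //.
rewrite (lt_le_trans z0 zx)/= lt_neqAle xzb andbT; apply/eqP => xE.
by have := upper_integral_crossing_gt0 (lexx zbar); rewrite -xE Fx ltxx.
Qed.

(** Up to a positive factor the value is [L + x^(n1 - n2) F x], where [L] integrates
    [nu^(n1 - n2) w nu] over [[z, x]]. Since [F z = 0], the integral of [w] alone is [-F x].
    Freezing the weight at [m] lowers the integral, so [L >= -m^(n1 - n2) F x], and the conclusion
    follows from [m <= x] and [F x >= 0]. *)
Lemma crossing_value_ge0 (z x : R) : theta != 0 -> 0 < z < zbar -> F z = 0 ->
  z <= x -> 0 <= homogeneous_coef theta n1 n2 h z * x `^ n2 + Xi theta n1 n2 h x.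
Proof.
move=> theta0 /andP[z0 zz] Fz zx; have x0 := lt_le_trans z0 zx.
have n12 : 0 < n1 - n2 by move: n1_gt1 n2_lt0; lra.
have Fsplit := upper_integral_split Xh (a := z) (u := x).
rewrite z0 zx Fz in Fsplit; have {}Fsplit := Fsplit isT.
have Fx0 : 0 <= F x.
  have [xzb|/ltW xz] := leP x zbar; last by rewrite ltW// upper_integral_crossing_gt0.
  move: zx; rewrite le_eqVlt => /predU1P[<-|zx]; first by rewrite Fz.
  by rewrite -Fz ltW// upper_integral_crossing_lt.
have pw a b : 0 < a -> a <= b -> a `^ (n1 - n2) <= b `^ (n1 - n2).
  move=> a0 ab; apply: ge0_ler_powR => //; rewrite ?nnegrE ?ltW//.
  exact: lt_le_trans ab.
pose L := lower_integral n2 h x - lower_integral n2 h z.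
have LE : L = \int[mu]_(nu in `[z, x]) (nu `^ (- n2 - 1) * h nu).
  rewrite /L (lower_integral_split Xh (a := z) (u := x)) ?z0 ?zx//.
  by rewrite addrAC subrr add0r.
(* [nu ^ (n1 - n2) - m ^ (n1 - n2)] and [h nu] have the same sign for nu <= x. *)
pose m := Num.min x zbar.
have m0 : 0 < m by rewrite lt_min x0 zbar_gt0.
have Lm : - (m `^ (n1 - n2) * F x) <= L.
  have -> : - (m `^ (n1 - n2) * F x) = m `^ (n1 - n2) * \int[mu]_(nu in `[z, x]) w nu.
    by rewrite -mulrN; congr (_ * _); apply/eqP; rewrite eq_sym -addr_eq0 -Fsplit.
  rewrite LE -RintegralZl; [|exact: measurable_itv|exact: Iw].
  apply: le_Rintegral => //.
  - by apply: eq_integrable (integrableZl _ (m `^ (n1 - n2)) (Iw x z0)) => //.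
  - by apply: (Xi_converges_itv Xh) => //; right.
  move=> nu /=; rewrite in_itv/= => /andP[znu nux].
  have nu0 := lt_le_trans z0 znu.
  have -> : nu `^ (- n2 - 1) * h nu = nu `^ (n1 - n2) * w nu.
    rewrite /w mulrA -powRD ?(gt_eqF nu0) ?implybT//; congr (_ `^ _ * _); ring.
  have [nz|zn] := leP nu zbar.
    apply: ler_wnM2r.
      by rewrite mulr_ge0_le0 ?powR_ge0// h_le0// nu0.
    by apply: pw => //; rewrite le_min nux nz.
  apply: ler_wpM2r; first by rewrite mulr_ge0 ?powR_ge0 ?h_ge0// ltW.
  by apply: pw => //; rewrite ge_min (ltW zn) orbT.
have mx : m `^ (n1 - n2) <= x `^ (n1 - n2).
  by apply: pw => //; rewrite ge_min lexx.
have key : 0 <= L + x `^ (n1 - n2) * F x.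
  have := ler_wpM2r Fx0 mx; move: Lm; lra.
have K0 : 0 <= 2 / (theta ^+ 2 * (n1 - n2)).
  by rewrite divr_ge0// mulr_ge0 ?sqr_ge0// ltW.
have xE : x `^ n1 = x `^ n2 * x `^ (n1 - n2).
  by rewrite -powRD ?(gt_eqF x0) ?implybT// addrC subrK.
have -> : homogeneous_coef theta n1 n2 h z * x `^ n2 + Xi theta n1 n2 h x =
    2 / (theta ^+ 2 * (n1 - n2)) * (x `^ n2 * (L + x `^ (n1 - n2) * F x)).
  by rewrite /homogeneous_coef /Xi xE /L; ring.
apply: mulr_ge0 => //; apply: mulr_ge0 => //; exact: powR_ge0.
Qed.

End single_crossing.

(** * The running reward of labor *)

Section labor.
Context {R : realType}.
Notation mu := (@lebesgue_measure R).
Variables (n1 n2 eps : R) (DB DA : set R) (uB uA : R -> R).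
Hypotheses (uB_class : utility_class n2 DB uB) (uA_class : utility_class n2 DA uA).

Local Notation h := (labor_flow uB uA eps).
Local Notation Psi := (Psi uB uA eps).

Lemma labor_flowE (x : R) : 0 < x -> h x = Psi x * x.
Proof. by move=> x0; rewrite /labor_flow /Defs.Psi; field; rewrite gt_eqF. Qed.

Lemma labor_flow_continuous (x : R) : 0 < x -> {for x, continuous h}.
Proof.
move=> x0; apply: continuousD.
  apply: continuousB; first exact: (conjugate_continuous uB_class).
  exact: (conjugate_continuous uA_class).
by apply: continuousM; [exact: cvg_id|exact: cst_continuous].
Qed.

(** Besides the two conjugates there is the linear term, which contributes [x^(-n2)] near 0 and
    [x^(-n1)] at infinity; the latter is integrable because [n1 > 1]. *)
Lemma Xi_converges_labor_flow : 1 < n1 -> n2 < 0 -> Xi_converges n1 n2 h.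
Proof.
move=> n1_gt1 n2_lt0.
have cB := Xi_converges_conjugate n1_gt1 n2_lt0 uB_class.
have cA := Xi_converges_conjugate n1_gt1 n2_lt0 uA_class.
have aux (D : set R) (p : R) : measurable D -> D `<=` `]0, +oo[%classic ->
    mu.-integrable D (fun x => (x `^ (p - 1) * conjugate uB x)%:E) ->
    mu.-integrable D (fun x => (x `^ (p - 1) * conjugate uA x)%:E) ->
    mu.-integrable D (EFin \o (fun x => x `^ (1 + p - 1))) ->
    mu.-integrable D (fun x => (x `^ (p - 1) * h x)%:E).
  move=> mD D0 IB IA Ip.
  have := integrableD _ (integrableB _ IB IA) (integrableZr _ eps Ip).
  move=> /(_ mD mD mD); apply: eq_integrable => // x; rewrite inE => /D0/=; rewrite in_itv/= andbT => x0.
  have -> : x `^ (1 + p - 1) = x * x `^ (p - 1).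
    by rewrite -addrA [LHS]powRD ?(gt_eqF x0) ?implybT// powRr1// ltW.
  rewrite -EFinM -EFinB -EFinD; congr EFin; rewrite /labor_flow; ring.
move=> y y0; have [lB upB] := cB y y0; have [lA upA] := cA y y0; split.
  apply: aux => //.
    by move=> x /=; rewrite !in_itv/= => /andP[->].
  by apply: integrable_powR_near0 => //; rewrite subr_gt0 (lt_trans n2_lt0).
apply: aux => //.
  by move=> x /=; rewrite !in_itv/= !andbT; exact: lt_trans.
by apply: integrable_powR_infty => //; rewrite subr_lt0.
Qed.

Hypothesis uB_lt_uA : forall y, 0 < y ->
  (utility_value uB (inverse_marginal uB y)
   < utility_value uA (inverse_marginal uA y))%E.

(** In the derivative of a conjugate divided by [t], the two terms containing [I] cancel, leaving
    minus the utility at the maximizer over [t^2]. *)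
Lemma Psi_increasing (x y : R) : 0 < x -> x < y -> Psi x < Psi y.
Proof.
move=> x0 xy.
have dPsi (t : R) : 0 < t -> is_derive t (1 : R) Psi
    ((utility_at_inverse uA t - utility_at_inverse uB t) / t ^+ 2).
  move=> t0; have dB := is_derive_conjugate uB_class t0.
  have dA := is_derive_conjugate uA_class t0.
  have tn0 : t != 0 by rewrite gt_eqF.
  have dV : is_derive t (1 : R) (fun x : R => x^-1) (- t ^- 2).
    apply: DeriveDef; first by apply: derivableV.
    by rewrite deriveV// derive_id [_ *: _]mulr1.
  have -> : Psi = (conjugate uB - conjugate uA) * (fun x : R => x^-1) + cst eps by [].
  have dd := is_deriveD (is_deriveM (is_deriveB dB dA) dV) (is_derive_cst eps t (1 : R)).
  apply: (is_derive_eq dd).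
  have E : (conjugate uB - conjugate uA) t = conjugate uB t - conjugate uA t by [].
  rewrite E (conjugateE uB_class t0) (conjugateE uA_class t0) /GRing.scale/=.
  by field.
have cPsi (t : R) : 0 < t -> {for t, continuous Psi}.
  move=> t0; apply: differentiable_continuous; apply/derivable1_diffP.
  by have [] := dPsi t t0.
apply: (@gtr0_derive1_lt_cc _ Psi x y).
- move=> t; rewrite in_itv/= => /andP[xt _].
  by have [] := dPsi t (lt_trans x0 xt).
- move=> t; rewrite in_itv/= => /andP[xt _]; have t0 := lt_trans x0 xt.
  rewrite derive1E; have [_ ->] := dPsi t t0.
  rewrite divr_gt0 ?exprn_gt0// subr_gt0 -lte_fin.
  rewrite -(utility_value_inverse uB_class t0) -(utility_value_inverse uA_class t0).
  exact: uB_lt_uA.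
- exact: continuous_pos_within.
- by rewrite in_itv/= lexx ltW.
- by rewrite in_itv/= lexx ltW.
- exact: xy.
Qed.

End labor.

(** * Optimal retirement *)

Section restriction.
Context {R : realType}.
Notation mu := (@lebesgue_measure R).
Variables (theta n1 n2 : R) (h : R -> R).

(** The reward has no meaning off the positive axis, while the general results ask for measurability
    on the whole line. As the dual process is positive, extending by zero leaves the stopped values
    and the optimal value unchanged. *)
Definition flow_on_pos : R -> R := h \_ `]0, +oo[.
Local Notation f := flow_on_pos.

Lemma flow_on_posE x : 0 < x -> f x = h x.
Proof. by move=> x0; rewrite /f patchE mem_set//= in_itv/= x0. Qed.

Lemma measurable_flow_on_pos :
  (forall x : R, 0 < x -> {for x, continuous h}) -> measurable_fun setT f.
Proof.
by move=> ch; apply/(measurable_restrictT h _) => //; exact: continuous_pos_measurable.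
Qed.

Lemma lower_integral_on_pos y : lower_integral n2 f y = lower_integral n2 h y.
Proof.
apply: eq_Rintegral => x; rewrite inE/= in_itv/= => /andP[x0 _].
by rewrite flow_on_posE.
Qed.

Lemma upper_integral_on_pos y : 0 < y ->
  upper_integral n1 f y = upper_integral n1 h y.
Proof.
move=> y0; apply: eq_Rintegral => x; rewrite inE/= in_itv/= andbT => yx.
by rewrite flow_on_posE// (lt_trans y0).
Qed.

Lemma Xi_on_pos y : 0 < y -> Xi theta n1 n2 f y = Xi theta n1 n2 h y.
Proof.
by move=> y0; rewrite /Xi lower_integral_on_pos upper_integral_on_pos.
Qed.

Lemma Xi_converges_on_pos : Xi_converges n1 n2 h -> Xi_converges n1 n2 f.
Proof.
move=> ch y y0; have [I1 I2] := ch y y0; split.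
  apply: eq_integrable I1 => // x; rewrite inE/= in_itv/= => /andP[x0 _].
  by rewrite flow_on_posE.
apply: eq_integrable I2 => // x; rewrite inE/= in_itv/= andbT => yx.
by rewrite flow_on_posE// (lt_trans y0).
Qed.

Lemma stopped_value_on_pos (d : measure_display) (Omega : measurableType d)
    (P : probability Omega R) (B : R -> Omega -> R) (r rho y : R) tau : 0 < y ->
  stopped_value P B r rho theta f y tau = stopped_value P B r rho theta h y tau.
Proof.
move=> y0; apply: eq_integral => w _; apply: eq_integral => t _.
by rewrite flow_on_posE// dual_process_gt0.
Qed.

Lemma optimal_value_on_pos (d : measure_display) (Omega : measurableType d)
    (P : probability Omega R) (B : R -> Omega -> R) (r rho y : R) : 0 < y ->
  optimal_value P B r rho theta f y = optimal_value P B r rho theta h y.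
Proof.
move=> y0; have E : stopped_value P B r rho theta f y =
    stopped_value P B r rho theta h y.
  by apply/funext => tau; exact: stopped_value_on_pos.
by rewrite /optimal_value E.
Qed.

End restriction.

(** The equation can be rewritten as [(n1 - 1) (theta^2 n1 / 2 + rho) = r n1], whose right side and
    second factor are positive. *)
Lemma root_gt1 (R : realType) (r rho theta n1 : R) : 0 < r -> 0 < rho -> 0 < n1 ->
  theta ^+ 2 / 2 * n1 ^+ 2 + (rho - r - theta ^+ 2 / 2) * n1 - rho = 0 -> 1 < n1.
Proof.
move=> r0 rho0 n0 E; have c0 : 0 < theta ^+ 2 / 2 * n1 + rho.
  by rewrite ltr_wpDl// mulr_ge0 ?divr_ge0 ?sqr_ge0// ltW.
have : 0 < (n1 - 1) * (theta ^+ 2 / 2 * n1 + rho).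
  have -> : (n1 - 1) * (theta ^+ 2 / 2 * n1 + rho) = r * n1.
    by apply/eqP; rewrite -subr_eq0 -E; apply/eqP; ring.
  exact: mulr_gt0.
by rewrite pmulr_lgt0// subr_gt0.
Qed.

Theorem proposition3p3 (R : realType) (d : measure_display)
    (Omega : measurableType d) (P : probability Omega R) (B : R -> Omega -> R)
    (r rho mu sigma eps theta n1 n2 zbar : R)
    (DB DA : set R) (uB uA : R -> R) (Psi0 : \bar R)
    (r_gt0 : 0 < r) (rho_gt0 : 0 < rho) (mu_gt0 : 0 < mu)
    (sigma_gt0 : 0 < sigma) (eps_gt0 : 0 < eps) (mu_neq_r : mu != r)
    (thetaE : theta = (mu - r) / sigma)
    (BM : standard_brownian_motion P B)
    (n1_gt0 : 0 < n1)
    (n1_root : theta ^+ 2 / 2 * n1 ^+ 2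
               + (rho - r - theta ^+ 2 / 2) * n1 - rho = 0)
    (n2_lt0 : n2 < 0)
    (n2_root : theta ^+ 2 / 2 * n2 ^+ 2
               + (rho - r - theta ^+ 2 / 2) * n2 - rho = 0)
    (uB_class : utility_class n2 DB uB) (uA_class : utility_class n2 DA uA)
    (uB_lt_uA : forall y, 0 < y ->
       (utility_value uB (inverse_marginal uB y)
        < utility_value uA (inverse_marginal uA y))%E)
    (Psi_at0 : (Psi uB uA eps y)%:E @[y --> 0^'+] --> Psi0)
    (Psi0_lt0 : (Psi0 < 0)%E)
    (zbar_gt0 : 0 < zbar) (Psi_zbar : Psi uB uA eps zbar = 0) :
  let h := labor_flow uB uA eps in
  Xi_converges n1 n2 h /\
  exists zR : R,
    [/\ 0 < zR < zbar,
        upper_integral n1 h zR = 0,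
        forall z, 0 < z -> upper_integral n1 h z = 0 -> z = zR &
        forall y, 0 < y ->
          [/\ zR <= y -> optimal_value P B r rho theta h y =
                (homogeneous_coef theta n1 n2 h zR * y `^ n2
                 + Xi theta n1 n2 h y)%:E,
              y <= zR -> optimal_value P B r rho theta h y = 0%E,
              stopping_time P B (hitting_time B r rho theta zR y) &
              optimal_value P B r rho theta h y =
                stopped_value P B r rho theta h y
                  (hitting_time B r rho theta zR y)]].
Proof.
move=> h.
have n1_gt1 := root_gt1 r_gt0 rho_gt0 n1_gt0 n1_root.
have theta0 : theta != 0.
  by rewrite thetaE mulf_neq0 ?subr_eq0// invr_eq0 gt_eqF.
have Xh : Xi_converges n1 n2 h by apply: Xi_converges_labor_flow uB_class uA_class _ _.
have ch (x : R) : 0 < x -> {for x, continuous h}.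
  exact: (labor_flow_continuous uB_class uA_class).
have incr (x y : R) : 0 < x -> x < y -> Psi uB uA eps x < Psi uB uA eps y.
  exact: (Psi_increasing eps uB_class uA_class uB_lt_uA).
have h_lt0 x : 0 < x < zbar -> h x < 0.
  move=> /andP[x0 xz]; rewrite /h labor_flowE// nmulr_rlt0// -Psi_zbar.
  exact: incr.
have h_gt0 x : zbar < x -> 0 < h x.
  move=> xz; have x0 := lt_trans zbar_gt0 xz.
  by rewrite /h labor_flowE// mulr_gt0// -Psi_zbar incr.
have h_zbar : h zbar = 0 by rewrite /h labor_flowE// Psi_zbar mul0r.
have z2 : 0 < zbar / 2 by rewrite divr_gt0.
have z2z : zbar / 2 < zbar by rewrite ltr_pdivrMr// ltr_pMr// ltr1n.
(* On []0, zbar / 2[] monotonicity bounds [Psi] by its negative value at [zbar / 2], which supplies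
   the slope [-c] needed for the existence of the threshold. *)
have c0 : 0 < - Psi uB uA eps (zbar / 2) by rewrite oppr_gt0 -Psi_zbar incr.
have near0 x : 0 < x < zbar / 2 -> h x <= - - Psi uB uA eps (zbar / 2) * x.
  move=> /andP[x0 xz]; rewrite /h labor_flowE// opprK ler_wpM2r ?ltW//.
  exact: incr.
have [zR zRz FzR] := upper_integral_crossing_exists n1_gt1 zbar_gt0 ch Xh h_gt0
  h_zbar c0 z2 near0.
have /andP[zR0 zR_lt] := zRz.
split => //; exists zR; split => //.
  by move=> z z0 Fz; apply: (upper_integral_crossing_uniq zbar_gt0 ch Xh h_lt0 h_gt0
    h_zbar).
move=> y y0; pose f := flow_on_pos h.
have mf : measurable_fun setT f := measurable_flow_on_pos ch.
have Xf : Xi_converges n1 n2 f := Xi_converges_on_pos Xh.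
have FfR : upper_integral n1 f zR = 0 by rewrite upper_integral_on_pos.
have rho0 := ltW rho_gt0.
have stopped := stopped_value_hitting BM theta0 n1_gt0 n2_lt0 n1_root n2_root y0
  mf Xf zR0 rho0 FfR.
have opt : optimal_value P B r rho theta f y = (Xi theta n1 n2 (flow_above f zR) y)%:E.
  apply: (optimal_value_hitting BM theta0 n1_gt0 n2_lt0 n1_root n2_root y0
    mf Xf zR0 rho0 FfR).
    move=> x /andP[x0 xz]; rewrite /f flow_on_posE// ltW// h_lt0// x0/=.
    exact: le_lt_trans zR_lt.
  move=> x zx; have x0 := lt_le_trans zR0 zx.
  rewrite /homogeneous_coef lower_integral_on_pos Xi_on_pos//.
  exact: (crossing_value_ge0 n1_gt1 n2_lt0 zbar_gt0 ch Xh h_lt0 h_gt0 h_zbar).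
rewrite -optimal_value_on_pos// opt; split.
- move=> zy; rewrite Xi_above_ge// Xi_on_pos// /homogeneous_coef.
  by rewrite lower_integral_on_pos.
- by move=> yz; rewrite Xi_above_le ?y0.
- exact: (hitting_time_stopping BM).
- rewrite -(stopped_value_on_pos theta h P B r rho _ y0); exact: esym stopped.
Qed.
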